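(* The rotational symmetry group $T\subset O(3)$ of the regular tetrahedron centered at the origin, in its standard action on $\mathbb{R}^3$, has property $(\mathcal{B}_6)$.
   Context: For an orthogonal representation $G\to O(V)$ of a finite group, let $\sigma_1,\ldots,\sigma_m$ be homogeneous generators of positive degree of the algebra $\mathbb{R}[V]^G$ of invariant polynomials and $\sigma=(\sigma_1,\ldots,\sigma_m):V\to\mathbb{R}^m$ the orbit map; $V/G$ is identified with $\sigma(V)\subseteq\mathbb{R}^m$ via the homeomorphism induced by $\sigma$. A curve in $V/G$ is of class $C^k$ if it is $C^k$ as a curve in $\mathbb{R}^m$ (independent of the choice of generators). A lift of a curve $c$ in $\sigma(V)$ is a curve $\bar c$ in $V$ with $\sigma\circ\bar c=c$; a local lift near $t_0$ is a lift of the restriction of $c$ to an open neighborhood of $t_0$. A differentiable lift has locally bounded derivative if $\|\bar c'\|$ is bounded on compact subsets of its domain. The representation has property $(\mathcal{B}_k)$ if there exists a neighborhood $U$ of $0$ in $V/G=\sigma(V)$ such that each $C^k$-curve in $U$ admits (near each parameter value) a local differentiable lift to $V$ with locally bounded derivative. *)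

(* Defs.v *)
From HB Require Import structures.
From mathcomp Require Import all_boot all_order all_algebra.
(* The notations of [mpoly] clash with those of the analysis library. *)
From mathcomp Require Import -(notations) mpoly.
From mathcomp Require Import all_classical all_reals all_analysis.

Set Implicit Arguments.
Unset Strict Implicit.
Unset Printing Implicit Defensive.

Import Order.TTheory GRing.Theory Num.Theory numFieldNormedType.Exports.

Local Open Scope classical_set_scope.
Local Open Scope ring_scope.

(* The canonical norm `| _ | on matrices is the sup norm. *)
Definition enorm (R : realType) (n : nat) (v : 'cV[R]_n) : R :=
  Num.sqrt (\sum_(i < n) v i 0 ^+ 2).

(* The curve f, restricted to the open set I, is of class C^k; the values of f
   outside I are irrelevant because I is open. *)
Definition class_C (R : realType) (V : normedModType R) (k : nat)
    (I : set R) (f : R -> V) : Prop :=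
  (forall i : nat, (i < k)%N -> forall t : R, I t -> derivable (f^`(i))%classic t 1)
  /\ (forall t : R, I t -> {for t, continuous (f^`(k))%classic}).

Section OrbitSpace.
Variables (R : realType) (n : nat).

Definition peval (p : mpoly n R) (v : 'cV[R]_n) : R :=
  meval (fun i => v i 0) p.

(* Here and below a representation on R^n is given by its image G, on which
   all the notions considered depend.  Polynomials are identified with
   polynomial functions, R being infinite. *)
Definition invariant_poly (G : set 'M[R]_n) (p : mpoly n R) : Prop :=
  forall A : 'M[R]_n, G A -> forall v : 'cV[R]_n, peval p (A *m v) = peval p v.

Definition homogeneous_generators (G : set 'M[R]_n) (m : nat)
    (sigma : m.-tuple (mpoly n R)) : Prop :=
  [/\ forall j : 'I_m, invariant_poly G (tnth sigma j),
      forall j : 'I_m, exists2 d : nat, (0 < d)%N &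
        tnth sigma j \is ishomog1 d (@mdeg n)
    & forall p : mpoly n R, invariant_poly G p ->
        exists q : mpoly m R, p = comp_mpoly sigma q].

Definition orbit_map (m : nat) (sigma : m.-tuple (mpoly n R))
    (v : 'cV[R]_n) : 'cV[R]_m :=
  \col_(j < m) peval (tnth sigma j) v.

Definition orbit_space (m : nat) (sigma : m.-tuple (mpoly n R)) :
    set 'cV[R]_m :=
  range (orbit_map sigma).

Definition is_lift (m : nat) (sigma : m.-tuple (mpoly n R)) (J : set R)
    (c : R -> 'cV[R]_m) (cbar : R -> 'cV[R]_n) : Prop :=
  forall t : R, J t -> orbit_map sigma (cbar t) = c t.

Definition differentiable_curve (J : set R) (f : R -> 'cV[R]_n) : Prop :=
  forall t : R, J t -> derivable f t 1.

Definition locally_bounded_derivative (J : set R) (f : R -> 'cV[R]_n) : Prop :=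
  forall K : set R, compact K -> K `<=` J ->
    exists M : R, forall t : R, K t -> enorm ((f^`())%classic t) <= M.

(* Property (B_k).  By Hilbert's finiteness theorem a finite group has systems
   of homogeneous generators; the property is required for each of them.
   [within (orbit_space sigma) (nbhs 0)] is the filter of neighbourhoods of 0
   for the subspace topology of the orbit space. *)
Definition property_B (G : set 'M[R]_n) (k : nat) : Prop :=
  forall (m : nat) (sigma : m.-tuple (mpoly n R)),
    homogeneous_generators G sigma ->
  exists U : set 'cV[R]_m,
    [/\ U `<=` orbit_space sigma,
        within (orbit_space sigma) (nbhs (0 : 'cV[R]_m)) U
      & forall (I : set R) (c : R -> 'cV[R]_m),
          open I -> is_interval I -> class_C k I c ->
          (forall t : R, I t -> U (c t)) ->
        forall t0 : R, I t0 ->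
          exists (J : set R) (cbar : R -> 'cV[R]_n),
            [/\ open J, J t0, J `<=` I, is_lift sigma J c cbar
              & differentiable_curve J cbar /\
                locally_bounded_derivative J cbar]].

End OrbitSpace.

(* [w] lists the vertices of a (nondegenerate) regular tetrahedron centered at
   the origin. *)
Definition regular_tetrahedron (R : realType) (w : 'I_4 -> 'cV[R]_3) : Prop :=
  (exists2 l : R, 0 < l & forall i j : 'I_4, i != j -> enorm (w i - w j) = l)
  /\ \sum_(i < 4) w i = 0.

(* The solid with vertices [w]: their convex hull. *)
Definition tetrahedron (R : realType) (w : 'I_4 -> 'cV[R]_3) : set 'cV[R]_3 :=
  [set x | exists a : 'I_4 -> R,
     [/\ forall i : 'I_4, 0 <= a i, \sum_(i < 4) a i = 1
       & x = \sum_(i < 4) a i *: w i]].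

Definition rotation_group (R : realType) (S : set 'cV[R]_3) : set 'M[R]_3 :=
  [set A | [/\ A *m A^T = 1%:M, \det A = 1 & (fun x => A *m x) @` S = S]].

(* Main.v *)
Require Import Defs.
From HB Require Import structures.
From mathcomp Require Import all_boot all_order all_algebra all_fingroup.
From mathcomp Require Import -(notations) mpoly.
From mathcomp Require Import all_classical all_reals all_analysis.
From mathcomp Require Import ring lra zify.

(** In coordinates along the three axes through the midpoints of opposite edges,
    the rotations of the tetrahedron are the even sign changes composed with the
    cyclic permutations.  With [X, Y, Z] the squares of the coordinates [x, y, z]
    and [w = X + exp(2 i pi / 3) Y + exp(4 i pi / 3) Z], the invariants
    [x^2 + y^2 + z^2], [x y z], [|w|^2] and the two components of [w^3], of
    degrees 2, 3, 4, 6 and 6, separate the orbits ([tet_separates]).  They are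
    polynomials in any system of generators, so along a curve of class C^6 in
    the orbit space they are functions of class C^6 ([regular_invariant]); an
    invariant of degree [d] enters through its derivatives up to the order [d].

    Existence of a differentiable lift ([tet_lift]).  For a finite linear group
    it suffices to lift locally away from the zero orbit, provided that every
    invariant of degree [d] is equivalent to a multiple of [(s - t)^d] at the
    parameters [t] where the curve is zero ([differentiable_lift]).  Indeed, at
    such a parameter the orbits are close to those of [(s - t) l] for some [l].
    If [l <> 0], a lift on each side has a one-sided derivative in the orbit of
    [l], by connectedness, and the group matches the two; if [l = 0], any lift
    that takes the value zero there has derivative zero.  The hypothesis holds
    for invariants of class C^d dominated by the norm to the power [d].  This
    principle is applied to three groups: to the rotation of order three of the
    plane of [w], where complex cube roots give the local lifts ([rot_lift]) and
    which makes [X, Y, Z] differentiable ([sq_dif_base]); to the sign change of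
    a plane, which is the slice representation on the axes of order two
    ([liftable_one]); and to the tetrahedral group.  A nonzero vector outside
    these axes has two nonzero coordinates, and a local lift is then explicit
    ([liftable_two]).

    Boundedness of the derivative ([lift_derivative_bound]).  The derivative of a
    lift is bounded in terms of the derivatives of the invariants.  If [v t] is
    at the distance [rho > 0] from the origin, the curve [v (t + rho s) / rho] of
    parameter [s] has the same derivative at [0] and starts on the unit sphere,
    and its invariant of degree [d] has a bounded [d]th derivative; being bounded
    as well, this invariant has all its lower derivatives bounded, by
    interpolation ([interpolation]).  For such normalised curves, interpolation
    at the scale of [|w|] bounds [w'] ([cube_root_derive_bound]), which settles
    the points with two large coordinates ([bound_two]), and Glaeser's inequality
    for the nonnegative function [X Y + Y Z + Z X] settles the points close to an
    axis ([bound_one]). *)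

Set Implicit Arguments.
Unset Strict Implicit.
Unset Printing Implicit Defensive.

Import Order.TTheory GRing.Theory Num.Theory numFieldNormedType.Exports.

Local Open Scope classical_set_scope.
Local Open Scope ring_scope.

(** * Derivatives of functions of one variable *)

Section Derivatives.
Variable R : realType.

Lemma is_derive_nearP (V : normedModType R) (f : R -> V) (t : R) (d : V) :
  is_derive t 1 f d <->
  forall e : R, 0 < e -> \forall s \near t,
    `|f s - f t - (s - t) *: d| <= e * `|s - t|.
Proof.
have shiftE (P : R -> Prop) : (\forall s \near t, P s) <-> \forall h \near 0, P (h + t).
  rewrite (near_shift 0 t) /=; split; apply: filterS => x /=; by rewrite subr0.
have key e h : h != 0 ->
    (`|d - h^-1 *: (f (h *: 1 + t) - f t)| <= e) =
    (`|f (h + t) - f t - (h + t - t) *: d| <= e * `|h + t - t|).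
  move=> h0; have nh : 0 < `|h| by rewrite normr_gt0.
  rewrite addrK.
  have -> : h *: (1 : R) = h by rewrite /GRing.scale/= mulr1.
  have -> : f (h + t) - f t - h *: d = (- h) *: (d - h^-1 *: (f (h + t) - f t)).
    by rewrite scalerBr scalerA mulNr mulfV // !scaleNr scale1r opprK addrC.
  by rewrite normrZ normrN [e * _]mulrC ler_pM2l.
split.
- case=> dfl dE e e0.
  have : (fun h => h^-1 *: ((f \o shift t) (h *: 1) - f t)) @ 0^' --> d.
    by rewrite -dE; exact: dfl.
  move=> /cvgrPdist_le/(_ e e0) H.
  apply/shiftE; move: H; rewrite /dnbhs !near_withinE.
  apply: filterS => h H.
  have [->|h0] := eqVneq h 0.
    by rewrite add0r !subrr scale0r subrr !normr0 mulr0.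
  by rewrite -key //; apply: H.
- move=> H.
  have cv : (fun h => h^-1 *: ((f \o shift t) (h *: 1) - f t)) @ 0^' --> d.
    apply/cvgrPdist_le => e e0.
    move/shiftE: (H e e0); rewrite /dnbhs !near_withinE.
    by apply: filterS => h Hh h0; rewrite /= key.
  split; first by apply/cvg_ex; exists d.
  by apply/cvg_lim.
Qed.

Lemma near_ballP (t : R) (P : R -> Prop) :
  (\forall s \near t, P s) <-> exists2 r : R, 0 < r & forall s, `|s - t| < r -> P s.
Proof.
split=> [/nbhs_ballP[r /= r0 H]|[r r0 H]].
  by exists r => // s st; apply: H; rewrite /ball /= distrC.
by apply/nbhs_ballP; exists r => //= s; rewrite /ball /= distrC => /H.
Qed.

Lemma nearI (t : R) (P Q : R -> Prop) : (\forall s \near t, P s) ->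
  (\forall s \near t, Q s) -> \forall s \near t, P s /\ Q s.
Proof. by move=> HP HQ; apply: filterI. Qed.

Lemma is_derive_continuous (V : normedModType R) (f : R -> V) (t : R) (d : V) :
  is_derive t 1 f d -> {for t, continuous f}.
Proof.
by case=> df _; apply: differentiable_continuous; apply/derivable1_diffP.
Qed.

Lemma is_derive_ext (V : normedModType R) (f g : R -> V) (t : R) (d d' : V) :
  (\forall s \near t, f s = g s) -> d = d' ->
  is_derive t 1 f d -> is_derive t 1 g d'.
Proof. by move=> fg <-; exact: near_eq_is_derive. Qed.

Lemma is_derive_unique (V : normedModType R) (f : R -> V) (t : R) (d d' : V) :
  is_derive t 1 f d -> is_derive t 1 f d' -> d = d'.
Proof. by move=> [_ <-] [_ <-]. Qed.

Lemma norm_derive_le (V : normedModType R) (f : R -> V) (t C : R) (d : V) :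
  is_derive t 1 f d -> f t = 0 -> (\forall s \near t, `|f s| <= C * `|s - t|) ->
  `|d| <= C.
Proof.
move=> /is_derive_nearP H f0 Hb; apply/ler_addgt0Pr => e e0.
have : \forall s \near t, `|s - t| * `|d| <= (C + e) * `|s - t|.
  near=> s.
  have h1 : `|f s - f t - (s - t) *: d| <= e * `|s - t| by near: s; exact: H.
  have h2 : `|f s| <= C * `|s - t| by near: s.
  rewrite f0 subr0 in h1.
  rewrite -normrZ mulrDl -[_ *: d](subKr (f s)).
  by rewrite (le_trans (ler_normB _ _)) ?lerD.
move=> /near_ballP[r r0 /(_ (t + r / 2))].
have -> : t + r / 2 - t = r / 2 by ring.
rewrite gtr0_norm ?divr_gt0 // [_ * `|d|]mulrC ler_pM2r ?divr_gt0 //; apply; lra.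
Unshelve. all: by end_near. Qed.

Definition between (x y z : R) : Prop := Num.min x y <= z <= Num.max x y.

Lemma mvt_between (f df : R -> R) (x y : R) :
  (forall z, between x y z -> is_derive z 1 f (df z)) ->
  exists2 c, between x y c & f y - f x = df c * (y - x).
Proof.
rewrite /between => H; have [xy|yx] := leP x y.
  have [||c cxy E] := @MVT_segment R f df x y xy.
  - move=> z; rewrite in_itv /= => /andP[a b]; apply: H.
    by rewrite min_l // max_r // !ltW.
  - apply: derivable_within_continuous => z; rewrite in_itv /= => zxy.
    by have [] := H z; rewrite ?min_l ?max_r.
  by exists c => //; move: cxy; rewrite in_itv.
have [||c cxy E] := @MVT_segment R f df y x (ltW yx).
- move=> z; rewrite in_itv /= => /andP[a b]; apply: H.
  by rewrite min_r ?max_l // !ltW.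
- apply: derivable_within_continuous => z; rewrite in_itv /= => zxy.
  by have [] := H z; rewrite ?min_r ?max_l // ltW.
exists c; first by move: cxy; rewrite in_itv.
by rewrite -opprB E; ring.
Qed.

Lemma between_dist (t s z : R) : between t s z -> `|z - t| <= `|s - t|.
Proof.
rewrite /between; have [ts|st] := leP t s => /andP[a b].
  by rewrite !ger0_norm; lra.
by rewrite !ler0_norm; lra.
Qed.

Lemma mvt_dist (f df : R -> R) (t r M : R) :
  (forall s, `|s - t| <= r -> is_derive s 1 f (df s)) ->
  (forall s, `|s - t| <= r -> `|df s| <= M) ->
  forall s, `|s - t| <= r -> `|f s - f t| <= M * `|s - t|.
Proof.
move=> H HM s sr.
have [z /between_dist zts|c /between_dist cts ->] := @mvt_between f df t s.
  by apply: H; apply: le_trans sr.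
by rewrite normrM ler_wpM2r // HM // (le_trans cts).
Qed.

Lemma taylor2 (f f1 f2 : R -> R) (t r M : R) :
  (forall s, `|s - t| <= r -> is_derive s 1 f (f1 s)) ->
  (forall s, `|s - t| <= r -> is_derive s 1 f1 (f2 s)) ->
  (forall s, `|s - t| <= r -> `|f2 s| <= M) ->
  forall s, `|s - t| <= r -> `|f s - f t - (s - t) * f1 t| <= M * (s - t) ^+ 2.
Proof.
move=> H1 H2 HM s sr.
have [z /between_dist zts|c /between_dist cts ->] := @mvt_between f f1 t s.
  by apply: H1; apply: le_trans sr.
rewrite [(s - t) * _]mulrC -mulrBl normrM -[_ ^+ 2]real_normK ?num_real // expr2 mulrA.
rewrite ler_wpM2r //.
have := mvt_dist H2 HM (le_trans cts sr) => /le_trans; apply.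
have M0 : 0 <= M by apply: le_trans (HM t _) => //; rewrite subrr normr0 (le_trans _ sr).
by rewrite ler_wpM2l.
Qed.

(** A nonnegative function with bounded second derivative cannot have a large
    slope where it is small: following the slope downhill over the distance [h]
    would make it negative. *)
Lemma glaeser (f f1 f2 : R -> R) (t h M : R) : 0 < h ->
  (forall s, `|s - t| <= h -> is_derive s 1 f (f1 s)) ->
  (forall s, `|s - t| <= h -> is_derive s 1 f1 (f2 s)) ->
  (forall s, `|s - t| <= h -> `|f2 s| <= M) ->
  (forall s, `|s - t| <= h -> 0 <= f s) ->
  `|f1 t| <= f t / h + M * h.
Proof.
move=> h0 H1 H2 HM Hp.
have T := taylor2 H1 H2 HM.
have d1 : `|t + h - t| <= h by rewrite addrAC subrr add0r gtr0_norm.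
have d2 : `|t - h - t| <= h by rewrite addrAC subrr add0r normrN gtr0_norm.
have := T _ d1; have := Hp _ d1; have := T _ d2; have := Hp _ d2.
rewrite !ler_norml.
have -> : t + h - t = h by ring.
have -> : t - h - t = - h by ring.
move=> p1 /andP[_ q1] p2 /andP[_ q2].
have e : (f t / h + M * h) * h = f t + M * h ^+ 2 by field; lra.
apply/andP; split; rewrite -(ler_pM2r h0) ?mulNr e; nra.
Qed.

Section pointwise.
Variables (f g : R -> R) (t a b : R).
Hypotheses (df : is_derive t 1 f a) (dg : is_derive t 1 g b).

Lemma derD : is_derive t 1 (fun x => f x + g x) (a + b).
Proof. exact: is_deriveD. Qed.

Lemma derB : is_derive t 1 (fun x => f x - g x) (a - b).
Proof. exact: is_deriveB. Qed.

Lemma derM : is_derive t 1 (fun x => f x * g x) (a * g t + f t * b).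
Proof.
by apply: (is_derive_eq (is_deriveM df dg)); rewrite /GRing.scale/= addrC mulrC.
Qed.

Lemma derZ (k : R) : is_derive t 1 (fun x => k * f x) (k * a).
Proof. exact: is_deriveZ. Qed.

Lemma derX (n : nat) : is_derive t 1 (fun x => f x ^+ n) (n%:R * f t ^+ n.-1 * a).
Proof.
have -> : (fun x => f x ^+ n) = f ^+ n by rewrite exprfctE.
by apply: (is_derive_eq (is_deriveX n df)).
Qed.

Lemma derV : f t != 0 -> is_derive t 1 (fun x => (f x)^-1) (- a / f t ^+ 2).
Proof.
move=> f0; apply: (is_derive_eq (@is_deriveV _ f _ _ _ f0 df)).
by rewrite /GRing.scale/= mulrC mulrN mulNr.
Qed.

Lemma der_sqrt : 0 < f t ->
  is_derive t 1 (fun x => Num.sqrt (f x)) (a / (2 * Num.sqrt (f t))).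
Proof.
move=> f0; have ds := is_derive1_sqrt f0.
by apply: (is_derive_eq (@is_derive1_comp _ Num.sqrt f _ _ _ ds df)); rewrite mulrC.
Qed.

End pointwise.

Lemma der_cst (c t : R) : is_derive t 1 (fun=> c) 0.
Proof. exact: is_derive_cst. Qed.

Lemma der_id (t : R) : is_derive t 1 (fun x => x) 1.
Proof. exact: is_derive_id. Qed.

(** ** Taylor expansion at a point *)

Definition tower (k : nat) (J : set R) (D : nat -> R -> R) : Prop :=
  forall i, (i < k)%N -> forall s, J s -> is_derive s 1 (D i) (D i.+1 s).

Lemma peano (k : nat) (D : nat -> R -> R) (t : R) :
  (forall i, (i < k)%N -> \forall s \near t, is_derive (s : R) 1 (D i) (D i.+1 s)) ->
  {for t, continuous (D k)} ->
  (forall i, (i < k)%N -> D i t = 0) ->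
  forall e : R, 0 < e -> \forall s \near t,
    `|D 0%N s - D k t / k`!%:R * (s - t) ^+ k| <= e * `|s - t| ^+ k.
Proof.
elim: k D => [|k IH] D dD cD zD e e0.
  move/cvgrPdist_le: cD => /(_ e e0); apply: filterS => s.
  by rewrite distrC fact0 expr0 divr1 !mulr1.
have := IH (fun i => D i.+1) (fun i Hi => dD i.+1 Hi) cD (fun i Hi => zD i.+1 Hi) e e0.
set b := D k.+1 t / k`!%:R => HIH.
have /near_ballP[r r0 Hr] := nearI HIH (dD 0%N isT).
apply/near_ballP; exists r => // s sr.
pose g x := D 0%N x - D k.+1 t / k.+1`!%:R * (x - t) ^+ k.+1.
have g0 : g t = 0 by rewrite /g (zD 0%N) // subrr expr0n /= mulr0 subrr.
have := @mvt_dist g (fun x => D 1%N x - b * (x - t) ^+ k) t `|s - t| (e * `|s - t| ^+ k).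
move=> /(_ _ _ s (lexx _)); rewrite g0 subr0 -mulrA -exprSr; apply.
- move=> x xs; have [_ dx] := Hr x (le_lt_trans xs sr).
  apply: (is_derive_eq (derB dx (derZ (derX (derB (der_id x) (der_cst t x)) k.+1) _))).
  rewrite subr0 mulr1 /b factS natrM /=; congr (_ - _).
  have f0 : k`!%:R != 0 :> R by rewrite pnatr_eq0 -lt0n fact_gt0.
  have k0 : k.+1%:R != 0 :> R by rewrite pnatr_eq0.
  by move: f0 k0; set u := k`!%:R; set v := k.+1%:R => f0 k0; field; apply/andP.
- move=> x xs; have [dx _] := Hr x (le_lt_trans xs sr).
  apply: le_trans dx _; rewrite ler_wpM2l ?(ltW e0) // lerXn2r ?nnegrE //.
Qed.
Definition homog_limit (f : R -> R) (t : R) (k : nat) (b : R) : Prop :=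
  forall e : R, 0 < e ->
    \forall s \near t, `|f s - b * (s - t) ^+ k| <= e * `|s - t| ^+ k.

Lemma le0_eps (a : R) (C : R) : 0 <= C -> (forall e : R, 0 < e -> a <= C * e) -> a <= 0.
Proof.
move=> C0 H; apply/ler_addgt0Pr => e e0; rewrite add0r.
apply: le_trans (H (e / (C + 1)) _) _; first by rewrite divr_gt0 //; lra.
rewrite mulrA ler_pdivrMr; last lra.
by rewrite mulrC ler_pM2l //; lra.
Qed.

(** The bound makes the derivatives of order less than [k] vanish at [t], one after
    the other, by comparison at parameters tending to [t]. *)
Lemma bigO_homog_limit (k : nat) (D : nat -> R -> R) (t C : R) :
  (forall i, (i < k)%N -> \forall s \near t, is_derive (s : R) 1 (D i) (D i.+1 s)) ->
  {for t, continuous (D k)} ->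
  (\forall s \near t, `|D 0%N s| <= C * `|s - t| ^+ k) ->
  exists b, homog_limit (D 0%N) t k b.
Proof.
move=> dD cD /near_ballP[r r0 Hr].
suff zD i : (i <= k)%N -> forall j, (j < i)%N -> D j t = 0.
  by exists (D k t / k`!%:R) => e; apply: peano => //; exact: (zD k).
elim: i => [//|i IH] ik j; rewrite ltnS leq_eqVlt => /orP[/eqP ->{j}|]; last first.
  by apply: IH; exact: ltnW.
have ci : {for t, continuous (D i)}.
  exact: (is_derive_continuous (nbhs_singleton (dD i ik))).
have P := peano (fun j ji => dD j (ltn_trans ji ik)) ci (IH (ltnW ik)).
set b := D i t / i`!%:R in P.
suff b0 : `|b| <= 0.
  move: b0; rewrite normr_le0 /b mulf_eq0 invr_eq0 pnatr_eq0.
  by rewrite (gtn_eqF (fact_gt0 i)) orbF => /eqP.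
have C0 : 0 <= C.
  have := Hr (t + r / 2); have -> : t + r / 2 - t = r / 2 by ring.
  rewrite gtr0_norm ?divr_gt0 // => /(_ ltac:(lra)) /(le_trans (normr_ge0 _)).
  by rewrite pmulr_lge0 // exprn_gt0 // divr_gt0.
apply: (@le0_eps _ (C + 1)); first lra.
move=> e e0; have /near_ballP[r' r'0 Hr'] := P e e0.
pose h := Num.min (Num.min (r / 2) (r' / 2)) (Num.min e 1).
have h0 : 0 < h by rewrite !lt_min !divr_gt0 // e0 ltr01.
have [h1 h2 h3 h4] : [/\ h <= r / 2, h <= r' / 2, h <= e & h <= 1].
  by rewrite !ge_min !lexx !orbT.
have E : t + h - t = h by ring.
have := Hr (t + h); have := Hr' (t + h); rewrite E gtr0_norm //.
move=> /(_ ltac:(lra)) A /(_ ltac:(lra)) B.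
have hi : 0 < h ^+ i by rewrite exprn_gt0.
rewrite -(ler_pM2r hi) -(gtr0_norm hi) -normrM (gtr0_norm hi).
have -> : b * h ^+ i = D 0%N (t + h) - (D 0%N (t + h) - b * h ^+ i) by ring.
apply: le_trans (ler_normB _ _) _; apply: le_trans (lerD B A) _.
rewrite !mulrDl mul1r lerD // -mulrA ler_wpM2l //.
apply: (@le_trans _ _ (h ^+ i.+1)); last by rewrite exprSr mulrC ler_wpM2r // ltW.
by rewrite ler_wiXn2l // ?h4 ?(ltW h0).
Qed.

(** ** Interpolation between the bounds on a function and on its last derivative *)

Lemma towerW (k m : nat) (J J' : set R) (D : nat -> R -> R) :
  (m <= k)%N -> J' `<=` J -> tower k J D -> tower m J' D.
Proof. by move=> mk JJ H i im s /JJ; apply: H; exact: leq_trans im mk. Qed.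

(** By induction, in each of the outer thirds of the interval there is a point with
    the bound for the derivative of order [k]; the mean value theorem is applied
    between the two. *)
Lemma interpolation_point (k : nat) : exists2 c : R, 0 <= c &
  forall (D : nat -> R -> R) (x l B : R), 0 < l ->
    tower k [set s | x <= s <= x + l] D ->
    (forall s, x <= s <= x + l -> `|D 0%N s| <= B) ->
  exists2 y, x <= y <= x + l & `|D k y| * l ^+ k <= c * B.
Proof.
elim: k => [|k [c c0 IH]].
  exists 1 => // D x l B l0 _ HB; exists x; first by lra.
  by rewrite expr0 mulr1 mul1r HB; lra.
exists (6 * 3 ^+ k * c) => [|D x l B l0 dD HB].
  by rewrite !mulr_ge0 // exprn_ge0.
have sub x' : x <= x' -> x' + l / 3 <= x + l ->
    [set s | x' <= s <= x' + l / 3] `<=` [set s | x <= s <= x + l].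
  by move=> h1 h2 s /= /andP[]; lra.
have third x' : x <= x' -> x' + l / 3 <= x + l ->
    exists2 y, x' <= y <= x' + l / 3 & `|D k y| * (l / 3) ^+ k <= c * B.
  move=> h1 h2; apply: IH; first lra.
    by apply: towerW dD => //; exact: sub.
  by move=> s /(sub _ h1 h2); exact: HB.
have [y1 y1i H1] := third x ltac:(lra) ltac:(lra).
have [y2 y2i H2] := third (x + 2 * l / 3) ltac:(lra) ltac:(lra).
have [z|y yb E] := @mvt_between (D k) (D k.+1) y1 y2.
  by rewrite /between min_l ?max_r; try lra; move=> zi; apply: dD => //=; lra.
move: yb; rewrite /between min_l ?max_r; try lra; move=> yi.
exists y; first lra.
have l3 : 0 < (l / 3) ^+ k by rewrite exprn_gt0 ?divr_gt0.
have : `|D k.+1 y| * (l / 3) * (l / 3) ^+ k <= c * B + c * B.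
  apply: (@le_trans _ _ (`|D k y2 - D k y1| * (l / 3) ^+ k)).
    rewrite ler_pM2r // E normrM ler_wpM2l // ger0_norm; lra.
  apply: le_trans (lerD H2 H1); rewrite -mulrDl ler_pM2r //.
  exact: ler_normB.
rewrite expr_div_n exprSr => H.
have p3 : 0 < 3 ^+ k :> R by rewrite exprn_gt0.
have -> : `|D k.+1 y| * (l ^+ k * l) =
   3 * 3 ^+ k * (`|D k.+1 y| * (l / 3) * (l ^+ k / 3 ^+ k)).
  by field; rewrite gt_eqF.
apply: le_trans (ler_wpM2l _ H) _; first by rewrite mulr_ge0 // ltW.
by rewrite le_eqVlt; apply/orP; left; apply/eqP; ring.
Qed.

(** Landau's interpolation: [interpolation_point] provides a point with the
    wanted bound, from which the bound spreads over the interval by integrating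
    the next derivative. *)
Lemma interpolation (n : nat) : exists2 C : R, 0 <= C &
  forall (D : nat -> R -> R) (x l B : R), 0 < l ->
    tower n [set s | x <= s <= x + l] D ->
    (forall s, x <= s <= x + l -> `|D 0%N s| <= B * l ^+ n) ->
    (forall s, x <= s <= x + l -> `|D n s| <= B) ->
  forall k, (k <= n)%N ->
    forall s, x <= s <= x + l -> `|D k s| <= C * B * l ^+ (n - k).
Proof.
suff H m : (m <= n)%N -> exists2 C : R, 0 <= C &
  forall (D : nat -> R -> R) (x l B : R), 0 < l ->
    tower n [set s | x <= s <= x + l] D ->
    (forall s, x <= s <= x + l -> `|D 0%N s| <= B * l ^+ n) ->
    (forall s, x <= s <= x + l -> `|D n s| <= B) ->
  forall k, (n - m <= k <= n)%N ->
    forall s, x <= s <= x + l -> `|D k s| <= C * B * l ^+ (n - k).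
  have [C C0 HC] := H n (leqnn n); exists C => // D x l B l0 dD h1 h2 k kn.
  by apply: (HC D x l B) => //; rewrite subnn.
elim: m => [|m IH] mn.
  exists 1 => // D x l B l0 dD h1 h2 k; rewrite subn0 -eqn_leq => /eqP <- s sx.
  by rewrite subnn expr0 mul1r mulr1 h2.
have [C C0 HC] := IH (ltnW mn).
have [c c0 Hc] := interpolation_point (n - m.+1).
exists (C + c) => [|D x l B l0 dD h1 h2 k]; first lra.
have B0 : 0 <= B by apply: le_trans (h2 x _) => //; lra.
case/andP => km kn s sx.
have HH := HC D x l B l0 dD h1 h2.
move: km; rewrite leq_eqVlt => /orP[/eqP ke|km]; last first.
  apply: le_trans (HH k _ s sx) _; first by rewrite kn andbT; move: km; clear; lia.
  rewrite -!mulrA ler_wpM2r ?mulr_ge0 ?exprn_ge0 ?(ltW l0) //; lra.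
have [y yx Hy] := Hc D x l (B * l ^+ n) l0 (towerW (leq_subr _ _) (@subset_refl _ _) dD) h1.
have [z|w wb E] := @mvt_between (D k) (D k.+1) y s.
  rewrite /between => /andP[z1 z2]; apply: dD; first by move: kn ke mn; clear; lia.
  move: z1 z2 yx sx; clear; rewrite /= ge_min le_max.
  by move=> /orP[]z1 /orP[] z2 yx sx; lra.
have wx : x <= w <= x + l.
  case/andP: wb; rewrite ge_min le_max => /orP[]z1 /orP[] z2; lra.
have -> : D k s = D k s - D k y + D k y by ring.
have lk : 0 < l ^+ k by rewrite exprn_gt0.
apply: le_trans (ler_normD _ _) _.
rewrite !mulrDl lerD //.
  rewrite E normrM.
  have -> : (n - k = (n - k.+1).+1)%N by move: kn ke mn; clear; lia.
  rewrite exprSr mulrA; apply: ler_pM => //.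
    by apply: HH => //; move: kn ke mn; clear; lia.
  by rewrite ler_norml; lra.
rewrite ke in Hy; rewrite -(ler_pM2r lk); apply: le_trans Hy _.
by rewrite -!mulrA -exprD subnK.
Qed.

End Derivatives.

(** * Lifting over the invariants of a finite linear group *)

(** The maps [act g] play the role of the elements of a finite group; only
    the consequences below of the group axioms are recorded. *)
Record orbit_data (R : realType) (V : normedModType R) (J K : finType)
    (act : J -> V -> V) (p : K -> V -> R) (deg : K -> nat) : Prop := OrbitData {
  act_linear : forall g c u v, act g (c *: u + v) = c *: act g u + act g v;
  act_bound : exists2 C : R, 0 <= C & forall g v, `|act g v| <= C * `|v|;
  act_inv : forall g k v, p k (act g v) = p k v;
  act_separates : forall u v, (forall k, p k u = p k v) -> exists g, v = act g u;
  inv_continuous : forall k, continuous (p k);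
  inv_homog : forall k c v, p k (c *: v) = c ^+ deg k * p k v;
  inv_coercive : exists k, exists2 C : R, 0 <= C & forall v, `|v| ^+ 2 <= C * p k v;
  ball_compact : forall B : R, compact [set v : V | `|v| <= B]
}.

Section Lifting.
Variables (R : realType) (V : normedModType R) (J K : finType).
Variables (act : J -> V -> V) (p : K -> V -> R) (deg : K -> nat).
Hypothesis od : orbit_data act p deg.

Definition same_orbit (u v : V) := forall k, p k u = p k v.

Lemma same_orbit_refl u : same_orbit u u. Proof. by []. Qed.

Lemma same_orbit_sym u v : same_orbit u v -> same_orbit v u.
Proof. by move=> H k; rewrite H. Qed.

Lemma same_orbit_trans u v w : same_orbit u v -> same_orbit v w -> same_orbit u w.
Proof. by move=> H1 H2 k; rewrite H1. Qed.

Lemma act0 g : act g 0 = 0.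
Proof.
have := act_linear od g 1 0 0.
rewrite !scale1r addr0 => /eqP; rewrite -subr_eq0 opprD addrA subrr sub0r oppr_eq0.
by move/eqP.
Qed.

Lemma actZ g c v : act g (c *: v) = c *: act g v.
Proof. by have := act_linear od g c v 0; rewrite act0 !addr0. Qed.

Lemma actD g u v : act g (u + v) = act g u + act g v.
Proof. by have := act_linear od g 1 u v; rewrite !scale1r. Qed.

Lemma actB g u v : act g (u - v) = act g u - act g v.
Proof. by rewrite actD -scaleN1r actZ scaleN1r. Qed.

Lemma act_same g v : same_orbit v (act g v).
Proof. by move=> k; rewrite (act_inv od). Qed.

Lemma same_orbit0 v : same_orbit 0 v -> v = 0.
Proof. by case/(act_separates od) => g ->; rewrite act0. Qed.

Lemma der_act g (u : R -> V) (t : R) (d : V) :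
  is_derive t 1 u d -> is_derive t 1 (fun s => act g (u s)) (act g d).
Proof.
move=> /is_derive_nearP H; apply/is_derive_nearP => e e0.
have [C C0 HC] := act_bound od.
have C1 : 0 < C + 1 by lra.
apply: filterS (H (e / (C + 1)) _) => [s Hs|]; last by rewrite divr_gt0.
rewrite -actZ -!actB; apply: le_trans (HC _ _) _.
apply: (@le_trans _ _ ((C + 1) * `|u s - u t - (s - t) *: d|)).
  by rewrite ler_wpM2r //; lra.
by rewrite mulrC -ler_pdivlMr // mulrAC.
Qed.

Lemma derB_vec (u w : R -> V) (t : R) (d d' : V) : is_derive t 1 u d -> is_derive t 1 w d' ->
  is_derive t 1 (fun s => u s - w s) (d - d').
Proof. by move=> *; exact: is_deriveB. Qed.

Lemma jet_neq0 (w : R -> V) (t : R) (d : V) : is_derive t 1 w d -> w t != 0 \/ d != 0 ->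
  \forall s \near t, s != t -> w s != 0.
Proof.
move=> dw; have [w0 [|d0]|w0 _] := eqVneq (w t) 0.
- by [].
- have n0 : 0 < `|d| by rewrite normr_gt0.
  move/is_derive_nearP: dw => /(_ (`|d| / 2)) /(_ ltac:(lra)).
  apply: filterS => s; rewrite w0 subr0 => Hs st; apply/negP => /eqP ws.
  move: Hs; rewrite ws sub0r normrN normrZ mulrC.
  have : 0 < `|s - t| by rewrite normr_gt0 subr_eq0.
  by move=> h; rewrite ler_pM2r //; lra.
- have := is_derive_continuous dw => cw.
  have : \forall s \near t, w s != 0.
    by move/cvgr_neq0: cw => /(_ w0).
  by apply: filterS.
Qed.

(** Two lifts of the same curve agree to first order, up to the group: among
    finitely many elements one has to be used arbitrarily close to [t]. *)
Lemma match_jets (u1 u2 : R -> V) (t : R) (d1 d2 : V) :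
  is_derive t 1 u1 d1 -> is_derive t 1 u2 d2 ->
  (\forall s \near t, same_orbit (u2 s) (u1 s)) ->
  exists g, u1 t = act g (u2 t) /\ d1 = act g d2.
Proof.
move=> du1 du2 same; apply: contrapT => /forallNP no.
have : \forall s \near t, forall g, s != t -> u1 s - act g (u2 s) != 0.
  apply: (@filter_forall R J (fun g s => s != t -> u1 s - act g (u2 s) != 0)
    (nbhs t)) => g.
  apply: jet_neq0 (derB_vec du1 (der_act g du2)) _.
  rewrite !subr_eq0; have [e1|] := eqVneq (u1 t) (act g (u2 t)); last by left.
  by right; apply/eqP => e2; exact: (no g).
move=> /(nearI same)/near_ballP[r r0 H].
have rr : `|t + r / 2 - t| < r by rewrite addrAC subrr add0r gtr0_norm; lra.
have [/(act_separates od)[g E] /(_ g)] := H _ rr.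
rewrite E subrr eqxx => H2; suff : false by [].
by apply: H2; apply/eqP; lra.
Qed.

Definition good (v0 u : R -> V) (t : R) : Prop :=
  same_orbit (v0 t) (u t) /\ exists d, is_derive t 1 u d.

Lemma good_act v0 u t g : good v0 u t -> good v0 (fun s => act g (u s)) t.
Proof.
move=> [su [d du]]; split; first exact: same_orbit_trans su (act_same _ _).
by exists (act g d); exact: der_act.
Qed.

Lemma good_ext v0 u u' t : (\forall s \near t, u s = u' s) ->
  good v0 u t -> good v0 u' t.
Proof.
move=> uu [su [d du]]; split; first by rewrite -(nbhs_singleton uu).
by exists d; apply: is_derive_ext du.
Qed.

Definition locally_good (v0 u : R -> V) (t : R) : Prop :=
  \forall s \near t, good v0 u s.

Lemma locally_good_ext v0 u u' t : (\forall s \near t, u s = u' s) ->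
  locally_good v0 u t -> locally_good v0 u' t.
Proof.
move=> uu gu; have := nearI uu gu => /near_ballP[r r0 H].
apply/near_ballP; exists r => // s st; have [_] := H _ st; apply: good_ext.
apply/near_ballP; exists (r - `|s - t|) => [|x xs]; first lra.
suff /H[] : `|x - t| < r by [].
have -> : x - t = (x - s) + (s - t) by ring.
by apply: le_lt_trans (ler_normD _ _) _; lra.
Qed.

Definition glue (q : R) (u1 u2 : R -> V) (t : R) : V :=
  if t < q then u1 t else u2 t.

Lemma near_lt (t q : R) : t < q -> \forall s \near t, s < q.
Proof.
move=> tq; apply/near_ballP; exists (q - t); first lra.
by move=> s; rewrite ltr_norml; lra.
Qed.

Lemma near_gt (t q : R) : q < t -> \forall s \near t, q < s.
Proof.
move=> tq; apply/near_ballP; exists (t - q); first lra.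
by move=> s; rewrite ltr_norml; lra.
Qed.

Lemma glue_lt (q : R) (u1 u2 : R -> V) (t : R) : t < q -> \forall s \near t, u1 s = glue q u1 u2 s.
Proof. by move=> /near_lt; apply: filterS => s; rewrite /glue => ->. Qed.

Lemma glue_gt (q : R) (u1 u2 : R -> V) (t : R) : q < t -> \forall s \near t, u2 s = glue q u1 u2 s.
Proof. by move=> /near_gt; apply: filterS => s qs; rewrite /glue ltNge (ltW qs). Qed.

Lemma glue_der (q : R) (u1 u2 : R -> V) (d : V) : u1 q = u2 q -> is_derive q 1 u1 d ->
  is_derive q 1 u2 d -> is_derive q 1 (glue q u1 u2) d.
Proof.
move=> E /is_derive_nearP H1 /is_derive_nearP H2; apply/is_derive_nearP => e e0.
have := nearI (H1 e e0) (H2 e e0); apply: filterS => s [h1 h2].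
by rewrite /glue ltxx; case: ifP => // _; rewrite -E.
Qed.

(** The group element is chosen to make the first-order jets of the two lifts at [q]
    agree. *)
Lemma glue_locally_good v0 (q : R) (u1 u2 : R -> V) :
  locally_good v0 u1 q -> locally_good v0 u2 q ->
  exists g, forall t,
    (t <= q -> locally_good v0 u1 t) -> (q <= t -> locally_good v0 u2 t) ->
    locally_good v0 (glue q u1 (fun s => act g (u2 s))) t.
Proof.
move=> g1 g2.
have [_ [d1 du1]] := nbhs_singleton g1; have [_ [d2 du2]] := nbhs_singleton g2.
have [|g [eg ed]] := match_jets du1 du2.
  have := nearI g1 g2; apply: filterS => s [[s1 _] [s2 _]].
  exact: same_orbit_trans (same_orbit_sym s2) s1.
exists g => t h1 h2.
have lo s : s < q -> good v0 u1 s ->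
    good v0 (glue q u1 (fun s => act g (u2 s))) s.
  by move=> sq; apply: good_ext; exact: glue_lt.
have hi s : q < s -> good v0 u2 s ->
    good v0 (glue q u1 (fun s => act g (u2 s))) s.
  move=> sq gs; apply: (good_ext (glue_gt _ _ sq)); exact: good_act.
have [tq|qt|tq] := ltgtP t q.
- have := nearI (near_lt tq) (h1 (ltW tq)); apply: filterS => s [sq gs].
  exact: lo.
- have := nearI (near_gt qt) (h2 (ltW qt)); apply: filterS => s [sq gs].
  exact: hi.
- rewrite tq; have := nearI g1 g2; apply: filterS => s [s1 s2].
  have [sq|qs|sq] := ltgtP s q; [exact: lo|exact: hi|].
  rewrite sq; split.
    rewrite /glue ltxx; rewrite sq in s2; case: s2 => s2 _.
    exact: same_orbit_trans s2 (act_same _ _).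
  exists d1; apply: glue_der => //; rewrite ed; exact: der_act.
Qed.

Definition liftable (v0 : R -> V) (t : R) : Prop := exists u, locally_good v0 u t.

Lemma liftable_near v0 t : liftable v0 t -> \forall s \near t, liftable v0 s.
Proof.
move=> [u /near_ballP[r r0 H]]; apply/near_ballP; exists r => // s sr.
exists u; apply/near_ballP; exists (r - `|s - t|); first lra.
move=> x xs; apply: H; have -> : x - t = (x - s) + (s - t) by ring.
by apply: le_lt_trans (ler_normD _ _) _; lra.
Qed.

Lemma lift_segment v0 a b : a <= b -> (forall t, a <= t <= b -> liftable v0 t) ->
  exists u, forall t, a <= t <= b -> locally_good v0 u t.
Proof.
move=> ab lf.
pose S := [set x : R | a <= x <= b /\ exists u, forall t, a <= t <= x -> locally_good v0 u t].
have Sa : S a.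
  split; first by rewrite lexx ab.
  have [u Hu] := lf a ltac:(lra); exists u => t; rewrite -eq_le => /eqP <- //.
have hs : has_sup S by split; [exists a|exists b => x [/andP[]]].
have sa : a <= sup S by exact: sup_upper_bound.
have sb : sup S <= b by apply: ge_sup; [exists a|move=> x [/andP[]]].
have [f /near_ballP[r r0 Hf]] := lf (sup S) ltac:(lra).
have [x [/andP[ax xb] [u Hu]] xs] := @sup_adherent _ S r r0 hs.
have xS : x <= sup S by apply: sup_upper_bound => //; split; [rewrite ax|exists u].
have fl t : `|t - sup S| < r -> locally_good v0 f t.
  move=> tr; apply/near_ballP; exists (r - `|t - sup S|); first lra.
  move=> y yt; apply: Hf; have -> : y - sup S = (y - t) + (t - sup S) by ring.
  by apply: le_lt_trans (ler_normD _ _) _; lra.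
have [|g Hg] := @glue_locally_good v0 x u f (Hu x ltac:(lra)).
  by apply: fl; rewrite ltr_norml; lra.
pose y := Num.min b (sup S + r / 2).
have yb : y <= b by rewrite /y ge_min lexx.
have yS : y <= sup S + r / 2 by rewrite /y ge_min lexx orbT.
have Gy t : a <= t <= y -> locally_good v0 (glue x u (fun s => act g (f s))) t.
  move=> /andP[t1 t2]; apply: Hg => t3; first by apply: Hu; rewrite t1.
  by apply: fl; rewrite ltr_norml; lra.
have [bS|Sb] := leP b (sup S + r / 2).
  exists (glue x u (fun s => act g (f s))) => t /andP[t1 t2]; apply: Gy.
  by rewrite t1 /y le_min t2 (le_trans t2 bS).
have : S y.
  split; first by rewrite yb andbT /y le_min ab; lra.
  by exists (glue x u (fun s => act g (f s))).
move=> /(sup_upper_bound hs); rewrite /y min_r ?(ltW Sb) //; lra.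
Qed.
Lemma exhaust_right (A : set R) (o : R) : A o -> (forall t, A t -> o <= t) ->
  (forall s t, A t -> o <= s <= t -> A s) -> (forall t, A t -> exists2 s, t < s & A s) ->
  exists q : nat -> R, [/\ forall k, A (q k), forall k, q k <= q k.+1
    & forall t, A t -> exists k, t < q k].
Proof.
move=> Ap Age Adown Aup.
have [hs|unb] := pselect (has_ubound A).
  have hsA : has_sup A by split; [exists o|].
  have bA t : A t -> t < sup A.
    by case/Aup => s ts /(sup_upper_bound hsA); exact: lt_le_trans.
  have ob := bA _ Ap.
  have q_lt (k : nat) : 0 < (sup A - o) / k.+1%:R.
    by rewrite divr_gt0 ?subr_gt0 ?ltr0n.
  exists (fun k => sup A - (sup A - o) / k.+1%:R); split.
  - move=> k; have [x Ax xs] := @sup_adherent _ A _ (q_lt k) hsA.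
    apply: (Adown _ x) => //; rewrite (ltW xs) andbT lerBrDr -lerBrDl.
    rewrite ler_pdivrMr ?ltr0n // ler_peMr ?subr_ge0 ?(ltW ob) //.
    by rewrite ler1n.
  - move=> k; rewrite lerD2l lerN2 ler_pM2l ?subr_gt0 //.
    by rewrite lef_pV2 ?posrE ?ltr0n // ler_nat.
  - move=> t /bA tb; have d0 : 0 < sup A - t by rewrite subr_gt0.
    have /archi_boundP : 0 <= (sup A - o) / (sup A - t).
      by rewrite divr_ge0 ?subr_ge0 ?ltW.
    set n := Num.bound _ => Hn; exists n.
    rewrite ltrBrDr -ltrBrDl ltr_pdivrMr ?ltr0n // mulrC -ltr_pdivrMr //.
    by apply: lt_trans Hn _; rewrite ltr_nat.
exists (fun k => o + k%:R); split.
- move=> k; apply: contrapT => nA; apply: unb; exists (o + k%:R) => t At.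
  have [//|tk] := leP t (o + k%:R); case: nA; apply: (Adown _ t) => //.
  by rewrite lerDl ler0n ltW.
- by move=> k; rewrite lerD2l ler_nat.
- move=> t At; have := archi_boundP (x := t - o); rewrite subr_ge0 => /(_ (Age _ At)).
  by set n := Num.bound _ => Hn; exists n; rewrite addrC -ltrBlDr.
Qed.

(** A lift on a half-open interval is built along an exhausting sequence, each
    stage being left unchanged by the next ones. *)
Lemma lift_right v0 (o : R) : exists u, forall t, o <= t ->
  (forall s, o <= s <= t -> liftable v0 s) -> locally_good v0 u t.
Proof.
pose A := [set t : R | o <= t /\ forall s, o <= s <= t -> liftable v0 s].
have [lp|nlp] := pselect (liftable v0 o); last first.
  by exists (fun=> 0) => t pt /(_ o); rewrite lexx pt => /(_ isT) /nlp.
have [| | | |q [Aq qS qex]] := @exhaust_right A o.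
- by split=> // s; rewrite -eq_le => /eqP <-.
- by move=> t [].
- move=> s t [pt H] /andP[ps st]; split=> // r /andP[pr rs]; apply: H.
  by rewrite pr (le_trans rs).
- move=> t [pt H]; have := liftable_near (H t _); rewrite lexx pt => /(_ isT).
  move=> /near_ballP[r r0 Hr]; exists (t + r / 2); first lra.
  split; first lra.
  move=> s /andP[ps st]; have [st'|ts] := leP s t; first by apply: H; rewrite ps.
  by apply: Hr; rewrite ltr_norml; lra.
pose P k u := forall t, o <= t <= q k -> locally_good v0 u t.
have qp k : o <= q k by case: (Aq k).
have [u0 P0] : exists u, P 0%N u.
  by have [_ H] := Aq 0%N; apply: lift_segment.
have step (ku : nat * (R -> V)) : exists u', P ku.1 ku.2 ->
    P ku.1.+1 u' /\ forall t, t < q ku.1 -> u' t = ku.2 t.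
  case: ku => k u /=; have [Pk|] := pselect (P k u); last by exists u.
  have [t|f Hf] := @lift_segment v0 (q k) (q k.+1) (qS k).
    move=> /andP[t1 t2]; have [_] := Aq k.+1; apply.
    by rewrite t2 (le_trans (qp k)).
  have [||g Hg] := @glue_locally_good v0 (q k) u f.
  - by apply: Pk; rewrite qp lexx.
  - by apply: Hf; rewrite lexx qS.
  exists (glue (q k) u (fun s => act g (f s))) => _; split=> [t /andP[t1 t2]|t tq].
    apply: Hg => tq; first by apply: Pk; rewrite t1.
    by apply: Hf; rewrite tq.
  by rewrite /glue tq.
have [F HF] := choice step.
pose U := fix U k := if k is k'.+1 then F (k', U k') else u0.
have PU k : P k (U k).
  by elim: k => [|k IH]; [exact: P0|have [] := HF (k, U k) IH].
have US k m t : t < q k -> U (k + m)%N t = U k t.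
  move=> tq; elim: m => [|m IH]; first by rewrite addn0.
  rewrite addnS /=; have [_ /= ->//] := HF (_, _) (PU (k + m)%N).
  apply: lt_le_trans tq _; elim: (m) => [|n IHn]; first by rewrite addn0.
  by rewrite addnS (le_trans IHn).
have ex (t : R) : exists m, (exists k, t < q k) -> t < q m.
  have [[k Hk]|no] := pselect (exists k, t < q k); first by exists k.
  by exists 0%N.
have [kk Hk] := choice ex.
exists (fun t => U (kk t) t) => t pt H.
have [k tk] := qex t (conj pt H).
apply: (@locally_good_ext _ (U k)); last by apply: PU; rewrite pt ltW.
apply: filterS (near_lt tk) => s sk.
have skk := Hk s (ex_intro _ k sk).
have [kkk|kkk] := leqP k (kk s).
  by rewrite -(subnKC kkk) US.
by rewrite -(subnKC (ltnW kkk)) US.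
Qed.

Lemma near_opp (t : R) (P : R -> Prop) :
  (\forall s \near t, P s) -> \forall s \near - t, P (- s).
Proof.
move=> /near_ballP[r r0 H]; apply/near_ballP; exists r => // s st; apply: H.
by move: st; rewrite -normrN !opprD !opprK.
Qed.

Lemma der_opp (u : R -> V) (t : R) (d : V) :
  is_derive t 1 u d -> is_derive (- t) 1 (fun s => u (- s)) (- d).
Proof.
move=> /is_derive_nearP H; apply/is_derive_nearP => e /H /near_opp.
apply: filterS => s; rewrite !opprK.
have -> : - s - t = - (s + t) by ring.
by rewrite normrN scalerN scaleNr.
Qed.

Lemma good_opp v0 u t : good v0 u t -> good (fun s => v0 (- s)) (fun s => u (- s)) (- t).
Proof.
case=> su [d du]; split; first by rewrite opprK.
by exists (- d); exact: der_opp.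
Qed.

Lemma locally_good_opp v0 u t : locally_good v0 u t ->
  locally_good (fun s => v0 (- s)) (fun s => u (- s)) (- t).
Proof.
by move=> /near_opp; apply: filterS => s /good_opp; rewrite opprK.
Qed.

Lemma opp_opp (v0 : R -> V) : (fun s => v0 (- - s)) = v0.
Proof. by apply/funext => s; rewrite opprK. Qed.

Lemma lift_left v0 (o : R) : exists u, forall t, t <= o ->
  (forall s, t <= s <= o -> liftable v0 s) -> locally_good v0 u t.
Proof.
have [u Hu] := lift_right (fun s => v0 (- s)) (- o).
exists (fun s => u (- s)) => t tp H.
have := Hu (- t); rewrite lerN2 => /(_ tp) Hu'.
have {Hu'}/Hu'/locally_good_opp : forall s, - o <= s <= - t -> liftable (fun s => v0 (- s)) s.
  move=> s /andP[s1 s2]; have [|w Hw] := H (- s); first lra.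
  by exists (fun s => w (- s)); rewrite -[s]opprK; exact: locally_good_opp.
by rewrite opprK opp_opp.
Qed.

(** The connected component of [o] in the set of liftable parameters. *)
Definition component v0 (o : R) : set R :=
  [set t | forall s, between o t s -> liftable v0 s].

Lemma component_self v0 o : liftable v0 o -> component v0 o o.
Proof.
move=> lp s; rewrite /between minxx maxxx => sp.
by have /eqP <- : o == s by rewrite eq_le.
Qed.

Lemma component_eq v0 o q : component v0 o q -> component v0 o = component v0 q.
Proof.
rewrite /component /between => pq; apply/seteqP; split=> t /= H s st.
- have [a|a] := pselect (Num.min o q <= s <= Num.max o q); first exact: pq.
  apply: H; move: a st; rewrite !ge_min !le_max => a.
  move=> /andP[] /orP[]h1 /orP[]h2; have [sp|sp] := leP o s; have [sq|sq] := leP q s;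
  have [sr|sr] := leP t s; rewrite ?orbT ?orTb //=; 
  try (by case: a; rewrite ?(ltW sp) ?(ltW sq) ?sp ?sq ?orbT);
  by rewrite ?(ltW sp) ?(ltW sq) ?(ltW sr) ?orbT //; lra.
- have [a|a] := pselect (Num.min o q <= s <= Num.max o q); first exact: pq.
  apply: H; move: a st; rewrite !ge_min !le_max => a.
  move=> /andP[] /orP[]h1 /orP[]h2; have [sp|sp] := leP o s; have [sq|sq] := leP q s;
  have [sr|sr] := leP t s; rewrite ?orbT ?orTb //=; 
  try (by case: a; rewrite ?(ltW sp) ?(ltW sq) ?sp ?sq ?orbT);
  by rewrite ?(ltW sp) ?(ltW sq) ?(ltW sr) ?orbT //; lra.
Qed.

Lemma lift_component v0 (o : R) : liftable v0 o ->
  exists u, forall t, component v0 o t -> locally_good v0 u t.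
Proof.
move=> lp.
have [u1 H1] := lift_left v0 o; have [u2 H2] := lift_right v0 o.
have eqp s : o <= s <= o -> liftable v0 s by rewrite -eq_le => /eqP <-.
have [||g Hg] := @glue_locally_good v0 o u1 u2.
- exact: H1.
- exact: H2.
exists (glue o u1 (fun s => act g (u2 s))) => t ct; apply: Hg => tp.
  by apply: H1 => // s st; apply: ct; rewrite /between min_r // max_l.
by apply: H2 => // s st; apply: ct; rewrite /between min_l // max_r.
Qed.

(** Local lifts can be chosen coherently on the whole set of liftable
    parameters. *)
Lemma lift_liftable v0 : exists u, forall t, liftable v0 t -> locally_good v0 u t.
Proof.
have ex (C : set R) : exists u, forall o, liftable v0 o -> C = component v0 o ->
    forall t, C t -> locally_good v0 u t.
  have [[x [lo ->]]|no] := pselect (exists o, liftable v0 o /\ C = component v0 o).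
    by have [u Hu] := lift_component lo; exists u.
  by exists (fun=> 0) => o lo E; case: no; exists o.
have [F HF] := choice ex.
exists (fun t => F (component v0 t) t) => t lt.
apply: (@locally_good_ext _ (F (component v0 t))); last first.
  by apply: (HF _ t) => //; exact: component_self.
have /near_ballP[r r0 Hr] := liftable_near lt.
apply/near_ballP; exists r => // s st; congr (F _ _); apply: component_eq => x xb.
by apply: Hr; apply: le_lt_trans st; exact: between_dist.
Qed.

(** A continuous path close to a finite set stays close to a single element of
    it, by the intermediate value theorem. *)
Lemma path_limit_right (w : R -> V) (L : J -> V) (t r : R) : 0 < r ->
  (forall s, t < s < t + r -> exists d, is_derive s 1 w d) ->
  (forall e : R, 0 < e -> exists2 a : R, 0 < a & forall s, t < s < t + a ->
     exists g, `|w s - (s - t) *: L g| <= e * (s - t)) ->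
  exists g, forall e : R, 0 < e -> exists2 a : R, 0 < a & forall s, t < s < t + a ->
    `|w s - (s - t) *: L g| <= e * (s - t).
Proof.
move=> r0 dw near_L.
have [m m0 Hm] : exists2 m : R, 0 < m & forall g h, L g != L h -> 4 * m <= `|L g - L h|.
  exists (\big[Num.min/1]_(gh : J * J | L gh.1 != L gh.2) (`|L gh.1 - L gh.2| / 4)).
    apply: lt_bigmin => // -[g h] /= ?.
    by rewrite divr_gt0 // normr_gt0 subr_eq0.
  move=> g h gh; rewrite mulrC -ler_pdivlMr //.
  exact: (@bigmin_le_cond _ _ _ _ (g, h)).
have [a a0 Ha] := near_L m m0.
pose b := Num.min a r.
have b0 : 0 < b by rewrite lt_min a0.
have [ba br] : b <= a /\ b <= r by rewrite !ge_min !lexx orbT.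
have scal g e s : t < s -> (`|(s - t)^-1 *: w s - L g| <= e) =
    (`|w s - (s - t) *: L g| <= e * (s - t)).
  move=> ts; have st : 0 < s - t by rewrite subr_gt0.
  rewrite -(ler_pM2l st) -{1}(gtr0_norm st) -normrZ scalerBr scalerA.
  by rewrite divff ?scale1r ?gt_eqF // [e * _]mulrC.
have dich g s : t < s < t + b -> `|(s - t)^-1 *: w s - L g| <= m \/
    3 * m <= `|(s - t)^-1 *: w s - L g|.
  move=> /andP[ts sb]; have [|g' Hg'] := Ha s; first lra.
  rewrite -scal // in Hg'.
  have [<-|gg] := eqVneq (L g') (L g); [by left|right].
  have := Hm _ _ gg.
  have -> : L g' - L g = ((s - t)^-1 *: w s - L g) - ((s - t)^-1 *: w s - L g').
    by rewrite opprB [RHS]addrC subrKA.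
  move=> /le_trans/(_ (ler_normB _ _)); lra.
have [g Hg] : exists g, `|(t + b / 2 - t)^-1 *: w (t + b / 2) - L g| <= m.
  have [|g Hg] := Ha (t + b / 2); first lra.
  by exists g; rewrite scal //; lra.
have close s : t < s < t + b -> `|(s - t)^-1 *: w s - L g| <= m.
  move=> sb; case: (dich g s sb) => // far; exfalso.
  pose f x := `|(x - t)^-1 *: w x - L g|.
  have cf x : t < x < t + b -> {for x, continuous f}.
    move=> xb; have [|d /is_derive_continuous cw] := dw x; first lra.
    apply: (@continuous_comp _ _ _ (fun x => (x - t)^-1 *: w x - L g) Num.norm).
      apply: cvgB; last exact: cvg_cst.
      apply: cvgZ cw; apply: cvgV; first by rewrite subr_eq0; apply/eqP; lra.
      by apply: cvgB; [exact: cvg_id|exact: cvg_cst].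
    exact: norm_continuous.
  have [c cb fc] : exists2 c, t < c < t + b & f c = 2 * m.
    have within x y : t < x -> y < t + b -> {within `[x, y], continuous f}.
      move=> xt yb; apply: continuous_in_subspaceT => z; rewrite inE /= in_itv /= => zb.
      by apply: cf; lra.
    have tb : t + b / 2 < t + b by lra.
    have tb' : t < t + b / 2 by lra.
    move: sb => /andP[ts sb].
    have [bs|sb'] := leP (t + b / 2) s.
      have [|c cs <-] := IVT bs (within _ _ tb' sb) (v := 2 * m).
        by rewrite ge_min le_max -/(f (t + b / 2)) ; apply/andP; split; apply/orP;
           [left|right]; rewrite /f; lra.
      by exists c => //; move: cs; rewrite in_itv /=; lra.
    have [|c cs <-] := IVT (ltW sb') (within _ _ ts tb) (v := 2 * m).
      by rewrite ge_min le_max; apply/andP; split; apply/orP;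
         [right|left]; rewrite /f; lra.
    by exists c => //; move: cs; rewrite in_itv /=; lra.
  by case: (dich g c cb); rewrite -/(f c) fc; lra.
exists g => e e0.
have [a' a'0 Ha'] := near_L (Num.min e m) ltac:(by rewrite lt_min e0).
exists (Num.min a' b) => [|s /andP[ts]]; first by rewrite lt_min a'0.
rewrite -ltrBlDl lt_min => /andP[sa sb].
have [|g' Hg'] := Ha' s; first lra.
rewrite -!scal // in Hg' *.
have [gg|gg] := eqVneq (L g') (L g).
  by rewrite -gg; apply: le_trans Hg' _; rewrite ge_min lexx.
have := Hm _ _ gg; have := close s ltac:(lra).
have -> : L g' - L g = ((s - t)^-1 *: w s - L g) - ((s - t)^-1 *: w s - L g').
  by rewrite opprB [RHS]addrC subrKA.
move=> h1 /le_trans/(_ (ler_normB _ _)).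
have : Num.min e m <= m by rewrite ge_min lexx orbT.
lra.
Qed.

Lemma path_limit_left (w : R -> V) (L : J -> V) (t r : R) : 0 < r ->
  (forall s, t - r < s < t -> exists d, is_derive s 1 w d) ->
  (forall e : R, 0 < e -> exists2 a : R, 0 < a & forall s, t - a < s < t ->
     exists g, `|w s - (s - t) *: L g| <= e * (t - s)) ->
  exists g, forall e : R, 0 < e -> exists2 a : R, 0 < a & forall s, t - a < s < t ->
    `|w s - (s - t) *: L g| <= e * (t - s).
Proof.
move=> r0 dw near_L.
have [||g Hg] := @path_limit_right (fun s => w (- s)) (fun g => - L g) (- t) r r0.
- move=> s sr; have [|d /der_opp] := dw (- s); first lra.
  by rewrite opprK => dd; exists (- d).
- move=> e e0; have [a a0 Ha] := near_L e e0; exists a => // s sa.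
  have [|g Hg] := Ha (- s); first lra.
  exists g; move: Hg; rewrite !scalerN -scaleNr.
  have -> : - (s - - t) = - s - t by ring.
  by have -> : t - - s = s - - t by ring.
exists g => e e0; have [a a0 Ha] := Hg e e0; exists a => // s sa.
have := Ha (- s) ltac:(lra); rewrite opprK scalerN -scaleNr.
have -> : - (- s - - t) = s - t by ring.
by have -> : - s - - t = t - s by ring.
Qed.

(** By compactness, a vector whose invariants are close to prescribed values is
    close to a vector with exactly these invariants. *)
Lemma invariants_proper (b : K -> R) (e : R) : 0 < e -> exists2 a : R, 0 < a &
  forall v, (forall k, `|p k v - b k| < a) ->
    exists2 l, forall k, p k l = b k & `|v - l| < e.
Proof.
move=> e0; have [k0 [C C0 HC]] := inv_coercive od.
pose B := 1 + C * (`|b k0| + 1).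
pose far := [set v : V | `|v| <= B] `&`
  \bigcap_(l in [set l | forall k, p k l = b k]) [set v : V | e <= `|v - l|].
have cfar : compact far.
  apply: compact_closedI; first exact: (ball_compact od).
  apply: closed_bigI => l _.
  have -> : [set v : V | e <= `|v - l|] = (fun v => `|v - l|) @^-1` [set x | e <= x].
    by [].
  apply: closed_comp; last exact: closed_ge.
  move=> v _; apply: (@continuous_comp _ _ _ (fun v => v - l) Num.norm).
    by apply: cvgB; [exact: cvg_id|exact: cvg_cst].
  exact: norm_continuous.
have bounded v : (forall k, `|p k v - b k| < 1) -> `|v| <= B.
  move=> /(_ k0); rewrite ltr_norml => /andP[_ h].
  have h1 : p k0 v <= `|b k0| + 1 by have := ler_norm (b k0); lra.
  have := ler_wpM2l C0 h1; have := HC v; rewrite /B; have := sqr_ge0 (`|v| - 1).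
  have := normr_ge0 v; nra.
have in_far v (a : R) : a <= 1 -> (forall k, `|p k v - b k| < a) ->
    ~ (exists2 l, forall k, p k l = b k & `|v - l| < e) -> far v.
  move=> a1 Hv no; split; first by apply: bounded => k; exact: lt_le_trans (Hv k) a1.
  by move=> l Hl /=; rewrite leNgt; apply/negP => ?; apply: no; exists l.
have [[v0 fv0]|empty] := pselect (far !=set0); last first.
  exists 1 => // v Hv; apply: contrapT => no; apply: empty; exists v.
  exact: (in_far v 1).
pose phi v := \sum_k `|p k v - b k|.
have cphi : continuous phi.
  apply: continuous_big => [|k _ v]; first exact: add_continuous.
  apply: (@continuous_comp _ _ _ (fun v => p k v - b k) Num.norm).
    by apply: cvgB; [exact: inv_continuous od k v|exact: cvg_cst].
  exact: norm_continuous.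
have [||c cf cmin] := @compact_EVT_min _ _ phi far _ cfar; first by exists v0.
  exact: continuous_subspaceT.
rewrite inE in cf.
have c0 : 0 < phi c.
  rewrite lt_neqAle sumr_ge0 // andbT eq_sym; apply/negP => /eqP phi0.
  have bc k : p k c = b k.
    apply/eqP; rewrite -subr_eq0 -normr_eq0.
    by rewrite (psumr_eq0P _ phi0).
  by have [_ /(_ c bc)/=] := cf; rewrite subrr normr0 leNgt e0.
exists (Num.min 1 (phi c / (#|K|%:R + 1))) => [|v Hv].
  by rewrite lt_min ltr01 divr_gt0 // ltr_wpDl ?ler0n.
apply: contrapT => no.
have fv : far v by apply: in_far Hv no; rewrite ge_min lexx.
have := cmin v (mem_set fv); apply/negP; rewrite -ltNge.
apply: (@le_lt_trans _ _ (\sum_(k : K) (phi c / (#|K|%:R + 1)))).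
  by apply: ler_sum => k _; apply: le_trans (ltW (Hv k)) _; rewrite ge_min lexx orbT.
rewrite sumr_const -[_ *+ _]mulr_natr mulrAC ltr_pdivrMr ?ltr_wpDl ?ler0n //.
by rewrite ltr_pM2l //; lra.
Qed.

(** Any lift that takes the value zero at such a parameter has derivative zero there. *)
Definition flat v0 (t : R) : Prop := forall e : R, 0 < e ->
  \forall s \near t, forall v, same_orbit (v0 s) v -> `|v| <= e * `|s - t|.

(** Where the base curve vanishes to exactly first order, the lifts on both
    sides have one-sided derivatives, which the group can match. *)
Lemma isolated_zero v0 (t : R) (l : V) : v0 t = 0 -> l != 0 ->
  (forall e : R, 0 < e -> \forall s \near t, forall v, same_orbit (v0 s) v ->
     exists g, `|v - (s - t) *: act g l| <= e * `|s - t|) ->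
  (\forall s \near t, v0 s != 0 -> liftable v0 s) ->
  liftable v0 t.
Proof.
move=> vt l0 Hl Hlift.
have n0 : 0 < \big[Num.min/1]_(g : J) `|act g l|.
  apply: lt_bigmin => // g _.
  rewrite normr_gt0; apply: contra l0 => /eqP gl; apply/eqP/same_orbit0.
  by apply: same_orbit_sym; rewrite -gl; exact: act_same.
set m := \big[_/_]_(_ : J) _ in n0.
have [u Hu] := lift_liftable v0.
have m2 : 0 < m / 2 by lra.
have /near_ballP[r r0 Hr] := nearI Hlift (Hl _ m2).
have good_u s : `|s - t| < r -> s != t -> locally_good v0 u s.
  move=> sr st; have [hlift hl] := Hr s sr; apply: Hu; apply: hlift.
  apply/negP => /eqP v0s; have [g] := hl _ (same_orbit_refl (v0 s)).
  rewrite v0s sub0r normrN normrZ mulrC; apply/negP; rewrite -ltNge ltr_pM2r.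
    apply: (@lt_le_trans _ _ m); first lra.
    exact: bigmin_le_cond.
  by rewrite normr_gt0 subr_eq0.
have lim_u e : 0 < e -> exists2 a : R, 0 < a & forall s, `|s - t| < a -> s != t ->
    exists g, `|u s - (s - t) *: act g l| <= e * `|s - t|.
  move=> e0; have /near_ballP[a a0 Ha] := Hl e e0.
  exists (Num.min a r) => [|s]; first by rewrite lt_min a0.
  rewrite lt_min => /andP[sa sr] st; apply: Ha => //.
  by have [] := nbhs_singleton (good_u s sr st).
have [||g1 H1] := @path_limit_right u (fun g => act g l) t r r0.
- move=> s sr; have [||_ //] := nbhs_singleton (good_u s _ _).
    by rewrite ltr_norml; lra.
  by apply/eqP; lra.
- move=> e e0; have [a a0 Ha] := lim_u e e0; exists a => // s sa.
  have [||g] := Ha s; [by rewrite ltr_norml; lra|by apply/eqP; lra|].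
  by rewrite gtr0_norm; last lra; exists g.
have [||g2 H2] := @path_limit_left u (fun g => act g l) t r r0.
- move=> s sr; have [||_ //] := nbhs_singleton (good_u s _ _).
    by rewrite ltr_norml; lra.
  by apply/eqP; lra.
- move=> e e0; have [a a0 Ha] := lim_u e e0; exists a => // s sa.
  have [||g] := Ha s; [by rewrite ltr_norml; lra|by apply/eqP; lra|].
  by rewrite ltr0_norm ?opprB; last lra; exists g.
have [g Hg] := act_separates od
  (same_orbit_trans (same_orbit_sym (act_same g2 l)) (act_same g1 l)).
pose w s := if s < t then act g (u s) else if s == t then 0 else u s.
exists w; apply/near_ballP; exists r => // s sr.
have [st|ts|->] := ltgtP s t.
- apply: (@good_ext _ (fun s => act g (u s))).
    by apply: filterS (near_lt st) => x xt; rewrite /w xt.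
  apply: good_act; apply: (nbhs_singleton (good_u s sr _)).
  by rewrite lt_eqF.
- apply: (@good_ext _ u).
    by apply: filterS (near_gt ts) => x xt; rewrite /w ltNge ltW //= gt_eqF.
  by apply: (nbhs_singleton (good_u s sr _)); rewrite gt_eqF.
- have wt : w t = 0 by rewrite /w ltxx eqxx.
  split; first by rewrite wt vt.
  exists (act g1 l); apply/is_derive_nearP => e e0.
  have [C C0 HC] := act_bound od.
  have C1 : 0 < C + 1 by lra.
  have [a1 a10 Ha1] := H1 e e0.
  have [a2 a20 Ha2] := H2 (e / (C + 1)) ltac:(by rewrite divr_gt0).
  apply/near_ballP; exists (Num.min a1 a2) => [|x]; first by rewrite lt_min a10.
  rewrite lt_min !ltr_norml wt subr0 => /andP[xa1 xa2].
  have [xt|tx|->] := ltgtP x t.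
  + rewrite /w xt Hg -actZ -actB; apply: le_trans (HC _ _) _.
    apply: (@le_trans _ _ ((C + 1) * `|u x - (x - t) *: act g2 l|)).
      by rewrite ler_wpM2r //; lra.
    rewrite mulrC -ler_pdivlMr // mulrAC ltr0_norm ?opprB; last lra.
    by apply: Ha2; lra.
  + rewrite /w [x < t]ltNge (ltW tx) /= gt_eqF // gtr0_norm; last lra.
    by apply: Ha1; lra.
  + by rewrite wt subrr scale0r subrr !normr0 mulr0.
Qed.

(** The rescaled vectors [v / (s - t)] have invariants close to [b], hence are close
    to the fibre of the invariants over [b]. *)
Lemma homog_limit_orbit v0 (t : R) (b : K -> R) :
  (forall k, homog_limit (fun s => p k (v0 s)) t (deg k) (b k)) -> v0 t = 0 ->
  forall e : R, 0 < e -> \forall s \near t, forall v, same_orbit (v0 s) v ->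
     exists2 l, forall k, p k l = b k & `|v - (s - t) *: l| <= e * `|s - t|.
Proof.
move=> Hb vt e e0; have [a a0 Ha] := invariants_proper b e0.
have a2 : 0 < a / 2 by lra.
have Hk : \forall s \near t, forall k,
    `|p k (v0 s) - b k * (s - t) ^+ deg k| <= a / 2 * `|s - t| ^+ deg k.
  by apply: (@filter_forall R K (fun k s => _ <= _) (nbhs t)) => k; exact: Hb.
have close s v : (forall k,
    `|p k (v0 s) - b k * (s - t) ^+ deg k| <= a / 2 * `|s - t| ^+ deg k) ->
    s != t -> same_orbit (v0 s) v ->
    exists2 l, forall k, p k l = b k & `|v - (s - t) *: l| <= e * `|s - t|.
  move=> Hs st sv; have n0 : s - t != 0 by rewrite subr_eq0.
  have nn : 0 < `|s - t| by rewrite normr_gt0.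
  have [|l Hl vl] := Ha ((s - t)^-1 *: v); last first.
    exists l => //; have -> : v - (s - t) *: l = (s - t) *: ((s - t)^-1 *: v - l).
      by rewrite scalerBr scalerA divff // scale1r.
    by rewrite normrZ mulrC ler_wpM2r // ltW.
  move=> k; rewrite (inv_homog od) -(sv k).
  have nk : 0 < `|s - t| ^+ deg k by rewrite exprn_gt0.
  rewrite -(ltr_pM2r nk) -{1}normrX -normrM mulrBl exprVn mulrAC mulVf ?mul1r ?expf_neq0 //.
  by apply: le_lt_trans (Hs k) _; rewrite ltr_pM2r //; lra.
have [l0 Hl0] : exists l, forall k, p k l = b k.
  have /near_ballP[r r0 Hr] := Hk.
  have rr : `|t + r / 2 - t| < r by rewrite addrAC subrr add0r gtr0_norm; lra.
  have [||l Hl _] := close (t + r / 2) (v0 (t + r / 2)) (Hr _ rr); last by exists l.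
    by apply/eqP; lra.
  exact: same_orbit_refl.
apply: filterS Hk => s Hs v sv; have [st|st] := eqVneq s t; last exact: close.
exists l0 => //; move: sv; rewrite st vt => /same_orbit0 ->.
by rewrite subrr scale0r subrr !normr0 mulr0.
Qed.

(** A curve of orbits that is locally liftable away from the zero orbit, and
    whose invariants have the expected order at the zeros, has a differentiable
    lift: the zeros of higher order than one cut the line into open intervals
    along which local lifts can be glued, and there the lift is set to zero. *)
Theorem differentiable_lift v0 (I : set R) :
  (forall t, I t -> v0 t != 0 -> liftable v0 t) ->
  (forall t, I t -> v0 t = 0 -> forall k,
     exists b, homog_limit (fun s => p k (v0 s)) t (deg k) b) ->
  (forall t, I t -> \forall s \near t, I s) ->
  exists u, forall t, I t -> good v0 u t.
Proof.
move=> Hl Hz Iopen.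
have dich t : I t -> liftable v0 t \/ flat v0 t.
  move=> It; have [vt|vt] := eqVneq (v0 t) 0; last by left; exact: Hl.
  have [b Hb] := choice (Hz t It vt).
  have Horb := homog_limit_orbit Hb vt.
  have [zb|zb] := pselect (forall k, p k 0 = b k).
    right => e e0; apply: filterS (Horb e e0) => s Hs v /Hs[l El].
    have -> : l = 0 by apply: same_orbit0 => k; rewrite El zb.
    by rewrite scaler0 subr0.
  left; have [l Hl0] : exists l, forall k, p k l = b k.
    have [l Hl0 _] := nbhs_singleton (Horb 1 ltr01) _ (same_orbit_refl _).
    by exists l.
  apply: (isolated_zero (l := l) vt).
  - by apply/eqP => l0; apply: zb => k; rewrite -Hl0 l0.
  - move=> e e0; apply: filterS (Horb e e0) => s Hs v /Hs[l' El'].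
    by have [k|g ->] := act_separates od (u := l) (v := l'); [rewrite Hl0 El'|exists g].
  - by apply: filterS (Iopen t It) => s; exact: Hl.
have [u Hu] := lift_liftable v0.
exists (fun t => if pselect (liftable v0 t) then u t else 0) => t It.
have [lt|nlt] := pselect (liftable v0 t).
  apply: good_ext (nbhs_singleton (Hu t lt)).
  by apply: filterS (liftable_near lt) => s ls; case: pselect.
have [//|ft] := dich t It.
have vt : v0 t = 0.
  apply/eqP; rewrite -normr_le0; have := nbhs_singleton (ft 1 ltr01) _ (same_orbit_refl _).
  by rewrite subrr normr0 mulr0.
split; first by case: pselect => ? //=; rewrite vt.
exists 0; apply/is_derive_nearP => e e0; have := ft e e0; apply: filterS => s Hs.
case: (pselect (liftable v0 t)) => ? //=; rewrite scaler0 !subr0.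
case: pselect => [ls|?] /=; last by rewrite normr0 mulr_ge0 // ltW.
by apply: Hs; have [] := nbhs_singleton (Hu s ls).
Qed.

End Lifting.

(** * The groups of order 2, 3 and 12 *)

Section Groups.
Variable R : realType.

Lemma norm_pair (U W : normedModType R) (u : U) (w : W) :
  `|(u, w)| = Num.max `|u| `|w|.
Proof. by []. Qed.

Lemma max_norm_sqr (x y : R) : Num.max `|x| `|y| ^+ 2 <= x ^+ 2 + y ^+ 2.
Proof.
have := sqr_ge0 x; have := sqr_ge0 y.
have nx := real_normK (num_real x); have ny := real_normK (num_real y).
by case: (leP `|x| `|y|) => _; rewrite ?nx ?ny; lra.
Qed.

Lemma compact_pair_ball (U W : normedModType R) :
  (forall B : R, compact [set v : U | `|v| <= B]) ->
  (forall B : R, compact [set v : W | `|v| <= B]) ->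
  forall B : R, compact [set v : U * W | `|v| <= B].
Proof.
move=> cU cW B.
rewrite (_ : [set v | _] = [set u : U | `|u| <= B] `*` [set w : W | `|w| <= B]).
  exact: compact_setX.
by apply/seteqP; split=> -[u w] /=; rewrite norm_pair ge_max => /andP.
Qed.

Lemma compact_real_ball (B : R) : compact [set x : R | `|x| <= B].
Proof.
rewrite (_ : [set x | _] = `[- B, B]%classic); first exact: segment_compact.
by apply/seteqP; split=> x /=; rewrite in_itv /= ler_norml.
Qed.

Section Continuity.
Variables (T : topologicalType) (f g : T -> R).
Hypotheses (cf : continuous f) (cg : continuous g).

Lemma ctsD : continuous (fun x => f x + g x).
Proof. by move=> x; apply: cvgD; [exact: cf|exact: cg]. Qed.

Lemma ctsB : continuous (fun x => f x - g x).
Proof. by move=> x; apply: cvgB; [exact: cf|exact: cg]. Qed.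

Lemma ctsM : continuous (fun x => f x * g x).
Proof. by move=> x; apply: cvgM; [exact: cf|exact: cg]. Qed.

Lemma ctsX n : continuous (fun x => f x ^+ n).
Proof.
move=> x; apply: (@continuous_comp _ _ _ f (fun y => y ^+ n)); first exact: cf.
exact: exprn_continuous.
Qed.

Lemma ctsC (c : R) : continuous (fun _ : T => c).
Proof. by move=> x; exact: cvg_cst. Qed.

End Continuity.

Lemma cts_fst (U W : topologicalType) : continuous (@fst U W).
Proof. by move=> x; exact: cvg_fst. Qed.

Lemma cts_snd (U W : topologicalType) : continuous (@snd U W).
Proof. by move=> x; exact: cvg_snd. Qed.

Lemma cts_x (U W : topologicalType) : continuous (fun v : U * U * W => v.1.1).
Proof. by move=> x; apply: continuous_comp; exact: cts_fst. Qed.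

Lemma cts_y (U W : topologicalType) : continuous (fun v : U * U * W => v.1.2).
Proof. by move=> x; apply: continuous_comp; [exact: cts_fst|exact: cts_snd]. Qed.

(** ** Sign change in the plane *)

Definition sign_act (b : bool) (v : R * R) : R * R := if b then - v else v.

Definition sign_inv (k : 'I_3) (v : R * R) : R :=
  nth 0 [:: v.1 ^+ 2 + v.2 ^+ 2; v.1 ^+ 2 - v.2 ^+ 2; v.1 * v.2] k.

Lemma sum_sqr_eq0 (c a b : R) : 0 < c -> a ^+ 2 + c * b ^+ 2 = 0 -> a = 0 /\ b = 0.
Proof.
move=> c0 H; have h1 : 0 <= a ^+ 2 := sqr_ge0 a; have h2 : 0 <= c * b ^+ 2.
  by rewrite mulr_ge0 ?sqr_ge0 // ltW.
have a0 : a ^+ 2 = 0 by lra.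
have /eqP : c * b ^+ 2 = 0 by lra.
rewrite mulf_eq0 (gt_eqF c0) /= sqrf_eq0 => /eqP ->.
by move/eqP: a0; rewrite sqrf_eq0 => /eqP ->.
Qed.

Lemma sign_orbit_data : orbit_data sign_act sign_inv (fun=> 2%N).
Proof.
split.
- by move=> [] c u v //=; rewrite scalerN opprD.
- by exists 1 => // -[] v; rewrite mul1r ?normrN.
- by move=> [] [[|[|[|//]]] ?] [x y] //=; rewrite /sign_inv /= ?sqrrN ?mulrNN.
- move=> [x y] [x' y'] H.
  have := H ord0; have := H (inord 1); have := H (inord 2).
  rewrite /sign_inv /= !inordK //= => xy b a.
  have /eqP : ((x' - x) ^+ 2 + 1 * (y' - y) ^+ 2) * ((x' + x) ^+ 2 + 1 * (y' + y) ^+ 2) = 0.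
    transitivity ((x' ^+ 2 - y' ^+ 2 - (x ^+ 2 - y ^+ 2)) ^+ 2 + 4 * (x' * y' - x * y) ^+ 2).
      ring.
    by rewrite b xy; ring.
  rewrite mulf_eq0 => /orP[]/eqP/(sum_sqr_eq0 ltr01)[h1 h2].
    by exists false => /=; congr (_, _); lra.
  by exists true; rewrite /sign_act; congr (_, _); rewrite /=; lra.
- pose x2 := ctsX (n:=2) (@cts_fst R R); pose y2 := ctsX (n:=2) (@cts_snd R R).
  move=> [[|[|[|//]]] ?]; [exact: (ctsD x2 y2)|exact: (ctsB x2 y2)|].
  exact: (ctsM (@cts_fst R R) (@cts_snd R R)).
- by move=> k c [x y]; case: k => -[|[|[|//]]] ?; rewrite /sign_inv /= /GRing.scale /=; ring.
- exists ord0, 1 => // -[x y]; rewrite mul1r; exact: max_norm_sqr.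
- exact: compact_pair_ball compact_real_ball compact_real_ball.
Qed.

(** ** Rotation of order three of the plane *)

(** With [w = a + i sqrt 3 b], the functions below are [|w|^2] and the
    coordinates of [w^3]. *)
Definition rnorm (a b : R) : R := a ^+ 2 + 3 * b ^+ 2.
Definition rcube1 (a b : R) : R := a ^+ 3 - 9 * a * b ^+ 2.
Definition rcube2 (a b : R) : R := 3 * a ^+ 2 * b - 3 * b ^+ 3.

Lemma rcube_norm a b : rcube1 a b ^+ 2 + 3 * rcube2 a b ^+ 2 = rnorm a b ^+ 3.
Proof. by rewrite /rcube1 /rcube2 /rnorm; ring. Qed.

Definition rot_act (k : 'I_3) (v : R * R) : R * R :=
  nth v [:: v; (- v.1 / 2 - 3 * v.2 / 2, v.1 / 2 - v.2 / 2);
               (- v.1 / 2 + 3 * v.2 / 2, - v.1 / 2 - v.2 / 2)] k.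

Definition rot_inv (k : 'I_3) (v : R * R) : R :=
  nth 0 [:: rnorm v.1 v.2; rcube1 v.1 v.2; rcube2 v.1 v.2] k.

Definition rot_deg (k : 'I_3) : nat := nth 0%N [:: 2; 3; 3]%N k.

Lemma rcube_eq a b a' b' : rcube1 a b = rcube1 a' b' -> rcube2 a b = rcube2 a' b' ->
  exists k, (a', b') = rot_act k (a, b).
Proof.
move=> h1 h2.
have /eqP : ((a' - a) ^+ 2 + 3 * (b' - b) ^+ 2) *
  ((a' - (- a / 2 - 3 * b / 2)) ^+ 2 + 3 * (b' - (a / 2 - b / 2)) ^+ 2) *
  ((a' - (- a / 2 + 3 * b / 2)) ^+ 2 + 3 * (b' - (- a / 2 - b / 2)) ^+ 2) = 0.
  transitivity ((rcube1 a' b' - rcube1 a b) ^+ 2 + 3 * (rcube2 a' b' - rcube2 a b) ^+ 2).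
    by rewrite /rcube1 /rcube2; field.
  by rewrite h1 h2; ring.
have p3 : 0 < 3 :> R by [].
rewrite !mulf_eq0 => /orP[/orP[]|] /eqP/(sum_sqr_eq0 p3)[e1 e2].
- by exists ord0; rewrite /rot_act /=; congr (_, _); lra.
- by exists (inord 1); rewrite /rot_act inordK //=; congr (_, _); lra.
- by exists (inord 2); rewrite /rot_act inordK //=; congr (_, _); lra.
Qed.

Lemma rot_act_inv g a b : [/\ rnorm (rot_act g (a, b)).1 (rot_act g (a, b)).2 = rnorm a b,
    rcube1 (rot_act g (a, b)).1 (rot_act g (a, b)).2 = rcube1 a b &
    rcube2 (rot_act g (a, b)).1 (rot_act g (a, b)).2 = rcube2 a b].
Proof.
by case: g => -[|[|[|//]]] ?; rewrite /rot_act /rnorm /rcube1 /rcube2 /=; split; field.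
Qed.

Section CubeContinuity.
Variables (T : topologicalType) (f g : T -> R).
Hypotheses (cf : continuous f) (cg : continuous g).

Lemma rnorm_cts : continuous (fun x => rnorm (f x) (g x)).
Proof. exact: (ctsD (ctsX (n:=2) cf) (ctsM (ctsC (T:=T) (c:=3)) (ctsX (n:=2) cg))). Qed.

Lemma rcube1_cts : continuous (fun x => rcube1 (f x) (g x)).
Proof. exact: (ctsB (ctsX (n:=3) cf) (ctsM (ctsM (ctsC (T:=T) (c:=9)) cf) (ctsX (n:=2) cg))). Qed.

Lemma rcube2_cts : continuous (fun x => rcube2 (f x) (g x)).
Proof.
exact: (ctsB (ctsM (ctsM (ctsC (T:=T) (c:=3)) (ctsX (n:=2) cf)) cg) (ctsM (ctsC (T:=T) (c:=3)) (ctsX (n:=3) cg))).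
Qed.

End CubeContinuity.

Lemma rot_orbit_data : orbit_data rot_act rot_inv rot_deg.
Proof.
split.
- by move=> k c [a b] [a' b']; case: k => -[|[|[|//]]] ?; rewrite /rot_act //=; congr (_, _);
    rewrite /= /GRing.scale /=; field.
- exists 2 => // g [a b]; rewrite !norm_pair.
  set m := Num.max `|a| `|b|.
  have : `|a| <= m by rewrite /m le_max lexx.
  have : `|b| <= m by rewrite /m le_max lexx orbT.
  rewrite !ler_norml => h1 h2.
  by case: g => -[|[|[|//]]] ?; rewrite /rot_act /= norm_pair ge_max !ler_norml;
    apply/andP; split; lra.
- move=> g k [a b]; have [h1 h2 h3] := rot_act_inv g a b.
  by case: k => -[|[|[|//]]] ?; rewrite /rot_inv.
- move=> [a b] [a' b'] H; apply: rcube_eq.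
    by have := H (inord 1); rewrite /rot_inv inordK.
  by have := H (inord 2); rewrite /rot_inv inordK.
- move=> [[|[|[|//]]] ?].
  + exact: (rnorm_cts (@cts_fst R R) (@cts_snd R R)).
  + exact: (rcube1_cts (@cts_fst R R) (@cts_snd R R)).
  + exact: (rcube2_cts (@cts_fst R R) (@cts_snd R R)).
- by move=> k c [x y]; case: k => -[|[|[|//]]] ?;
    rewrite /rot_inv /rnorm /rcube1 /rcube2 /= /GRing.scale /=; ring.
- exists ord0, 1 => // -[x y]; rewrite mul1r; apply: le_trans (max_norm_sqr x y) _.
  by rewrite /rot_inv /rnorm /= lerD2l ler_peMl ?sqr_ge0 // ler1n.
- exact: compact_pair_ball compact_real_ball compact_real_ball.
Qed.

(** ** Rotations of the tetrahedron *)

(** In the coordinates along the axes through the midpoints of opposite edges,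
    the rotations are the cyclic permutations composed with the even sign
    changes.  On the squares [X, Y, Z] of the coordinates, the cyclic
    permutations act by rotations of the complex number
    [X + exp(2 i pi / 3) Y + exp(4 i pi / 3) Z], equal to [wa + i sqrt 3 wb]. *)
Notation vec := (R * R * R)%type.

Definition wa (v : vec) : R := v.1.1 ^+ 2 - (v.1.2 ^+ 2 + v.2 ^+ 2) / 2.
Definition wb (v : vec) : R := (v.1.2 ^+ 2 - v.2 ^+ 2) / 2.

Definition inv2 (v : vec) : R := v.1.1 ^+ 2 + v.1.2 ^+ 2 + v.2 ^+ 2.
Definition inv3 (v : vec) : R := v.1.1 * v.1.2 * v.2.
Definition inv4 (v : vec) : R := rnorm (wa v) (wb v).
Definition inv6a (v : vec) : R := rcube1 (wa v) (wb v).
Definition inv6b (v : vec) : R := rcube2 (wa v) (wb v).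

Definition cyc (v : vec) : vec := (v.1.2, v.2, v.1.1).

Definition flip (s : bool * bool) (v : vec) : vec :=
  ((-1) ^+ s.1 * v.1.1, (-1) ^+ s.2 * v.1.2, (-1) ^+ (s.1 (+) s.2) * v.2).

Definition tet_act (g : 'I_3 * (bool * bool)) (v : vec) : vec :=
  flip g.2 (iter g.1 cyc v).

Definition tet_inv (k : 'I_5) (v : vec) : R :=
  nth 0 [:: inv2 v; inv3 v; inv4 v; inv6a v; inv6b v] k.

Definition tet_deg (k : 'I_5) : nat := nth 0%N [:: 2; 3; 4; 6; 6]%N k.

Lemma tet_invP u v : (forall k, tet_inv k u = tet_inv k v) <->
  [/\ inv2 u = inv2 v, inv3 u = inv3 v, inv4 u = inv4 v, inv6a u = inv6a v
    & inv6b u = inv6b v].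
Proof.
split=> [H|[h1 h2 h3 h4 h5] [[|[|[|[|[|//]]]]] ?] //].
have := H ord0; have := H (inord 1); have := H (inord 2); have := H (inord 3).
have := H (inord 4).
by rewrite /tet_inv /= !inordK.
Qed.

Lemma flip_sqr s v : [/\ (flip s v).1.1 ^+ 2 = v.1.1 ^+ 2,
  (flip s v).1.2 ^+ 2 = v.1.2 ^+ 2, (flip s v).2 ^+ 2 = v.2 ^+ 2 &
  inv3 (flip s v) = inv3 v].
Proof.
by case: s => -[] []; rewrite /flip /inv3 /= ?expr0 ?expr1; split; ring.
Qed.

Lemma flip_inv s v k : tet_inv k (flip s v) = tet_inv k v.
Proof.
have [h1 h2 h3 h4] := flip_sqr s v; move: k; apply/tet_invP.
by split=> //; rewrite /inv2 /inv4 /inv6a /inv6b /wa /wb h1 h2 h3.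
Qed.

Lemma cyc_inv v k : tet_inv k (cyc v) = tet_inv k v.
Proof.
move: k; apply/tet_invP; rewrite /inv2 /inv3 /inv4 /inv6a /inv6b /rnorm /rcube1 /rcube2.
by rewrite /wa /wb /cyc /=; split; field.
Qed.

Lemma tet_act_inv g k v : tet_inv k (tet_act g v) = tet_inv k v.
Proof.
rewrite /tet_act flip_inv; elim: (nat_of_ord g.1) => //= n IH.
by rewrite cyc_inv.
Qed.

Lemma squares_w v : [/\ v.1.1 ^+ 2 = (inv2 v + 2 * wa v) / 3,
  v.1.2 ^+ 2 = (inv2 v - wa v) / 3 + wb v & v.2 ^+ 2 = (inv2 v - wa v) / 3 - wb v].
Proof. by rewrite /inv2 /wa /wb; split; field. Qed.

Lemma sign_of_sqr (x y : R) : x ^+ 2 = y ^+ 2 -> exists s : bool, y = (-1) ^+ s * x.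
Proof.
move/eqP; rewrite eqf_sqr => /orP[]/eqP ->.
  by exists false; rewrite mul1r.
by exists true; rewrite expr1 mulN1r opprK.
Qed.

Lemma flip_separates u v : u.1.1 ^+ 2 = v.1.1 ^+ 2 -> u.1.2 ^+ 2 = v.1.2 ^+ 2 ->
  u.2 ^+ 2 = v.2 ^+ 2 -> inv3 u = inv3 v -> exists s, v = flip s u.
Proof.
case: u v => [[x y] z] [[x' y'] z'] /=.
move=> /sign_of_sqr[s1 ->] /sign_of_sqr[s2 ->] /sign_of_sqr[s3 ->].
rewrite /inv3 /= => E.
have [s3E|s3N] := eqVneq s3 (s1 (+) s2); first by exists (s1, s2); rewrite /flip /= s3E.
have {}s3N : s3 = ~~ (s1 (+) s2) by move: s3N; case: s1 s2 s3 {E} => [] [] [].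
have xyz : x * y * z = 0.
  by move: E; rewrite s3N; case: s1 {s3N} => //=; case: s2 => /=;
    rewrite ?expr0 ?expr1; lra.
move/eqP: xyz; rewrite !mulf_eq0 => /orP[/orP[]|]/eqP z0.
- exists (~~ s1, s2); rewrite /flip /= z0 !mulr0 s3N; congr (_, _ * _).
  by case: s1 {E s3N}; case: s2.
- exists (s1, ~~ s2); rewrite /flip /= z0 !mulr0 s3N; congr (_, _ * _).
  by case: s1 {E s3N}; case: s2.
- by exists (s1, s2); rewrite /flip /= z0 !mulr0.
Qed.

Lemma tet_separates u v : (forall k, tet_inv k u = tet_inv k v) -> exists g, v = tet_act g u.
Proof.
move=> /tet_invP[h2 h3 h4 h6a h6b].
have [k Ek] := rcube_eq h6a h6b.
suff [m [Em1 Em2 Em3]] : exists m : 'I_3, [/\ (iter m cyc u).1.1 ^+ 2 = v.1.1 ^+ 2,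
     (iter m cyc u).1.2 ^+ 2 = v.1.2 ^+ 2 & (iter m cyc u).2 ^+ 2 = v.2 ^+ 2].
  have [|s Es] := flip_separates Em1 Em2 Em3; last by exists (m, s).
  rewrite -h3; case: (m) => i /= _; elim: i => //= i <-.
  by rewrite /inv3 /cyc /=; ring.
have [v1 v2 v3] := squares_w v; rewrite v1 v2 v3 -h2.
have [u1 u2 u3] := squares_w u.
case: k Ek => -[|[|[|//]]] ? /=; rewrite /rot_act /= => -[-> ->].
- by exists ord0 => /=; rewrite u1 u2 u3.
- exists (inord 2); by rewrite inordK //= u1 u2 u3; split; field.
- exists (inord 1); by rewrite inordK //= u1 u2 u3; split; field.
Qed.

Lemma tet_orbit_data : orbit_data tet_act tet_inv tet_deg.
Proof.
have cyc_lin c u v : cyc (c *: u + v) = c *: cyc u + cyc v by [].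
have flip_lin s c u v : flip s (c *: u + v) = c *: flip s u + flip s v.
  by rewrite /flip /=; congr (_, _, _); rewrite /= /GRing.scale /=; ring.
split.
- move=> [m s] c u v; rewrite /tet_act /= -flip_lin; congr flip.
  by elim: (nat_of_ord m) => //= n ->.
- have flip_norm s v : `|flip s v| = `|v|.
    by case: v => [[x y] z]; rewrite /flip !norm_pair !normrM !normrX normrN1 !expr1n !mul1r.
  have cyc_norm v : `|cyc v| = `|v|.
    by case: v => [[x y] z]; rewrite /cyc !norm_pair /= maxC maxA.
  exists 1 => // -[m s] v; rewrite mul1r /tet_act flip_norm /=.
  by elim: (nat_of_ord m) => //= n; rewrite cyc_norm.
- by move=> g k v; exact: tet_act_inv.
- exact: tet_separates.
- pose X := ctsX (n:=2) (@cts_x R R); pose Y := ctsX (n:=2) (@cts_y R R).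
  pose Z := ctsX (n:=2) (@cts_snd (R * R)%type R).
  have ca : continuous wa by exact: (ctsB X (ctsM (ctsD Y Z) (ctsC (c:=2^-1)))).
  have cb : continuous wb by exact: (ctsM (ctsB Y Z) (ctsC (c:=2^-1))).
  move=> [[|[|[|[|[|//]]]]] ?].
  + exact: (ctsD (ctsD X Y) Z).
  + exact: (ctsM (ctsM (@cts_x R R) (@cts_y R R)) (@cts_snd (R * R)%type R)).
  + exact: (rnorm_cts ca cb).
  + exact: (rcube1_cts ca cb).
  + exact: (rcube2_cts ca cb).
- by move=> k c [[x y] z]; case: k => -[|[|[|[|[|//]]]]] ?; rewrite /tet_inv /inv2 /inv3 /inv4;
  rewrite /inv6a /inv6b /rnorm /rcube1 /rcube2 /wa /wb /= /GRing.scale /=; field.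
- exists ord0, 1 => // -[[x y] z]; rewrite mul1r /tet_inv /inv2 /= !norm_pair.
  have := max_norm_sqr (Num.max `|x| `|y|) z; rewrite ger0_norm ?le_max ?normr_ge0 //.
  by move=> /le_trans; apply; rewrite lerD2r max_norm_sqr.
- apply: compact_pair_ball; last exact: compact_real_ball.
  exact: compact_pair_ball compact_real_ball compact_real_ball.
Qed.

End Groups.

(** * Functions of class C^k *)

Section Regular.
Variable R : realType.
Implicit Types (f g : R -> R) (I : set R).

Definition regular (k : nat) I f := exists D : nat -> R -> R,
  [/\ D 0%N = f, tower k I D & forall t, I t -> {for t, continuous (D k)}].

Lemma regular0 I f : regular 0 I f <-> forall t, I t -> {for t, continuous f}.
Proof.
split=> [[D [<- _]] //|H]; exists (fun=> f); split=> //.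
Qed.

Lemma regularS k I f : regular k.+1 I f <->
  exists2 f1, forall t, I t -> is_derive t 1 f (f1 t) & regular k I f1.
Proof.
split=> [[D [<- dD cD]]|[f1 df [D [D0 dD cD]]]].
  exists (D 1%N); first exact: dD.
  by exists (fun i => D i.+1); split=> // i ik; exact: dD.
exists (fun i => if i is j.+1 then D j else f); split=> //.
move=> [|i] ik t It; first by rewrite D0; exact: df.
exact: dD.
Qed.

Lemma regularSW k I f : regular k.+1 I f -> regular k I f.
Proof.
move=> [D [D0 dD cD]]; exists D; split=> //.
  by move=> i ik; apply: dD; exact: leqW.
by move=> t It; apply: is_derive_continuous (dD k (ltnSn k) t It).
Qed.

Lemma regularW k m I f : (m <= k)%N -> regular k I f -> regular m I f.
Proof.
move=> /subnKC <-; elim: (k - m)%N => [|n IH]; first by rewrite addn0.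
by rewrite addnS => /regularSW.
Qed.

Lemma regular_cst k I (c : R) : regular k I (fun=> c).
Proof.
elim: k c => [|k IH] c; first by apply/regular0 => t _; exact: cvg_cst.
by apply/regularS; exists (fun=> 0) => // t _; exact: der_cst.
Qed.

Lemma regularD k I f g : regular k I f -> regular k I g -> regular k I (fun t => f t + g t).
Proof.
elim: k f g => [|k IH] f g.
  move=> /regular0 cf /regular0 cg; apply/regular0 => t It.
  by apply: cvgD; [exact: cf|exact: cg].
move=> /regularS[f1 df rf] /regularS[g1 dg rg]; apply/regularS.
exists (fun t => f1 t + g1 t); last exact: IH.
by move=> t It; exact: derD (df t It) (dg t It).
Qed.

Lemma regularM k I f g : regular k I f -> regular k I g -> regular k I (fun t => f t * g t).
Proof.
elim: k f g => [|k IH] f g.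
  move=> /regular0 cf /regular0 cg; apply/regular0 => t It.
  by apply: cvgM; [exact: cf|exact: cg].
move=> rf rg; move: (rf) (rg) => /regularS[f1 df rf1] /regularS[g1 dg rg1]; apply/regularS.
exists (fun t => f1 t * g t + f t * g1 t).
  by move=> t It; exact: derM (df t It) (dg t It).
by apply: regularD; apply: IH => //; exact: regularSW.
Qed.

Lemma regularB k I f g : regular k I f -> regular k I g -> regular k I (fun t => f t - g t).
Proof.
move=> rf rg; have := regularD rf (regularM (regular_cst k I (-1)) rg).
by under eq_fun do rewrite mulN1r.
Qed.

Lemma regular_der k I f t : (0 < k)%N -> regular k I f -> I t ->
  exists d, is_derive t 1 f d.
Proof.
by case: k => // k _ /regularS[f1 df _] It; exists (f1 t); exact: df.
Qed.

Lemma regular_homog_limit k I f t (C : R) : regular k I f ->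
  (\forall s \near t, I s) ->
  (\forall s \near t, `|f s| <= C * `|s - t| ^+ k) -> exists b, homog_limit f t k b.
Proof.
move=> [D [<- dD cD]] It; apply: bigO_homog_limit; last exact/cD/(nbhs_singleton It).
by move=> i ik; apply: filterS It => s; exact: dD.
Qed.

(** A zero of a nonnegative function is a critical point. *)
Lemma regular_zero_sqr I f t : regular 2 I f -> (\forall s \near t, I s) ->
  (\forall s \near t, 0 <= f s) -> f t = 0 ->
  exists2 C : R, 0 <= C & \forall s \near t, f s <= C * (s - t) ^+ 2.
Proof.
move=> [D [D0 dD cD]] nI f_ge0 ft; have It := nbhs_singleton nI.
have D1 : D 1%N t = 0.
  apply/normr0_eq0/le_anti; rewrite normr_ge0 andbT.
  apply: (@le0_eps _ _ 1) => // e e0; rewrite mul1r.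
  have := dD 0%N isT t It; rewrite D0 => /is_derive_nearP/(_ e e0) H.
  have /near_ballP[r r0 Hr] := nearI H f_ge0.
  have r2 : `|t + r / 2 - t| < r by rewrite addrAC subrr add0r gtr0_norm; lra.
  have r3 : `|t - r / 2 - t| < r by rewrite addrAC subrr add0r normrN gtr0_norm; lra.
  have := Hr _ r2; have := Hr _ r3; rewrite ft !subr0.
  have -> : t - r / 2 - t = - (r / 2) by ring.
  have -> : t + r / 2 - t = r / 2 by ring.
  have h0 : 0 < r / 2 by lra.
  rewrite normrN (gtr0_norm h0) !ler_norml /GRing.scale /=; set h := r / 2 in h0 *.
  move=> [/andP[a1 a2] a3] [/andP[b1 b2] b3].
  by apply/andP; split; rewrite -(ler_pM2r h0); nra.
have := @peano _ 2 D t _ (cD t It) _ 1 ltr01.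
rewrite D0; set b := D 2%N t / 2`!%:R => P.
exists (`|b| + 1); first by rewrite addr_ge0.
have {}P : \forall s \near t, `|f s - b * (s - t) ^+ 2| <= 1 * `|s - t| ^+ 2.
  apply: P => [i i2|i]; first by apply: filterS nI => s; exact: dD.
  by case: i => [|[|]] // _; rewrite D0.
apply: filterS P => s; rewrite mul1r real_normK ?num_real // ler_norml.
move=> /andP[_]; have := ler_norm b; have := sqr_ge0 (s - t); nra.
Qed.

Lemma sqr_bigO (f g : R -> R) (t c C : R) (d : nat) : 0 <= c -> 0 <= C ->
  (\forall s \near t, f s ^+ 2 <= c * g s ^+ d) ->
  (\forall s \near t, 0 <= g s <= C * (s - t) ^+ 2) ->
  \forall s \near t, `|f s| <= (c + 1) * (C + 1) ^+ d * `|s - t| ^+ d.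
Proof.
move=> c0 C0 H1 H2; have := nearI H1 H2; apply: filterS => s [h1 /andP[h2 h3]].
have C1 : 0 <= C + 1 by lra.
rewrite -(@ler_pXn2r _ 2) ?nnegrE ?mulr_ge0 ?exprn_ge0 //; last by lra.
rewrite real_normK ?num_real // !exprMn; apply: le_trans h1 _.
rewrite -mulrA; apply: ler_pM => //; first by rewrite exprn_ge0.
  nra.
rewrite -!exprM ![(d * 2)%N]mulnC !exprM -exprMn lerXn2r ?nnegrE ?mulr_ge0 ?exprn_ge0 //.
apply: le_trans h3 _; rewrite real_normK ?num_real // ler_wpM2r ?sqr_ge0 //; nra.
Qed.

Lemma homog_limitB f g t k b c : homog_limit f t k b -> homog_limit g t k c ->
  homog_limit (fun s => f s - g s) t k (b - c).
Proof.
move=> Hf Hg e e0; have e2 : 0 < e / 2 by lra.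
have := nearI (Hf _ e2) (Hg _ e2); apply: filterS => s [h1 h2].
have -> : f s - g s - (b - c) * (s - t) ^+ k =
   (f s - b * (s - t) ^+ k) - (g s - c * (s - t) ^+ k) by ring.
apply: le_trans (ler_normB _ _) _; apply: le_trans (lerD h1 h2) _.
by rewrite -mulrDl -splitr.
Qed.

Lemma homog_limit_ext f g t k b : (\forall s \near t, f s = g s) ->
  homog_limit f t k b -> homog_limit g t k b.
Proof.
by move=> fg Hf e e0; have := nearI fg (Hf e e0); apply: filterS => s [->].
Qed.

Lemma homog_limitM f (phi : R -> R) t k b : homog_limit f t k b ->
  {for t, continuous phi} -> homog_limit (fun s => f s * phi s) t k (b * phi t).
Proof.
move=> Hf /cvgrPdist_le cphi e e0.
pose A := `|phi t| + 1.
have A0 : 0 < A by rewrite ltr_wpDl.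
have B0 : 0 < `|b| + 1 by rewrite ltr_wpDl.
have e1 : 0 < e / (2 * A) by rewrite divr_gt0 // mulr_gt0.
have e2 : 0 < e / (2 * (`|b| + 1)) by rewrite divr_gt0 // mulr_gt0.
have := nearI (Hf _ e1) (nearI (cphi _ e2) (cphi _ ltr01)).
apply: filterS => s [h1 [h2 h3]].
have ps : `|phi s| <= A.
  have -> : phi s = phi t - (phi t - phi s) by ring.
  by apply: le_trans (ler_normB _ _) _; rewrite lerD2l.
have -> : f s * phi s - b * phi t * (s - t) ^+ k =
   (f s - b * (s - t) ^+ k) * phi s - b * (phi t - phi s) * (s - t) ^+ k by ring.
apply: le_trans (ler_normB _ _) _; rewrite !normrM normrX.
set h := `|s - t| ^+ k in h1 *; have h0 : 0 <= h by rewrite exprn_ge0.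
have q1 := ler_pM (normr_ge0 _) (normr_ge0 _) h1 ps.
have bb : `|b| <= `|b| + 1 by lra.
have q2 := ler_wpM2r h0 (ler_pM (normr_ge0 _) (normr_ge0 _) bb h2).
apply: le_trans (lerD q1 q2) _.
rewrite le_eqVlt; apply/orP; left; apply/eqP; field.
by rewrite !gt_eqF.
Qed.

End Regular.

(** * Differentiable cube roots *)

Section Differentiable.
Variable R : realType.

Definition dif (f : R -> R) (t : R) := exists d, is_derive t 1 f d.

Lemma difD (f g : R -> R) (t : R) : dif f t -> dif g t -> dif (fun s => f s + g s) t.
Proof. by move=> [d df] [e dg]; exists (d + e); exact: derD. Qed.

Lemma difB (f g : R -> R) (t : R) : dif f t -> dif g t -> dif (fun s => f s - g s) t.
Proof. by move=> [d df] [e dg]; exists (d - e); exact: derB. Qed.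

Lemma difM (f g : R -> R) (t : R) : dif f t -> dif g t -> dif (fun s => f s * g s) t.
Proof. by move=> [d df] [e dg]; eexists; exact: derM df dg. Qed.

Lemma difV (f : R -> R) (t : R) : f t != 0 -> dif f t -> dif (fun s => (f s)^-1) t.
Proof. by move=> f0 [d df]; eexists; exact: derV df f0. Qed.

Lemma difC (c t : R) : dif (fun=> c) t.
Proof. by exists 0; exact: der_cst. Qed.

Lemma dif_sqrt (f : R -> R) (t : R) : 0 < f t -> dif f t -> dif (fun s => Num.sqrt (f s)) t.
Proof. by move=> f0 [d df]; eexists; exact: der_sqrt df f0. Qed.

Lemma dif_comp (h f : R -> R) (t : R) : dif h (f t) -> dif f t -> dif (fun s => h (f s)) t.
Proof.
by move=> [e dh] [d df]; exists (e * d); exact: (@is_derive1_comp _ h f).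
Qed.

Lemma dif_atan (t : R) : dif (@atan R) t.
Proof. by eexists; exact: is_derive1_atan. Qed.

Lemma dif_cos (t : R) : dif (@cos R) t. Proof. by eexists; exact: is_derive_cos. Qed.

Lemma dif_sin (t : R) : dif (@sin R) t. Proof. by eexists; exact: is_derive_sin. Qed.

Lemma dif_cts (f : R -> R) (t : R) : dif f t -> {for t, continuous f}.
Proof. by case=> d; exact: is_derive_continuous. Qed.

Lemma cts_gt0 (f : R -> R) (t : R) : {for t, continuous f} -> 0 < f t -> \forall s \near t, 0 < f s.
Proof. by move=> /cvgr_gt cf f0; exact: cf. Qed.

Lemma der_pair (U W : normedModType R) (f : R -> U) (g : R -> W) (t : R) (d : U) (e : W) :
  is_derive t 1 f d -> is_derive t 1 g e ->
  is_derive t 1 (fun s => (f s, g s)) (d, e).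
Proof.
move=> /is_derive_nearP Hf /is_derive_nearP Hg; apply/is_derive_nearP => c c0.
have := nearI (Hf c c0) (Hg c c0); apply: filterS => s [h1 h2].
have -> : (f s, g s) - (f t, g t) - (s - t) *: (d, e) =
   (f s - f t - (s - t) *: d, g s - g t - (s - t) *: e) by [].
by rewrite norm_pair ge_max h1.
Qed.

Lemma der_fst (U W : normedModType R) (f : R -> U * W) (t : R) (d : U * W) :
  is_derive t 1 f d -> is_derive t 1 (fun s => (f s).1) d.1.
Proof.
move=> /is_derive_nearP H; apply/is_derive_nearP => c c0; apply: filterS (H c c0) => s.
have -> : (f s).1 - (f t).1 - (s - t) *: d.1 = (f s - f t - (s - t) *: d).1 by [].
by apply: le_trans; case: (f s - _ - _) => x y; rewrite norm_pair le_max lexx.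
Qed.

Lemma der_snd (U W : normedModType R) (f : R -> U * W) (t : R) (d : U * W) :
  is_derive t 1 f d -> is_derive t 1 (fun s => (f s).2) d.2.
Proof.
move=> /is_derive_nearP H; apply/is_derive_nearP => c c0; apply: filterS (H c c0) => s.
have -> : (f s).2 - (f t).2 - (s - t) *: d.2 = (f s - f t - (s - t) *: d).2 by [].
by apply: le_trans; case: (f s - _ - _) => x y; rewrite norm_pair le_max lexx orbT.
Qed.

Lemma dif_pair (f g : R -> R) (t : R) : dif f t -> dif g t ->
  exists d, is_derive t 1 (fun s => (f s, g s) : R * R) d.
Proof. by move=> [d df] [e dg]; exists (d, e); exact: der_pair. Qed.

Lemma cos_sin_atan3 (x : R) (c := cos (atan x / 3)) (s := sin (atan x / 3)) :
  [/\ c ^+ 2 + s ^+ 2 = 1, c ^+ 3 - 3 * c * s ^+ 2 = cos (atan x)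
    & 3 * c ^+ 2 * s - s ^+ 3 = x * cos (atan x)].
Proof.
have E : atan x = atan x / 3 + atan x / 3 + atan x / 3 by field.
split; first exact: cos2Dsin2.
  by rewrite [in RHS]E !(cosD, sinD) -/c -/s; ring.
have cn0 : cos (atan x) != 0 by rewrite cos_atan invr_eq0 gt_eqF // sqrtr_gt0; nra.
have -> : x * cos (atan x) = sin (atan x) by rewrite -{1}(atanK x) /tan divfK.
by rewrite [in RHS]E !(cosD, sinD) -/c -/s; ring.
Qed.

(** The cube root of [f1 + i sqrt 3 f2] on the branch through [a0 + i sqrt 3 b0]:
    divide by the value at the base point, so that the argument is small, and
    take a third of the argument. *)
Lemma cube_root (f1 f2 g : R -> R) (a0 b0 t : R)
    (alpha := fun s => f1 s * f1 t + 3 * f2 s * f2 t)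
    (beta := fun s => Num.sqrt 3 * (f2 s * f1 t - f1 s * f2 t))
    (m := fun s => Num.sqrt (g s * g t))
    (theta := fun s => atan (beta s / alpha s) / 3)
    (a := fun s => m s / g t * (a0 * cos (theta s) - Num.sqrt 3 * b0 * sin (theta s)))
    (b := fun s => m s / g t * (a0 * sin (theta s) / Num.sqrt 3 + b0 * cos (theta s))) :
  g t = rnorm a0 b0 -> f1 t = rcube1 a0 b0 -> f2 t = rcube2 a0 b0 -> 0 < g t ->
  forall s, f1 s ^+ 2 + 3 * f2 s ^+ 2 = g s ^+ 3 -> 0 < g s -> 0 < alpha s ->
    [/\ rnorm (a s) (b s) = g s, rcube1 (a s) (b s) = f1 s & rcube2 (a s) (b s) = f2 s].
Proof.
move=> gt ft1 ft2 gt0 s fg gs0 as0.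
have [] := cos_sin_atan3 (beta s / alpha s).
rewrite /a /b -/(theta s).
set C := cos (theta s); set S := sin (theta s).
have q0 : Num.sqrt 3 != 0 :> R by rewrite gt_eqF // sqrtr_gt0.
have q2 : Num.sqrt 3 ^+ 2 = 3 :> R by rewrite sqr_sqrtr.
have m2 : m s ^+ 2 = g s * g t by rewrite /m sqr_sqrtr // mulr_ge0 // ltW.
have m0 : 0 < m s by rewrite sqrtr_gt0 mulr_gt0.
have ab : alpha s ^+ 2 + beta s ^+ 2 = (m s ^+ 3) ^+ 2.
  have -> : (m s ^+ 3) ^+ 2 = g s ^+ 3 * g t ^+ 3.
    by rewrite -exprMn -m2 -!exprM.
  rewrite -fg gt -rcube_norm -ft1 -ft2 /alpha /beta.
  by rewrite [(Num.sqrt 3 * _) ^+ 2]exprMn q2; ring.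
have cosE : cos (atan (beta s / alpha s)) = alpha s / m s ^+ 3.
  rewrite cos_atan.
  have -> : 1 + (beta s / alpha s) ^+ 2 = (m s ^+ 3 / alpha s) ^+ 2.
    by rewrite !expr_div_n -ab; field; rewrite gt_eqF.
  by rewrite sqrtr_sqr gtr0_norm ?divr_gt0 ?exprn_gt0 // invf_div.
rewrite cosE => CS h1 h2.
have {}h2 : 3 * C ^+ 2 * S - S ^+ 3 = beta s / m s ^+ 3.
  by rewrite h2; field; rewrite !gt_eqF.
have gn0 : g t != 0 by rewrite gt_eqF.
have mn0 : m s != 0 by rewrite gt_eqF.
have g3 : g t ^+ 3 = f1 t ^+ 2 + 3 * f2 t ^+ 2 by rewrite ft1 ft2 gt rcube_norm.
set q := Num.sqrt 3 in q0 q2 *.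
(* Written with [q ^+ 2] instead of [3], the formulas hold for every [q]. *)
have c1 x y : rcube1 x y = x ^+ 3 - 3 * q ^+ 2 * x * y ^+ 2 by rewrite q2 /rcube1; ring.
have c2 x y : rcube2 x y = 3 * x ^+ 2 * y - q ^+ 2 * y ^+ 3 by rewrite q2 /rcube2; ring.
split.
- rewrite /rnorm.
  have -> : (m s / g t * (a0 * C - q * b0 * S)) ^+ 2 +
      3 * (m s / g t * (a0 * S / q + b0 * C)) ^+ 2 =
    m s ^+ 2 / g t ^+ 2 * ((a0 * C - q * b0 * S) ^+ 2 +
      3 * (a0 * S / q + b0 * C) ^+ 2) by field; apply/andP.
  have -> : (a0 * C - q * b0 * S) ^+ 2 + 3 * (a0 * S / q + b0 * C) ^+ 2 =
    g t * (C ^+ 2 + S ^+ 2).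
    by rewrite gt /rnorm -q2; field.
  by rewrite CS m2; field.
- have -> : rcube1 (m s / g t * (a0 * C - q * b0 * S))
      (m s / g t * (a0 * S / q + b0 * C)) =
    (m s / g t) ^+ 3 * (f1 t * (C ^+ 3 - 3 * C * S ^+ 2)
      - q * f2 t * (3 * C ^+ 2 * S - S ^+ 3)).
    by rewrite ft1 ft2 !c1 !c2; field; apply/andP.
  rewrite h1 h2.
  have -> : (m s / g t) ^+ 3 * (f1 t * (alpha s / m s ^+ 3) - q * f2 t * (beta s / m s ^+ 3))
     = (f1 t * alpha s - q * f2 t * beta s) / g t ^+ 3 by field; apply/andP.
  have -> : f1 t * alpha s - q * f2 t * beta s = f1 s * g t ^+ 3.
    by rewrite g3 /alpha /beta -/q -q2; ring.
  by field.
- have -> : rcube2 (m s / g t * (a0 * C - q * b0 * S))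
      (m s / g t * (a0 * S / q + b0 * C)) =
    (m s / g t) ^+ 3 * (f2 t * (C ^+ 3 - 3 * C * S ^+ 2)
      + f1 t * (3 * C ^+ 2 * S - S ^+ 3) / q).
    by rewrite ft1 ft2 !c1 !c2; field; apply/andP.
  rewrite h1 h2.
  have -> : (m s / g t) ^+ 3 * (f2 t * (alpha s / m s ^+ 3) + f1 t * (beta s / m s ^+ 3) / q)
     = (f2 t * alpha s + f1 t * beta s / q) / g t ^+ 3 by field; repeat (apply/andP; split).
  have -> : f2 t * alpha s + f1 t * beta s / q = f2 s * g t ^+ 3.
    by rewrite g3 /alpha /beta -/q; field.
  by field.
Qed.

End Differentiable.

(** * Differentiable lifts for the tetrahedral group *)

Section TetLift.
Variable R : realType.
Implicit Types I : set R.

Definition near_open I := forall t, I t -> \forall s \near t, I s.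

Lemma liftableI (V : normedModType R) (K : finType) (p : K -> V -> R) (v0 u : R -> V) (t : R) :
  (\forall s \near t, (forall k, p k (u s) = p k (v0 s)) /\ exists d, is_derive s 1 u d) ->
  liftable p v0 t.
Proof.
by move=> H; exists u; apply: filterS H => s [h1 h2]; split.
Qed.

(** Away from zero a lift is given by a complex cube root; at zero the norm is
    [O((s - t)^2)], which bounds the other invariants. *)
Lemma rot_lift (v0 : R -> R * R) I : near_open I ->
  regular 2 I (fun t => rnorm (v0 t).1 (v0 t).2) ->
  regular 3 I (fun t => rcube1 (v0 t).1 (v0 t).2) ->
  regular 3 I (fun t => rcube2 (v0 t).1 (v0 t).2) ->
  exists u, forall t, I t -> good (@rot_inv R) v0 u t.
Proof.
set g := fun t => rnorm _ _; set f1 := fun t => rcube1 _ _; set f2 := fun t => rcube2 _ _.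
move=> oI rg r1 r2.
have dg t (It : I t) := regular_der (ltn0Sn _) rg It.
have d1 t (It : I t) := regular_der (ltn0Sn _) r1 It.
have d2 t (It : I t) := regular_der (ltn0Sn _) r2 It.
have fg s : f1 s ^+ 2 + 3 * f2 s ^+ 2 = g s ^+ 3 by exact: rcube_norm.
have g_ge0 s : 0 <= g s by rewrite /g /rnorm; have := sqr_ge0 (v0 s).1; have := sqr_ge0 (v0 s).2; lra.
apply: (differentiable_lift (@rot_orbit_data R)) => // t It.
- move=> vt.
  have gt0 : 0 < g t.
    rewrite lt_neqAle g_ge0 andbT eq_sym; apply: contra vt => /eqP.
    by move=> /(sum_sqr_eq0 (ltr0Sn _ 2))[h1 h2]; rewrite [v0 t]surjective_pairing h1 h2.
  pose alpha s := f1 s * f1 t + 3 * f2 s * f2 t.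
  have at0 : 0 < alpha t.
    have -> : alpha t = g t ^+ 3 by rewrite -fg /alpha; ring.
    by rewrite exprn_gt0.
  have da s : I s -> dif alpha s.
    move=> Is; apply: difD; apply: difM; try exact: difC; first exact: d1.
    by apply: difM; [exact: difC|exact: d2].
  have cr := cube_root (erefl (g t)) (erefl (f1 t)) (erefl (f2 t)) gt0.
  pose th s := atan (Num.sqrt 3 * (f2 s * f1 t - f1 s * f2 t) / alpha s) / 3.
  pose mg s := Num.sqrt (g s * g t) / g t.
  pose u s := (mg s * ((v0 t).1 * cos (th s) - Num.sqrt 3 * (v0 t).2 * sin (th s)),
     mg s * ((v0 t).1 * sin (th s) / Num.sqrt 3 + (v0 t).2 * cos (th s))).
  apply: (@liftableI _ _ _ _ u).
  have := nearI (oI t It) (nearI (cts_gt0 (dif_cts (dg t It)) gt0)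
     (cts_gt0 (dif_cts (da t It)) at0)).
  apply: filterS => s [Is [gs as0]]; have [e1 e2 e3] := cr s (fg s) gs as0.
  split; first by move=> [[|[|[|//]]] ?]; rewrite /rot_inv /=; [exact: e1|exact: e2|exact: e3].
  have dmg : dif mg s.
    apply: difM; last exact: difC.
    apply: dif_sqrt; first by rewrite mulr_gt0.
    by apply: difM; [exact: dg|exact: difC].
  have dth : dif th s.
    apply: difM; last exact: difC; apply: dif_comp; first exact: dif_atan.
    apply: difM; last by apply: difV; [rewrite gt_eqF|exact: da].
    apply: difM; first exact: difC.
    apply: difB; apply: difM; try exact: difC; [exact: d2|exact: d1].
  have dco := dif_comp (dif_cos _) dth; have dsi := dif_comp (dif_sin _) dth.
  apply: dif_pair; apply: (difM dmg).
    apply: difB; apply: difM => //; exact: difC.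
  apply: difD; last by apply: difM => //; exact: difC.
  by apply: difM; [apply: difM => //; exact: difC|exact: difC].
- move=> vt.
  have gt : g t = 0 by rewrite /g /rnorm vt /=; ring.
  have [C C0 HC] := regular_zero_sqr rg (oI t It) (filterE _ g_ge0) gt.
  have HC' : \forall s \near t, 0 <= g s <= C * (s - t) ^+ 2.
    by apply: filterS HC => s; rewrite g_ge0.
  have big f (d : nat) : regular d I f -> (forall s, f s ^+ 2 <= 1 * g s ^+ d) ->
      exists b, homog_limit f t d b.
    move=> rf Hf; apply: regular_homog_limit rf (oI t It) _.
    exact: (sqr_bigO ler01 C0 (filterE _ Hf) HC').
  move=> [[|[|[|//]]] ?].
  + by apply: big rg _ => s; rewrite mul1r.
  + apply: big r1 _ => s; rewrite mul1r -fg; have := sqr_ge0 (f2 s); lra.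
  + apply: big r2 _ => s; rewrite mul1r -fg.
    have := sqr_ge0 (f1 s); have := sqr_ge0 (f2 s); lra.
Qed.

Definition sq_dif (v : R -> R * R * R) I := forall t, I t ->
  [/\ dif (fun s => (v s).1.1 ^+ 2) t, dif (fun s => (v s).1.2 ^+ 2) t,
      dif (fun s => (v s).2 ^+ 2) t & dif (fun s => inv3 (v s)) t].

Lemma same_squares (u v : R * R * R) : u.1.1 ^+ 2 = v.1.1 ^+ 2 ->
  u.1.2 ^+ 2 = v.1.2 ^+ 2 -> u.2 ^+ 2 = v.2 ^+ 2 -> inv3 u = inv3 v ->
  forall k, tet_inv k u = tet_inv k v.
Proof.
move=> h1 h2 h3 h4; apply/tet_invP; split=> //;
by rewrite /inv2 /inv4 /inv6a /inv6b /wa /wb h1 h2 h3.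
Qed.

(** The square roots of two squared coordinates that do not vanish are
    differentiable, and the cubic invariant determines the third coordinate. *)
Lemma liftable_two (v : R -> R * R * R) I t : near_open I -> sq_dif v I -> I t ->
  (v t).1.2 != 0 -> (v t).2 != 0 -> liftable (@tet_inv R) v t.
Proof.
move=> oI dv It y0 z0.
have [_ dY dZ _] := dv t It.
pose Y s := (v s).1.2 ^+ 2; pose Z s := (v s).2 ^+ 2.
have Yt : 0 < Y t by rewrite exprn_even_gt0.
have Zt : 0 < Z t by rewrite exprn_even_gt0.
pose u s := (inv3 (v s) / (Num.sqrt (Y s) * Num.sqrt (Z s)), Num.sqrt (Y s), Num.sqrt (Z s)).
apply: (@liftableI _ _ _ _ u).
have := nearI (oI t It) (nearI (cts_gt0 (dif_cts dY) Yt) (cts_gt0 (dif_cts dZ) Zt)).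
apply: filterS => s [Is [Ys Zs]]; have [_ dYs dZs dTs] := dv s Is.
have sY : Num.sqrt (Y s) ^+ 2 = Y s by rewrite sqr_sqrtr // ltW.
have sZ : Num.sqrt (Z s) ^+ 2 = Z s by rewrite sqr_sqrtr // ltW.
have nY : Num.sqrt (Y s) != 0 by rewrite gt_eqF // sqrtr_gt0.
have nZ : Num.sqrt (Z s) != 0 by rewrite gt_eqF // sqrtr_gt0.
split.
  apply: same_squares; rewrite ?sY ?sZ //.
    have D : (Num.sqrt (Y s) * Num.sqrt (Z s)) ^+ 2 = Y s * Z s by rewrite exprMn sY sZ.
    rewrite [LHS]expr_div_n D /inv3 !exprMn -/(Y s) -/(Z s).
    by field; rewrite !gt_eqF.
  move: nY nZ; rewrite {1}/inv3 /u /=.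
  set y := Num.sqrt _; set z := Num.sqrt (Z s); set c := inv3 _ => nY nZ.
  by field; apply/andP.
have dsY := dif_sqrt (f := Y) Ys dYs; have dsZ := dif_sqrt (f := Z) Zs dZs.
have [d dd] : exists d, is_derive s 1
    (fun s => (inv3 (v s) / (Num.sqrt (Y s) * Num.sqrt (Z s)), Num.sqrt (Y s))) d.
  apply: (dif_pair _ dsY); apply: (difM dTs); apply: difV; last exact: difM dsY dsZ.
  by rewrite mulf_neq0.
by have [e de] := dsZ; exists (d, e); exact: der_pair dd de.
Qed.

Lemma liftable_cyc (v : R -> R * R * R) t :
  liftable (@tet_inv R) (fun s => cyc (v s)) t -> liftable (@tet_inv R) v t.
Proof.
move=> [u Hu]; exists u; apply: filterS Hu => s [h1 h2]; split=> // k.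
by rewrite -h1 cyc_inv.
Qed.

Lemma sq_dif_cyc (v : R -> R * R * R) I : sq_dif v I -> sq_dif (fun s => cyc (v s)) I.
Proof.
move=> dv t /dv[h1 h2 h3 h4]; split=> //.
have -> : (fun s => inv3 (cyc (v s))) = (fun s => inv3 (v s)); last by [].
by apply/funext => s; rewrite /inv3 /cyc /=; ring.
Qed.

(** The second elementary symmetric function of the squared coordinates. *)
Definition inv4e (v : R * R * R) : R :=
  v.1.1 ^+ 2 * v.1.2 ^+ 2 + v.1.2 ^+ 2 * v.2 ^+ 2 + v.2 ^+ 2 * v.1.1 ^+ 2.

Lemma inv4eE (v : R * R * R) : inv4e v = (inv2 v ^+ 2 - inv4 v) / 3.
Proof. by rewrite /inv4e /inv2 /inv4 /rnorm /wa /wb; field. Qed.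

Lemma inv6bE (v : R * R * R) : inv6b v = 3 / 2 * (v.1.1 ^+ 2 - v.1.2 ^+ 2) *
  (v.1.2 ^+ 2 - v.2 ^+ 2) * (v.1.1 ^+ 2 - v.2 ^+ 2).
Proof. by rewrite /inv6b /rcube2 /wa /wb; field. Qed.

Lemma inv4e_ge0 (v : R * R * R) : 0 <= inv4e v.
Proof. by rewrite /inv4e !addr_ge0 // mulr_ge0 // sqr_ge0. Qed.

Lemma rnorm_ge0 (a b : R) : 0 <= rnorm a b.
Proof. by rewrite /rnorm; have := sqr_ge0 a; have := sqr_ge0 b; lra. Qed.

Lemma inv2_ge0 (v : R * R * R) : 0 <= inv2 v.
Proof.
rewrite /inv2; have := sqr_ge0 v.1.1; have := sqr_ge0 v.1.2; have := sqr_ge0 v.2; lra.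
Qed.

Lemma inv3_le (v : R * R * R) : inv3 v ^+ 2 <= inv2 v ^+ 3.
Proof.
rewrite /inv3 /inv2 !exprMn.
have := sqr_ge0 v.1.1; have := sqr_ge0 v.1.2; have := sqr_ge0 v.2.
set X := v.1.1 ^+ 2; set Y := v.1.2 ^+ 2; set Z := v.2 ^+ 2 => Z0 Y0 X0.
have -> : (X + Y + Z) ^+ 3 = (X + Y + Z) * (X + Y + Z) * (X + Y + Z) by ring.
apply: ler_pM; [exact: mulr_ge0|exact: Z0| |lra].
by apply: ler_pM => //; lra.
Qed.

Lemma inv4_le (v : R * R * R) : inv4 v <= inv2 v ^+ 2.
Proof. by rewrite -subr_ge0; have := inv4e_ge0 v; rewrite inv4eE; lra. Qed.

Lemma inv6_le (v : R * R * R) : inv6a v ^+ 2 + 3 * inv6b v ^+ 2 <= inv2 v ^+ 6.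
Proof.
rewrite /inv6a /inv6b rcube_norm -/(inv4 v) (exprM _ 2 3).
by rewrite lerXn2r ?nnegrE ?inv4_le ?exprn_even_ge0 //; exact: rnorm_ge0.
Qed.

(** On an axis of order two the slice representation is the sign change of the
    plane.  Its invariants are quotients of the invariants [inv4e], [inv6b] and
    [inv3] by functions that do not vanish there, up to a remainder of higher
    order. *)
Lemma sign_homog_limits (v : R -> R * R * R) I t : near_open I -> sq_dif v I -> I t ->
  regular 2 I (fun s => inv3 (v s)) -> regular 2 I (fun s => inv4e (v s)) ->
  regular 2 I (fun s => inv6b (v s)) ->
  (v t).1.1 = 0 -> (v t).1.2 = 0 -> (v t).2 != 0 ->
  [/\ exists b, homog_limit (fun s => (v s).1.1 ^+ 2 + (v s).1.2 ^+ 2) t 2 b,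
      exists b, homog_limit (fun s => (v s).1.1 ^+ 2 - (v s).1.2 ^+ 2) t 2 b &
      exists b, homog_limit (fun s => inv3 (v s)) t 2 b].
Proof.
move=> oI dv It r3 r4 r6 x0 y0 z0.
have [dX dY dZ dT] := dv t It.
pose X s := (v s).1.1 ^+ 2; pose Y s := (v s).1.2 ^+ 2; pose Z s := (v s).2 ^+ 2.
pose E s := inv4e (v s).
have X_ge0 s : 0 <= X s by exact: sqr_ge0.
have Y_ge0 s : 0 <= Y s by exact: sqr_ge0.
have Xt : X t = 0 by rewrite /X x0 expr0n.
have Yt : Y t = 0 by rewrite /Y y0 expr0n.
have Tt : inv3 (v t) = 0 by rewrite /inv3 x0 !mul0r.
have Zt : 0 < Z t by rewrite exprn_even_gt0.
have Et : E t = 0 by rewrite /E /inv4e x0 y0; ring.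
have EXY s : E s = Z s * (X s + Y s) + X s * Y s by rewrite /E /inv4e -/(X s) -/(Y s) -/(Z s); ring.
have TXY s : inv3 (v s) ^+ 2 = X s * Y s * Z s by rewrite /inv3 !exprMn.
have E_ge0 s : 0 <= E s by rewrite /E /inv4e !addr_ge0 // mulr_ge0 // sqr_ge0.
have [C C0 HC] := regular_zero_sqr r4 (oI t It) (filterE _ E_ge0) Et.
have dX1 : dif (fun s => 1 - X s) t by apply: difB => //; exact: difC.
have dY1 : dif (fun s => 1 - Y s) t by apply: difB => //; exact: difC.
have dZ1 : dif (fun s => Z s - Z t / 2) t by apply: difB => //; exact: difC.
have dZ2 : dif (fun s => Z t + 1 - Z s) t by apply: difB => //; exact: difC.
have nZ : \forall s \near t, Z t / 2 < Z s.
  have : 0 < Z t - Z t / 2 by lra.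
  by move=> /(cts_gt0 (dif_cts dZ1)); apply: filterS => s; rewrite subr_gt0.
have nZ2 : \forall s \near t, Z s < Z t + 1.
  have : 0 < Z t + 1 - Z t by lra.
  by move=> /(cts_gt0 (dif_cts dZ2)); apply: filterS => s; rewrite subr_gt0.
have nX : \forall s \near t, X s < 1.
  have : 0 < 1 - X t by rewrite Xt; lra.
  by move=> /(cts_gt0 (dif_cts dX1)); apply: filterS => s; rewrite subr_gt0.
have nY : \forall s \near t, Y s < 1.
  have : 0 < 1 - Y t by rewrite Yt; lra.
  by move=> /(cts_gt0 (dif_cts dY1)); apply: filterS => s; rewrite subr_gt0.
pose C1 := 2 * C / Z t.
have C10 : 0 <= C1 by apply: divr_ge0; [exact: mulr_ge0|exact: ltW].
have nXY : \forall s \near t, 0 <= X s + Y s <= C1 * (s - t) ^+ 2.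
  have := nearI HC nZ; apply: filterS => s [h1 h2].
  have := X_ge0 s; have := Y_ge0 s => p2 p1.
  rewrite addr_ge0 //= /C1 mulrAC ler_pdivlMr //.
  have : 0 <= X s * Y s by rewrite mulr_ge0.
  have : 0 <= (X s + Y s) * (Z s - Z t / 2) by rewrite mulr_ge0 //; lra.
  move: h1; rewrite -/(E s) EXY; nra.
have big f (c : R) : regular 2 I f -> 0 <= c ->
   (\forall s \near t, f s ^+ 2 <= c * (X s + Y s) ^+ 2) -> exists b, homog_limit f t 2 b.
  move=> rf c0 Hf; apply: regular_homog_limit rf (oI t It) _.
  exact: sqr_bigO c0 C10 Hf nXY.
have [bT HT] : exists b, homog_limit (fun s => inv3 (v s)) t 2 b.
  apply: (big _ (Z t + 1)) => //; first lra.
  apply: filterS nZ2 => s Zs; rewrite TXY.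
  have := X_ge0 s; have := Y_ge0 s => p2 p1.
  have : X s * Y s <= (X s + Y s) ^+ 2 by nra.
  have : 0 <= X s * Y s by rewrite mulr_ge0.
  have : 0 <= Z s by rewrite sqr_ge0.
  nra.
have [bE HE] : exists b, homog_limit E t 2 b.
  apply: regular_homog_limit r4 (oI t It) (_ : \forall s \near t, `|E s| <= C * `|s - t| ^+ 2).
  by apply: filterS HC => s; rewrite ger0_norm // real_normK ?num_real.
have [b6 H6] : exists b, homog_limit (fun s => inv6b (v s)) t 2 b.
  pose m := (Z t + 2) ^+ 4 * (9 / 4).
  have m0 : 0 <= m by rewrite mulr_ge0 // exprn_ge0; lra.
  apply: (big _ m) => //.
  have := nearI nX (nearI nY nZ2); apply: filterS => s [h1 [h2 h3]].
  have -> : inv6b (v s) ^+ 2 =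
     ((Y s - Z s) ^+ 2 * (X s - Z s) ^+ 2) * (9 / 4) * (X s - Y s) ^+ 2.
    by rewrite inv6bE -/(X s) -/(Y s) -/(Z s); field.
  have p1 := X_ge0 s; have p2 := Y_ge0 s; have p3 : 0 <= Z s by rewrite sqr_ge0.
  have q a : 0 <= a < 1 -> (a - Z s) ^+ 2 <= (Z t + 2) ^+ 2 by nra.
  have A0 : 0 <= (Y s - Z s) ^+ 2 * (X s - Z s) ^+ 2.
    by apply: mulr_ge0; exact: sqr_ge0.
  have A : (Y s - Z s) ^+ 2 * (X s - Z s) ^+ 2 <= (Z t + 2) ^+ 4.
    have -> : (Z t + 2) ^+ 4 = (Z t + 2) ^+ 2 * (Z t + 2) ^+ 2 by ring.
    by apply: ler_pM; [exact: sqr_ge0|exact: sqr_ge0|exact/q/andP|exact/q/andP].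
  apply: ler_pM; [by apply: mulr_ge0|exact: sqr_ge0| |by nra].
  by rewrite /m; lra.
have cX := dif_cts dX; have cY := dif_cts dY; have cZ := dif_cts dZ.
have dIZ : dif (fun s => (Z s)^-1) t by apply: difV => //; rewrite gt_eqF.
split; last by exists bT.
- exists (bE * (Z t)^-1 - bT * (inv3 (v t) / Z t / Z t)).
  apply: (homog_limit_ext _ (homog_limitB (homog_limitM HE (dif_cts dIZ))
     (homog_limitM HT (dif_cts (difM (difM dT dIZ) dIZ))))).
  apply: filterS nZ => s Zs; have Zs0 : Z s != 0 by rewrite gt_eqF; lra.
  have -> : inv3 (v s) * (inv3 (v s) / Z s / Z s) = inv3 (v s) ^+ 2 / (Z s * Z s) by field.
  by rewrite TXY EXY -/(X s) -/(Y s); field.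
- pose phi s := (3 / 2 * (Y s - Z s) * (X s - Z s))^-1.
  have dphi : dif phi t.
    apply: difV; first by rewrite Xt Yt; rewrite !mulf_neq0 ?sub0r ?oppr_eq0 ?gt_eqF //.
    by apply: difM; [apply: difM; [exact: difC|exact: difB]|exact: difB].
  exists (b6 * phi t); apply: (homog_limit_ext _ (homog_limitM H6 (dif_cts dphi))).
  have nYZ : \forall s \near t, 0 < Z s - Y s.
    by apply: cts_gt0; [apply: dif_cts; exact: difB|rewrite Yt subr0].
  have nXZ : \forall s \near t, 0 < Z s - X s.
    by apply: cts_gt0; [apply: dif_cts; exact: difB|rewrite Xt subr0].
  have := nearI nYZ nXZ; apply: filterS => s [h1 h2].
  rewrite inv6bE /phi -/(X s) -/(Y s) -/(Z s); field.
  by apply/andP; split; apply/eqP; lra.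
Qed.

(** The lift is [(u, |z|)], where [u] lifts the orbits of [(x, y)] under the sign
    change of the plane. *)
Lemma liftable_one (v : R -> R * R * R) I t : near_open I -> sq_dif v I -> I t ->
  regular 2 I (fun s => inv3 (v s)) -> regular 2 I (fun s => inv4e (v s)) ->
  regular 2 I (fun s => inv6b (v s)) ->
  (v t).1.1 = 0 -> (v t).1.2 = 0 -> (v t).2 != 0 -> liftable (@tet_inv R) v t.
Proof.
move=> oI dv It r3 r4 r6 x0 y0 z0.
pose X s := (v s).1.1 ^+ 2; pose Y s := (v s).1.2 ^+ 2; pose Z s := (v s).2 ^+ 2.
have Zt : 0 < Z t by rewrite exprn_even_gt0.
pose I' := [set s | I s /\ 0 < Z s].
have oI' : near_open I'.
  move=> s [Is Zs]; have [_ _ dZ _] := dv s Is.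
  by have := nearI (oI s Is) (cts_gt0 (dif_cts dZ) Zs); apply: filterS.
pose z s := Num.sqrt (Z s).
have zs s : I' s -> [/\ 0 < z s, z s ^+ 2 = Z s & dif z s].
  move=> [Is Zs]; rewrite sqrtr_gt0 sqr_sqrtr ?ltW //; split=> //.
  by have [_ _ dZ _] := dv s Is; exact: dif_sqrt.
pose p s := inv3 (v s) / z s.
have dp s : I' s -> dif p s.
  move=> Is; have [z_gt0 _ dz] := zs s Is; have [_ _ _ dT] := dv s (proj1 Is).
  by apply: difM => //; apply: difV => //; rewrite gt_eqF.
have p2 s : I' s -> p s ^+ 2 = X s * Y s.
  move=> Is; have [z_gt0 zZ _] := zs s Is.
  rewrite /p expr_div_n zZ /inv3 !exprMn -/(X s) -/(Y s) -/(Z s).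
  by field; rewrite gt_eqF //; case: Is.
(* The factor makes the product of the two coordinates equal to [x y z / |z|],
   which is differentiable. *)
pose v2 s : R * R := (Num.sg (v s).2 * (v s).1.1, (v s).1.2).
have v2E s : I' s -> [/\ (v2 s).1 ^+ 2 = X s, (v2 s).2 ^+ 2 = Y s & (v2 s).1 * (v2 s).2 = p s].
  move=> Is; have [z_gt0 zZ _] := zs s Is; have zn : (v s).2 != 0.
    by case: Is => _; rewrite /Z exprn_even_gt0.
  rewrite /v2 /= exprMn sqr_sg zn mul1r; split=> //.
  rewrite /p; apply: (canRL (mulfK _)); first by rewrite gt_eqF.
  have zE : (v s).2 = Num.sg (v s).2 * z s by rewrite /z sqrtr_sqr -numEsg.
  by rewrite /inv3 [X in _ = _ * X]zE; ring.
have [|||u Hu] := @differentiable_lift _ _ _ _ _ _ _ (@sign_orbit_data R) v2 I'.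
- move=> s Is v2s; have [e1 e2 e3] := v2E s Is.
  have [dX dY _ _] := dv s (proj1 Is).
  have [Xs|Xs] := eqVneq (X s) 0.
    have Ys : 0 < Y s.
      rewrite -e2 exprn_even_gt0 //=; apply: contra v2s => /eqP v22.
      have : (v2 s).1 ^+ 2 == 0 by rewrite e1 Xs.
      rewrite sqrf_eq0 => /eqP v21; rewrite [v2 s]surjective_pairing v21.
      by rewrite (_ : (v2 s).2 = 0).
    pose w r := (p r / Num.sqrt (Y r), Num.sqrt (Y r)).
    apply: (@liftableI _ _ _ _ w).
    have := nearI (oI' s Is) (cts_gt0 (dif_cts dY) Ys); apply: filterS => r [Ir Yr].
    have [f1 f2 f3] := v2E r Ir; have [_ dYr _ _] := dv r (proj1 Ir).
    have sY : Num.sqrt (Y r) ^+ 2 = Y r by rewrite sqr_sqrtr // ltW.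
    have nY : Num.sqrt (Y r) != 0 by rewrite gt_eqF // sqrtr_gt0.
    have pX : (p r / Num.sqrt (Y r)) ^+ 2 = X r.
      by rewrite expr_div_n sY p2 //; field; rewrite gt_eqF.
    split; last by apply: dif_pair; [apply: (difM (dp r Ir)); apply: difV => //|];
      exact: dif_sqrt.
    by move=> [[|[|[|//]]] ?]; rewrite /sign_inv /= ?pX ?sY ?f1 ?f2 ?f3 // divfK.
  have {}Xs : 0 < X s by rewrite lt_neqAle eq_sym Xs sqr_ge0.
  pose w r := (Num.sqrt (X r), p r / Num.sqrt (X r)).
  apply: (@liftableI _ _ _ _ w).
  have := nearI (oI' s Is) (cts_gt0 (dif_cts dX) Xs); apply: filterS => r [Ir Xr].
  have [f1 f2 f3] := v2E r Ir; have [dXr _ _ _] := dv r (proj1 Ir).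
  have sX : Num.sqrt (X r) ^+ 2 = X r by rewrite sqr_sqrtr // ltW.
  have nX : Num.sqrt (X r) != 0 by rewrite gt_eqF // sqrtr_gt0.
  have pY : (p r / Num.sqrt (X r)) ^+ 2 = Y r.
    by rewrite expr_div_n sX p2 //; field; rewrite gt_eqF.
  split; last by apply: dif_pair; [|apply: (difM (dp r Ir)); apply: difV => //];
    exact: dif_sqrt.
  by move=> [[|[|[|//]]] ?]; rewrite /sign_inv /= ?pY ?sX ?f1 ?f2 ?f3 // mulrC divfK.
- move=> s Is v2s; have [e1 e2 e3] := v2E s Is; have [z_gt0 zZ dz] := zs s Is.
  have zn : (v s).2 != 0 by case: Is => _; rewrite /Z exprn_even_gt0.
  have x0s : (v s).1.1 = 0.
    by apply/eqP; rewrite -sqrf_eq0 -/(X s) -e1 v2s expr0n.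
  have y0s : (v s).1.2 = 0.
    by apply/eqP; rewrite -sqrf_eq0 -/(Y s) -e2 v2s expr0n.
  have [[b1 H1] [b2 H2] [b3 H3]] := sign_homog_limits oI dv (proj1 Is) r3 r4 r6 x0s y0s zn.
  move=> [[|[|[|//]]] ?].
  + exists b1; apply: homog_limit_ext H1; apply: filterS (oI' s Is) => r Ir.
    by have [f1 f2 f3] := v2E r Ir; rewrite /sign_inv /= f1 f2.
  + exists b2; apply: homog_limit_ext H2; apply: filterS (oI' s Is) => r Ir.
    by have [f1 f2 f3] := v2E r Ir; rewrite /sign_inv /= f1 f2.
  + have dIz : dif (fun r => (z r)^-1) s by apply: difV => //; rewrite gt_eqF.
    exists (b3 * (z s)^-1); apply: homog_limit_ext (homog_limitM H3 (dif_cts dIz)).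
    apply: filterS (oI' s Is) => r Ir.
    by have [f1 f2 f3] := v2E r Ir; rewrite /sign_inv /= f3.
- exact: oI'.
pose w s := (u s, z s).
apply: (@liftableI _ _ _ _ w).
apply: filterS (oI' t (conj It Zt)) => s Is.
have [Hs [d du]] := Hu s Is; have [e1 e2 e3] := v2E s Is; have [z_gt0 zZ [e de]] := zs s Is.
split; last by exists (d, e); exact: der_pair.
have := Hs ord0; have := Hs (inord 1); have := Hs (inord 2).
rewrite /sign_inv /= !inordK //= e1 e2 e3 => h3 h2 h1.
have a1 : (u s).1 ^+ 2 = X s by lra.
have a2 : (u s).2 ^+ 2 = Y s by lra.
apply: same_squares => //; rewrite /inv3 /= -h3 /p divfK ?gt_eqF //.
Qed.

(** The squares of the coordinates are recovered from a differentiable lift of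
    the invariants of [w] for the group of order three. *)
Lemma sq_dif_base (v0 : R -> R * R * R) I : near_open I ->
  regular 1 I (fun t => inv2 (v0 t)) -> regular 1 I (fun t => inv3 (v0 t)) ->
  regular 2 I (fun t => inv4 (v0 t)) -> regular 3 I (fun t => inv6a (v0 t)) ->
  regular 3 I (fun t => inv6b (v0 t)) ->
  exists v, sq_dif v I /\ forall t, I t -> forall k, tet_inv k (v t) = tet_inv k (v0 t).
Proof.
move=> oI r2 r3 r4 r6a r6b.
have [u Hu] := @rot_lift (fun t => (wa (v0 t), wb (v0 t))) I oI r4 r6a r6b.
have ex t : exists v, I t -> [/\ forall k, tet_inv k v = tet_inv k (v0 t),
    wa v = (u t).1 & wb v = (u t).2].
  have [It|nIt] := pselect (I t); last by exists (v0 t).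
  have [Ht _] := Hu t It; have := Ht (inord 1); have := Ht (inord 2).
  rewrite /rot_inv /= !inordK //= => h6b h6a.
  have [k] := rcube_eq h6a h6b.
  have ic m : forall k, tet_inv k (iter m (@cyc R) (v0 t)) = tet_inv k (v0 t).
    by move=> k'; elim: m => //= m IH; rewrite cyc_inv.
  rewrite [u t]surjective_pairing.
  case: k => -[|[|[|//]]] ?; rewrite /rot_act /= => -[-> ->].
  - by exists (v0 t).
  - exists (iter 2 (@cyc R) (v0 t)) => _; split; first exact: ic.
      by rewrite /wa /wb /cyc /=; field.
    by rewrite /wa /wb /cyc /=; field.
  - exists (iter 1 (@cyc R) (v0 t)) => _; split; first exact: ic.
      by rewrite /wa /wb /cyc /=; field.
    by rewrite /wa /wb /cyc /=; field.
have [v Hv] := choice ex; exists v; split; last by move=> t /Hv[].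
move=> t It; have [_ [d du]] := Hu t It.
have [d1 d2] : dif (fun s => (u s).1) t /\ dif (fun s => (u s).2) t.
  by split; [exists d.1; exact: der_fst|exists d.2; exact: der_snd].
have dH := regular_der (ltn0Sn _) r2 It; have dT := regular_der (ltn0Sn _) r3 It.
have ext f g : (forall s, I s -> f s = g s) -> dif f t -> dif g t.
  move=> fg [e de]; exists e; apply: is_derive_ext de => //.
  by apply: filterS (oI t It) => s; exact: fg.
have eqs s : I s -> [/\ inv2 (v s) = inv2 (v0 s), inv3 (v s) = inv3 (v0 s),
    wa (v s) = (u s).1 & wb (v s) = (u s).2].
  by move=> /Hv[/tet_invP[-> -> _ _ _] -> ->].
split.
- apply: (ext (fun s => (inv2 (v0 s) + 2 * (u s).1) / 3)).
    by move=> s /eqs[h1 h2 h3 h4]; have [-> _ _] := squares_w (v s); rewrite h1 h3.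
  by apply: difM; [apply: difD => //; apply: difM => //|]; exact: difC.
- apply: (ext (fun s => (inv2 (v0 s) - (u s).1) / 3 + (u s).2)).
    by move=> s /eqs[h1 h2 h3 h4]; have [_ -> _] := squares_w (v s); rewrite h1 h3 h4.
  apply: difD => //; apply: difM; [exact: difB|exact: difC].
- apply: (ext (fun s => (inv2 (v0 s) - (u s).1) / 3 - (u s).2)).
    by move=> s /eqs[h1 h2 h3 h4]; have [_ _ ->] := squares_w (v s); rewrite h1 h3 h4.
  apply: difB => //; apply: difM; [exact: difB|exact: difC].
- by apply: (ext (fun s => inv3 (v0 s))) => // s /eqs[].
Qed.

Lemma near_open_regular_ext k I f g : near_open I -> (forall t, I t -> f t = g t) ->
  regular k I f -> regular k I g.
Proof.
move=> oI; elim: k f g => [|k IH] f g fg.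
  move=> /regular0 cf; apply/regular0 => t It.
  have cfx : f x @[x --> t] --> f t := cf t It.
  suff : g x @[x --> t] --> f t by rewrite (fg t It).
  apply: cvg_trans cfx; apply: near_eq_cvg.
  by apply: filterS (oI t It) => s Is; rewrite fg.
move=> /regularS[f1 df rf]; apply/regularS; exists f1 => // t It.
by apply: is_derive_ext (df t It) => //; apply: filterS (oI t It).
Qed.

(** The given curve is first replaced by one with differentiable squared
    coordinates.  At a nonzero value, the coordinates can be permuted so that
    either the last two are nonzero or the first two vanish; at zero, the
    invariant of degree two bounds the others. *)
Theorem tet_lift (v0 : R -> R * R * R) I : near_open I ->
  regular 2 I (fun t => inv2 (v0 t)) -> regular 3 I (fun t => inv3 (v0 t)) ->
  regular 4 I (fun t => inv4 (v0 t)) -> regular 6 I (fun t => inv6a (v0 t)) ->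
  regular 6 I (fun t => inv6b (v0 t)) ->
  exists u, forall t, I t -> good (@tet_inv R) v0 u t.
Proof.
move=> oI r2 r3 r4 r6a r6b.
have [v [dv Hv]] := sq_dif_base oI (regularW (isT : 1 <= 2)%N r2)
  (regularW (isT : 1 <= 3)%N r3) (regularW (isT : 2 <= 4)%N r4)
  (regularW (isT : 3 <= 6)%N r6a) (regularW (isT : 3 <= 6)%N r6b).
have Hv' t : I t -> [/\ inv2 (v t) = inv2 (v0 t), inv3 (v t) = inv3 (v0 t),
    inv4 (v t) = inv4 (v0 t), inv6a (v t) = inv6a (v0 t) & inv6b (v t) = inv6b (v0 t)].
  by move=> /Hv /tet_invP.
have rr2 : regular 2 I (fun t => inv2 (v t)).
  by apply: near_open_regular_ext oI _ r2 => t /Hv'[].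
have rr3 : regular 3 I (fun t => inv3 (v t)).
  by apply: near_open_regular_ext oI _ r3 => t /Hv'[].
have rr4 : regular 4 I (fun t => inv4 (v t)).
  by apply: near_open_regular_ext oI _ r4 => t /Hv'[].
have rr6a : regular 6 I (fun t => inv6a (v t)).
  by apply: near_open_regular_ext oI _ r6a => t /Hv'[].
have rr6b : regular 6 I (fun t => inv6b (v t)).
  by apply: near_open_regular_ext oI _ r6b => t /Hv'[].
suff [u Hu] : exists u, forall t, I t -> good (@tet_inv R) v u t.
  exists u => t It; have [h1 h2] := Hu t It; split=> // k; rewrite -h1; exact/esym/Hv.
have re : regular 2 I (fun t => inv4e (v t)).
  apply: near_open_regular_ext oI (_ : forall t, I t ->
    (inv2 (v t) * inv2 (v t) - inv4 (v t)) * 3^-1 = _) _.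
    by move=> t _; rewrite inv4eE expr2.
  apply: regularM; last exact: regular_cst.
  by apply: regularB; [exact: regularM|exact: regularW rr4].
have r32 := regularW (isT : 2 <= 3)%N rr3; have r62 := regularW (isT : 2 <= 6)%N rr6b.
apply: (differentiable_lift (@tet_orbit_data R)) => // t It.
- have cyc_inv4e (w : R * R * R) : inv4e (cyc w) = inv4e w by rewrite /inv4e /cyc /=; ring.
  have cyc_inv3 (w : R * R * R) : inv3 (cyc w) = inv3 w by rewrite /inv3 /cyc /=; ring.
  have cyc_inv6b (w : R * R * R) : inv6b (cyc w) = inv6b w by rewrite !inv6bE /cyc /=; ring.
  have dv1 := sq_dif_cyc dv; have dv2 := sq_dif_cyc dv1.
  move=> vt.
  have [z0|z0] := eqVneq (v t).2 0; have [y0|y0] := eqVneq (v t).1.2 0;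
    have [x0|x0] := eqVneq (v t).1.1 0.
  + by move: vt; rewrite [v t]surjective_pairing [(v t).1]surjective_pairing x0 y0 z0 eqxx.
  + apply: liftable_cyc; apply: (liftable_one oI dv1) => //.
      by under eq_fun do rewrite cyc_inv3.
      by under eq_fun do rewrite cyc_inv4e.
    by under eq_fun do rewrite cyc_inv6b.
  + apply: liftable_cyc; apply: liftable_cyc; apply: (liftable_one oI dv2) => //.
      by under eq_fun do rewrite !cyc_inv3.
      by under eq_fun do rewrite !cyc_inv4e.
    by under eq_fun do rewrite !cyc_inv6b.
  + apply: liftable_cyc; apply: liftable_cyc; exact: (liftable_two oI dv2).
  + exact: (liftable_one oI dv).
  + apply: liftable_cyc; exact: (liftable_two oI dv1).
  + exact: (liftable_two oI dv).
  + exact: (liftable_two oI dv).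
- move=> vt.
  have H_ge0 s : 0 <= inv2 (v s).
    rewrite /inv2; have := sqr_ge0 (v s).1.1; have := sqr_ge0 (v s).1.2.
    have := sqr_ge0 (v s).2; lra.
  have Ht : inv2 (v t) = 0 by rewrite vt /inv2 /=; ring.
  have [C C0 HC] := regular_zero_sqr rr2 (oI t It) (filterE _ H_ge0) Ht.
  have HC' : \forall s \near t, 0 <= inv2 (v s) <= C * (s - t) ^+ 2.
    by apply: filterS HC => s; rewrite H_ge0.
  have big f (d : nat) : regular d I f -> (forall s, f s ^+ 2 <= 1 * inv2 (v s) ^+ d) ->
      exists b, homog_limit f t d b.
    move=> rf Hf; apply: regular_homog_limit rf (oI t It) _.
    exact: (sqr_bigO ler01 C0 (filterE _ Hf) HC').
  move=> [[|[|[|[|[|//]]]]] ?].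
  + by apply: big rr2 _ => s; rewrite mul1r.
  + apply: big rr3 _ => s; rewrite mul1r; exact: inv3_le.
  + apply: big rr4 _ => s; rewrite mul1r (exprM _ 2 2).
    by rewrite lerXn2r ?nnegrE ?inv4_le ?exprn_even_ge0 //; exact: rnorm_ge0.
  + apply: big rr6a _ => s; rewrite mul1r; have := inv6_le (v s).
    have := sqr_ge0 (inv6b (v s)); lra.
  + apply: big rr6b _ => s; rewrite mul1r; have := inv6_le (v s).
    have := sqr_ge0 (inv6a (v s)); have := sqr_ge0 (inv6b (v s)); lra.
Qed.

End TetLift.

(** * The derivative of a lift is bounded by the invariants *)

Section Bound.
Variable R : realType.

Definition bdd_tower (n : nat) (c A : R) (D : nat -> R -> R) : Prop :=
  tower n [set s | `|s| <= c] D /\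
  forall k, (k <= n)%N -> forall s, `|s| <= c -> `|D k s| <= A.

Lemma bdd_towerW n m c c' A D : (m <= n)%N -> c' <= c ->
  bdd_tower n c A D -> bdd_tower m c' A D.
Proof.
move=> mn cc [dD bD]; split.
  by apply: towerW dD => // s /= /le_trans; apply.
by move=> k km s sc; apply: bD; [exact: leq_trans mn|exact: le_trans cc].
Qed.

Lemma bdd_tower_ge0 n c A D : 0 < c -> bdd_tower n c A D -> 0 <= A.
Proof.
by move=> c0 [_ /(_ 0%N isT 0)]; rewrite normr0 (ltW c0) => /(_ isT); exact: le_trans.
Qed.

Lemma bdd_towerD n c A B D E : bdd_tower n c A D -> bdd_tower n c B E ->
  bdd_tower n c (A + B) (fun i s => D i s + E i s).
Proof.
move=> [dD bD] [dE bE]; split=> [i i_n s sc|k kn s sc].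
  exact: derD (dD i i_n s sc) (dE i i_n s sc).
by apply: le_trans (ler_normD _ _) _; apply: lerD; [exact: bD|exact: bE].
Qed.

Lemma bdd_towerZ n c A D (k : R) : bdd_tower n c A D ->
  bdd_tower n c (`|k| * A) (fun i s => k * D i s).
Proof.
move=> [dD bD]; split=> [i i_n s sc|j jn s sc].
  exact: derZ (dD i i_n s sc) k.
by rewrite normrM ler_wpM2l // bD.
Qed.

(** Glaeser's inequality at the scale [e] on which [D 0] is controlled. *)
Lemma glaeser_scale (c A e k : R) D : 0 < c -> 0 < e <= 1 ->
  bdd_tower 2 c A D -> (forall s, `|s| <= c -> 0 <= D 0%N s) ->
  D 0%N 0 <= k * e ^+ 2 -> `|D 1%N 0| <= (k / c + A * c) * e.
Proof.
move=> c0 /andP[e0 e1] [dD bD] Dpos D0.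
have h0 : 0 < c * e by rewrite mulr_gt0.
have hc : c * e <= c by rewrite ler_piMr // ltW.
have sub s : `|s - 0| <= c * e -> `|s| <= c by rewrite subr0 => /le_trans; apply.
apply: le_trans (glaeser h0 _ _ _ _) _.
- by move=> s /sub; exact: (dD 0%N).
- by move=> s /sub; exact: (dD 1%N).
- by move=> s /sub; exact: (bD 2%N).
- by move=> s /sub; exact: Dpos.
have -> : (k / c + A * c) * e = k / c * e + A * (c * e) by ring.
rewrite lerD2r // ler_pdivrMr //.
by apply: le_trans D0 _; rewrite le_eqVlt; apply/orP; left; apply/eqP; field; rewrite gt_eqF.
Qed.

Lemma bdd_taylor2 (c A : R) D s : bdd_tower 2 c A D -> `|s| <= c ->
  `|D 0%N s - D 0%N 0 - s * D 1%N 0| <= A * s ^+ 2.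
Proof.
move=> [dD bD] sc.
have sub (r : R) : `|r - 0| <= c -> `|r| <= c by rewrite subr0.
have := taylor2 (fun r h => dD 0%N isT r (sub r h))
  (fun r h => dD 1%N isT r (sub r h)) (fun r h => bD 2%N isT r (sub r h)) (s := s).
by rewrite !subr0; apply.
Qed.

Lemma glaeser_zero (c A : R) D : 0 < c -> bdd_tower 2 c A D ->
  (forall s, `|s| <= c -> 0 <= D 0%N s) -> D 0%N 0 = 0 ->
  forall s, `|s| <= c -> D 0%N s <= A * s ^+ 2.
Proof.
move=> c0 bD Dpos D0 s sc.
have A0 := bdd_tower_ge0 c0 bD.
have D1 : D 1%N 0 = 0.
  apply/normr0_eq0/le_anti; rewrite normr_ge0 andbT.
  apply: (@le0_eps _ _ (A * c)) => [|e e0]; first by rewrite mulr_ge0 // ltW.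
  have [e1|e1] := leP e 1.
    have := @glaeser_scale c A e 0 D c0 _ bD Dpos; rewrite e0 e1 D0 !mul0r add0r.
    by apply.
  have := @glaeser_scale c A 1 0 D c0 _ bD Dpos; rewrite ltr01 lexx D0 !mul0r add0r.
  move=> /(_ isT (lexx _)) h; apply: le_trans h _.
  by apply: ler_wpM2l; [apply: mulr_ge0; [exact: A0|exact: ltW]|exact: ltW].
have := bdd_taylor2 bD sc; rewrite D0 D1 subr0 mulr0 subr0.
by apply: le_trans; exact: ler_norm.
Qed.

Lemma sqr_le_norm (x C : R) : 0 <= C -> x ^+ 2 <= C ^+ 2 -> `|x| <= C.
Proof. by move=> C0; rewrite -[x ^+ 2]real_normK ?num_real // ler_pXn2r ?nnegrE. Qed.

Lemma derive_sqr_le (f : R -> R) (d A c : R) : 0 < c -> 0 <= A -> is_derive (0 : R) 1 f d ->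
  f 0 = 0 -> (forall s, `|s| <= c -> f s ^+ 2 <= A * s ^+ 2) -> `|d| <= A + 1.
Proof.
move=> c0 A0 df f0 Hf; apply: (norm_derive_le df f0).
apply/near_ballP; exists c => // s; rewrite subr0 => /ltW sc.
apply: sqr_le_norm; first by rewrite mulr_ge0 // addr_ge0.
apply: le_trans (Hf s sc) _; rewrite exprMn real_normK ?num_real // ler_wpM2r ?sqr_ge0 //.
nra.
Qed.

(** The bound for the rotation of order three.  At the scale [sqrt g] given by
    the norm [g = |w|^2], the function [w^3] is of size [sqrt g ^ 3], so that
    its derivative is of size [g] by interpolation; but it is [3 w^2 w']. *)
Lemma cube_root_derive_bound (c A : R) : 0 < c -> 0 <= A -> exists2 K : R, 0 <= K &
  forall (a b : R -> R) (a1 b1 : R) (Dg D1 D2 : nat -> R -> R),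
    is_derive (0 : R) 1 a a1 -> is_derive (0 : R) 1 b b1 ->
    bdd_tower 2 c A Dg -> bdd_tower 3 c A D1 -> bdd_tower 3 c A D2 ->
    (forall s, Dg 0%N s = rnorm (a s) (b s)) ->
    (forall s, D1 0%N s = rcube1 (a s) (b s)) ->
    (forall s, D2 0%N s = rcube2 (a s) (b s)) ->
    rnorm (a 0) (b 0) <= 1 -> `|a1| <= K /\ `|b1| <= K.
Proof.
move=> c0 A0; have [C C0 HC] := interpolation R 3.
pose K2 := 2 + 2 * A * c ^+ 2.
have K21 : 1 <= K2 by rewrite /K2; have := sqr_ge0 c; nra.
pose B := K2 ^+ 2 / (8 * c ^+ 3) + A.
pose K3 := C * B * (4 * c ^+ 2).
have c3 : 0 < c ^+ 3 by rewrite exprn_gt0.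
have c2 : 0 < c ^+ 2 by rewrite exprn_gt0.
have B1 : 0 <= K2 ^+ 2 / (8 * c ^+ 3).
  apply: divr_ge0; [exact: sqr_ge0|apply: mulr_ge0; [lra|exact: ltW]].
have B0 : 0 <= B by apply: addr_ge0.
have K30 : 0 <= K3.
  by apply: mulr_ge0; [exact: mulr_ge0|apply: mulr_ge0 => //; exact: ltW].
exists (A + 1 + K3) => [|a b a1 b1 Dg D1 D2 da db bg bb1 bb2 eg e1 e2 g1]; first lra.
have Dg_ge0 s : `|s| <= c -> 0 <= Dg 0%N s by rewrite eg => _; exact: rnorm_ge0.
have [g0|g0] := eqVneq (rnorm (a 0) (b 0)) 0.
  have gz := glaeser_zero c0 bg Dg_ge0 (etrans (eg 0) g0).
  have [a0 b0] := sum_sqr_eq0 (ltr0Sn _ 2) g0.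
  have Ha s : `|s| <= c -> a s ^+ 2 <= A * s ^+ 2.
    by move=> /gz; rewrite eg /rnorm; have := sqr_ge0 (b s); lra.
  have Hb s : `|s| <= c -> b s ^+ 2 <= A * s ^+ 2.
    by move=> /gz; rewrite eg /rnorm; have := sqr_ge0 (b s); have := sqr_ge0 (a s); lra.
  have := derive_sqr_le c0 A0 da a0 Ha; have := derive_sqr_le c0 A0 db b0 Hb.
  by split; lra.
have {g0} g0 : 0 < rnorm (a 0) (b 0) by rewrite lt_neqAle eq_sym g0 rnorm_ge0.
pose gam := Num.sqrt (rnorm (a 0) (b 0)).
have gam0 : 0 < gam by rewrite sqrtr_gt0.
have gam2 : gam ^+ 2 = rnorm (a 0) (b 0) by rewrite sqr_sqrtr // ltW.
have gam1 : gam <= 1 by rewrite -(@ler_pXn2r _ 2) ?nnegrE ?(ltW gam0) // gam2 expr1n.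
have h0 : 0 < c * gam by rewrite mulr_gt0.
have hc : c * gam <= c by rewrite ler_piMr // ltW.
have G1 : `|Dg 1%N 0| <= (1 / c + A * c) * gam.
  by apply: glaeser_scale bg Dg_ge0 _; rewrite ?gam0 // mul1r eg gam2.
have Gs s : `|s| <= c * gam -> rnorm (a s) (b s) <= K2 * gam ^+ 2.
  move=> sh; have := bdd_taylor2 bg (le_trans sh hc); rewrite !eg -gam2.
  move=> /(le_trans (ler_norm _)) h1.
  have h2 : s * Dg 1%N 0 <= c * gam * ((1 / c + A * c) * gam).
    by apply: le_trans (ler_norm _) _; rewrite normrM ler_pM.
  have h3 : s ^+ 2 <= (c * gam) ^+ 2.
    by rewrite -[s ^+ 2]real_normK ?num_real // lerXn2r ?nnegrE // ltW.
  have h4 := ler_wpM2l A0 h3.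
  have E : c * gam * ((1 / c + A * c) * gam) = gam ^+ 2 + A * (c * gam) ^+ 2.
    by field; rewrite gt_eqF.
  rewrite /K2; rewrite E in h2; move: h1 h2 h4; rewrite exprMn; nra.
have small (D : nat -> R -> R) : bdd_tower 3 c A D ->
    (forall s, D 0%N s ^+ 2 <= rnorm (a s) (b s) ^+ 3) -> `|D 1%N 0| <= K3 * gam ^+ 2.
  move=> [dD bD] D0.
  have in_c s : - (c * gam) <= s <= - (c * gam) + 2 * (c * gam) -> `|s| <= c * gam.
    by rewrite ler_norml => ?; lra.
  have l0 : 0 < 2 * (c * gam) by lra.
  have -> : K3 * gam ^+ 2 = C * B * (2 * (c * gam)) ^+ (3 - 1) by rewrite /K3 /=; ring.
  apply: (HC D (- (c * gam)) (2 * (c * gam)) B l0) => //; last by lra.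
  - by move=> i i3 s /= /in_c sh; apply: dD => //=; exact: le_trans hc.
  - move=> s /in_c sh; apply: (@le_trans _ _ (K2 ^+ 2 * gam ^+ 3)).
      apply: sqr_le_norm; first by rewrite mulr_ge0 ?exprn_ge0 ?ltW //; lra.
      apply: le_trans (D0 s) _.
      apply: (@le_trans _ _ ((K2 * gam ^+ 2) ^+ 3)).
        by rewrite lerXn2r ?nnegrE ?rnorm_ge0 ?Gs // mulr_ge0 ?sqr_ge0 //; lra.
      have -> : (K2 * gam ^+ 2) ^+ 3 = K2 ^+ 3 * gam ^+ 6 by ring.
      have -> : (K2 ^+ 2 * gam ^+ 3) ^+ 2 = K2 ^+ 4 * gam ^+ 6 by ring.
      apply: ler_wpM2r; first by apply: exprn_ge0; exact: ltW.
      by rewrite ler_weXn2l.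
    have -> : B * (2 * (c * gam)) ^+ 3 = K2 ^+ 2 * gam ^+ 3 + A * (2 * (c * gam)) ^+ 3.
      by rewrite /B; field; rewrite gt_eqF.
    by rewrite lerDl mulr_ge0 // exprn_ge0 // ltW.
  - move=> s /in_c sh; apply: le_trans (bD 3%N isT s (le_trans sh hc)) _.
    by rewrite /B lerDr.
have s1 := small D1 bb1 ltac:(by move=> s; rewrite e1 -rcube_norm lerDl mulr_ge0 // sqr_ge0).
have s2 : `|D2 1%N 0| <= K3 * gam ^+ 2.
  apply: small => // s; rewrite e2 -rcube_norm.
  have := sqr_ge0 (rcube1 (a s) (b s)); have := sqr_ge0 (rcube2 (a s) (b s)); lra.
have c00 : `|0 : R| <= c by rewrite normr0 ltW.
have E1 : D1 1%N 0 = 3 * a 0 ^+ 2 * a1 - 9 * a1 * b 0 ^+ 2 - 18 * a 0 * b 0 * b1.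
  apply: (is_derive_unique (bb1.1 0%N isT 0 c00)).
  have -> : D1 0%N = fun s => a s ^+ 3 - 9 * a s * b s ^+ 2.
    by apply/funext => s; rewrite e1.
  apply: (is_derive_eq (derB (derX da 3) (derM (derZ da 9) (derX db 2)))).
  by rewrite /=; ring.
have E2 : D2 1%N 0 = 6 * a 0 * a1 * b 0 + 3 * a 0 ^+ 2 * b1 - 9 * b 0 ^+ 2 * b1.
  apply: (is_derive_unique (bb2.1 0%N isT 0 c00)).
  have -> : D2 0%N = fun s => 3 * a s ^+ 2 * b s - 3 * b s ^+ 3.
    by apply/funext => s; rewrite e2.
  apply: (is_derive_eq (derB (derM (derZ (derX da 2) 3) db) (derZ (derX db 3) 3))).
  by rewrite /=; ring.
have key : D1 1%N 0 ^+ 2 + 3 * D2 1%N 0 ^+ 2 =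
    9 * (gam ^+ 2) ^+ 2 * (a1 ^+ 2 + 3 * b1 ^+ 2).
  by rewrite E1 E2 gam2 /rnorm; ring.
have g4 : 0 < (gam ^+ 2) ^+ 2 by rewrite !exprn_gt0.
have sq (x : R) : `|x| <= K3 * gam ^+ 2 -> x ^+ 2 <= K3 ^+ 2 * (gam ^+ 2) ^+ 2.
  move=> xh; rewrite -[x ^+ 2]real_normK ?num_real // -exprMn lerXn2r ?nnegrE //.
  by rewrite mulr_ge0 // sqr_ge0.
have {}key : a1 ^+ 2 + 3 * b1 ^+ 2 <= K3 ^+ 2.
  rewrite -(ler_pM2r g4); have := sq _ s1; have := sq _ s2.
  have := sqr_ge0 a1; have := sqr_ge0 b1; have := sqr_ge0 K3.
  set u := (gam ^+ 2) ^+ 2 in key g4 *; nra.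
have ha : `|a1| <= K3 by apply: sqr_le_norm => //; have := sqr_ge0 b1; lra.
have hb : `|b1| <= K3.
  by apply: sqr_le_norm => //; have := sqr_ge0 b1; have := sqr_ge0 a1; lra.
by clear - ha hb A0 K30; split; lra.
Qed.

(** ** The normalised situation *)

Lemma inv3_le_inv4e (v : R * R * R) : 1 / 2 <= inv2 v -> `|inv3 v| <= inv4e v.
Proof.
move=> h; apply: sqr_le_norm; first exact: inv4e_ge0.
move: h; rewrite /inv3 /inv2 /inv4e !exprMn.
have := sqr_ge0 v.1.1; have := sqr_ge0 v.1.2; have := sqr_ge0 v.2.
set X := v.1.1 ^+ 2; set Y := v.1.2 ^+ 2; set Z := v.2 ^+ 2 => Z0 Y0 X0 h.
have XY : 0 <= X * Y by apply: mulr_ge0.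
have p : 0 <= X * Y * Z by apply: mulr_ge0.
have -> : (X * Y + Y * Z + Z * X) ^+ 2 = (X * Y) ^+ 2 + (Y * Z) ^+ 2 + (Z * X) ^+ 2
  + 2 * (X * Y * Z) * (X + Y + Z) by ring.
have := ler_wpM2l p h; have := sqr_ge0 (X * Y); have := sqr_ge0 (Y * Z).
have := sqr_ge0 (Z * X); lra.
Qed.

Lemma inv6b_le_inv4e (v : R * R * R) : `|inv6b v| <= 3 / 2 * inv2 v * inv4e v.
Proof.
rewrite inv6bE /inv2 /inv4e.
have := sqr_ge0 v.1.1; have := sqr_ge0 v.1.2; have := sqr_ge0 v.2.
set X := v.1.1 ^+ 2; set Y := v.1.2 ^+ 2; set Z := v.2 ^+ 2 => Z0 Y0 X0.
have m (a b : R) : 0 <= a -> 0 <= b -> 0 <= a ^+ 2 * b by move=> *; rewrite mulr_ge0 ?sqr_ge0.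
have := m X Y X0 Y0; have := m X Z X0 Z0; have := m Y X Y0 X0; have := m Y Z Y0 Z0.
have := m Z X Z0 X0; have := m Z Y Z0 Y0.
have := mulr_ge0 (mulr_ge0 X0 Y0) Z0.
by rewrite ler_norml => *; apply/andP; split; nra.
Qed.

(** A curve that is on the unit sphere at [0], together with the derivatives of its
    invariants; [inv4e] is listed besides [inv2] and [inv4] because Glaeser's
    inequality is applied to it. *)
Record tame (c A : R) (v : R -> R * R * R) (v1 : R * R * R)
    (D2 D3 D4 De Da Db : nat -> R -> R) : Prop := Tame {
  tame_der : is_derive (0 : R) 1 v v1;
  tame_normal : inv2 (v 0) = 1;
  tame2 : D2 0%N = (fun s => inv2 (v s)) /\ bdd_tower 2 c A D2;
  tame3 : D3 0%N = (fun s => inv3 (v s)) /\ bdd_tower 2 c A D3;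
  tame4 : D4 0%N = (fun s => inv4 (v s)) /\ bdd_tower 2 c A D4;
  tame4e : De 0%N = (fun s => inv4e (v s)) /\ bdd_tower 2 c A De;
  tame6a : Da 0%N = (fun s => inv6a (v s)) /\ bdd_tower 3 c A Da;
  tame6b : Db 0%N = (fun s => inv6b (v s)) /\ bdd_tower 3 c A Db
}.

Lemma der_coord (v : R -> R * R * R) (t : R) v1 : is_derive t 1 v v1 ->
  [/\ is_derive t 1 (fun s => (v s).1.1) v1.1.1, is_derive t 1 (fun s => (v s).1.2) v1.1.2
    & is_derive t 1 (fun s => (v s).2) v1.2].
Proof.
move=> dv; have d1 := der_fst dv; split; last exact: der_snd.
  exact: (der_fst d1).
exact: (der_snd d1).
Qed.

Lemma tame_cyc c A v v1 D2 D3 D4 De Da Db : tame c A v v1 D2 D3 D4 De Da Db ->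
  tame c A (fun s => cyc (v s)) (cyc v1) D2 D3 D4 De Da Db.
Proof.
have inv w : [/\ inv2 (cyc w) = inv2 w, inv3 (cyc w) = inv3 w, inv4 (cyc w) = inv4 w,
    inv6a (cyc w) = inv6a w & inv6b (cyc w) = inv6b (w : R * R * R)].
  by apply/tet_invP; exact: cyc_inv.
have inve (w : R * R * R) : inv4e (cyc w) = inv4e w by rewrite /inv4e /cyc /=; ring.
move=> [dv n [e2 b2] [e3 b3] [e4 b4] [ee be] [ea ba] [eb bb]].
have [d1 d2 d3] := der_coord dv.
split; first exact: (der_pair (der_pair d2 d3) d1).
- by have [-> _ _ _ _] := inv (v 0).
- by split=> //; rewrite e2; apply/funext => s; have [-> _ _ _ _] := inv (v s).
- by split=> //; rewrite e3; apply/funext => s; have [_ -> _ _ _] := inv (v s).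
- by split=> //; rewrite e4; apply/funext => s; have [_ _ -> _ _] := inv (v s).
- by split=> //; rewrite ee; apply/funext => s; rewrite inve.
- by split=> //; rewrite ea; apply/funext => s; have [_ _ _ -> _] := inv (v s).
- by split=> //; rewrite eb; apply/funext => s; have [_ _ _ _ ->] := inv (v s).
Qed.

(** The squares are combinations of [inv2] and of the components of [w]. *)
Lemma squares_derive_bound (c A : R) : 0 < c -> 0 <= A -> exists2 K : R, 0 <= K &
  forall v v1 D2 D3 D4 De Da Db, tame c A v v1 D2 D3 D4 De Da Db ->
  [/\ `|2 * (v 0).1.1 * v1.1.1| <= K, `|2 * (v 0).1.2 * v1.1.2| <= K
    & `|2 * (v 0).2 * v1.2| <= K].
Proof.
move=> c0 A0; have [K K0 HK] := cube_root_derive_bound c0 A0.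
exists (A + 2 * K) => [|v v1 D2 D3 D4 De Da Db]; first lra.
move=> [dv n [e2 b2] _ [e4 b4] _ [ea ba] [eb bb]].
have [dx dy dz] := der_coord dv.
have dX := derX dx 2; have dY := derX dy 2; have dZ := derX dz 2.
have da := derB dX (derM (derD dY dZ) (der_cst 2^-1 0)).
have db := derM (derB dY dZ) (der_cst 2^-1 0).
have [|||k1 k2] := HK _ _ _ _ D4 Da Db da db b4 ba bb (fun s => congr1 (@^~ s) e4).
- by move=> s; rewrite ea.
- by move=> s; rewrite eb.
- by rewrite -/(inv4 (v 0)); have := inv4_le (v 0); rewrite n expr1n.
have h2 : D2 1%N 0 = 2 * (v 0).1.1 * v1.1.1 + 2 * (v 0).1.2 * v1.1.2 + 2 * (v 0).2 * v1.2.
  apply: (is_derive_unique (b2.1 0%N isT 0 _)); first by rewrite /= normr0 ltW.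
  rewrite e2; apply: (is_derive_eq (derD (derD dX dY) dZ)).
  by rewrite /=; ring.
have h3 : `|D2 1%N 0| <= A by apply: b2.2 => //; rewrite normr0 ltW.
move: k1 k2 h3; rewrite h2 /= !expr1 !mulr0 !addr0.
set X := 2 * _ * _; set Y := 2 * _ * _; set Z := 2 * _ * _.
clearbody X Y Z; clear.
rewrite !ler_norml => /andP[k1 k1'] /andP[k2 k2'] /andP[k3 k3'].
by split; apply/andP; split; lra.
Qed.

Lemma sum_le1 (v : R * R * R) : inv2 v = 1 ->
  [/\ `|v.1.1| <= 1, `|v.1.2| <= 1 & `|v.2| <= 1].
Proof.
rewrite /inv2 => n.
have := sqr_ge0 v.1.1; have := sqr_ge0 v.1.2; have := sqr_ge0 v.2 => h1 h2 h3.
by split; apply: sqr_le_norm => //; rewrite expr1n; lra.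
Qed.

Lemma half_le_norm (y : R) : 1 / 4 <= y ^+ 2 -> 1 / 2 <= `|y|.
Proof.
move=> h; rewrite leNgt; apply/negP => h2.
have : `|y| ^+ 2 < (1 / 2) ^+ 2 by rewrite ltr_pXn2r ?nnegrE // divr_ge0.
by rewrite real_normK ?num_real //; lra.
Qed.

Lemma norm_le_of_mul (K e y d : R) : 0 < e -> e <= `|y| -> `|y * d| <= K -> `|d| <= K / e.
Proof.
move=> e0 ey; rewrite normrM ler_pdivlMr // => h; apply: le_trans h.
by rewrite mulrC ler_wpM2r.
Qed.

Lemma derive_inv3 c A v v1 D2 D3 D4 De Da Db : 0 < c -> tame c A v v1 D2 D3 D4 De Da Db ->
  D3 1%N 0 = v1.1.1 * (v 0).1.2 * (v 0).2 + (v 0).1.1 * v1.1.2 * (v 0).2 +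
    (v 0).1.1 * (v 0).1.2 * v1.2.
Proof.
move=> c0 [dv _ _ [e3 b3] _ _ _ _]; have [dx dy dz] := der_coord dv.
apply: (is_derive_unique (b3.1 0%N isT 0 _)); first by rewrite /= normr0 ltW.
rewrite e3; apply: (is_derive_eq (derM (derM dx dy) dz)).
by rewrite /=; ring.
Qed.

(** Two coordinates away from zero determine the derivative of the third. *)
Lemma bound_two (c A : R) : 0 < c -> 0 <= A -> exists2 K : R, 0 <= K &
  forall v v1 D2 D3 D4 De Da Db, tame c A v v1 D2 D3 D4 De Da Db ->
  1 / 4 <= (v 0).1.2 ^+ 2 -> 1 / 4 <= (v 0).2 ^+ 2 -> `|v1| <= K.
Proof.
move=> c0 A0; have [K K0 HK] := squares_derive_bound c0 A0.
exists (4 * (A + 4 * K)) => [|v v1 D2 D3 D4 De Da Db tv /half_le_norm y2 /half_le_norm z2].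
  lra.
have [_ ky kz] := HK _ _ _ _ _ _ _ _ tv.
have dT := derive_inv3 c0 tv.
have bT : `|D3 1%N 0| <= A.
  by case: tv => _ _ _ [_ [_ b3]] _ _ _ _; apply: b3 => //; rewrite normr0 ltW.
have [nx ny nz] := sum_le1 (tame_normal tv).
have p2 : 0 < 1 / 2 :> R by lra.
have hy : `|v1.1.2| <= K.
  have := @norm_le_of_mul K 1 (2 * (v 0).1.2) v1.1.2 ltr01; rewrite divr1; apply=> //.
  by rewrite normrM gtr0_norm //; lra.
have hz : `|v1.2| <= K.
  have := @norm_le_of_mul K 1 (2 * (v 0).2) v1.2 ltr01; rewrite divr1; apply=> //.
  by rewrite normrM gtr0_norm //; lra.
have hx : `|v1.1.1| <= (A + K + K) / (1 / 4).
  apply: (@norm_le_of_mul _ _ ((v 0).1.2 * (v 0).2)); first lra.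
    rewrite normrM; have -> : 1 / 4 = 1 / 2 * (1 / 2) :> R by field.
    by apply: ler_pM => //; lra.
  have -> : (v 0).1.2 * (v 0).2 * v1.1.1 = D3 1%N 0 - (v 0).1.1 * v1.1.2 * (v 0).2 -
    (v 0).1.1 * (v 0).1.2 * v1.2 by rewrite dT; ring.
  have q (a b d : R) : `|a| <= 1 -> `|b| <= 1 -> `|d| <= K -> `|a * b * d| <= K.
    move=> ha hb hd; rewrite !normrM -[K]mul1r; apply: ler_pM => //.
    by rewrite mulr_ile1.
  apply: le_trans (ler_normB _ _) _; apply: lerD; last exact: q.
  apply: le_trans (ler_normB _ _) _; apply: lerD => //.
  by rewrite mulrAC; exact: q.
rewrite [v1]surjective_pairing [v1.1]surjective_pairing !norm_pair !ge_max.
clear - hx hy hz A0 K0.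
by apply/andP; split; [apply/andP; split|]; lra.
Qed.

(** ** Near an axis of order two *)

(** Glaeser's inequality applies to the nonnegative function [k E + D]. *)
Lemma glaeser_dominated (c A k L : R) (E D : nat -> R -> R) (e : R) : 0 < c ->
  0 < e <= 1 -> 0 <= k -> bdd_tower 2 c A E -> bdd_tower 2 c A D ->
  (forall s, `|s| <= c -> `|D 0%N s| <= k * E 0%N s) -> E 0%N 0 = e ^+ 2 ->
  `|E 1%N 0| <= L * e ->
  `|D 1%N 0| <= (2 * k / c + (k * A + A) * c + k * L) * e.
Proof.
move=> c0 eI k0 bE bD dom E0 hE.
have := glaeser_scale (k := 2 * k) c0 eI (bdd_towerD (bdd_towerZ k bE) bD).
rewrite /= [`|k|]ger0_norm // => G.
have {}G : `|k * E 1%N 0 + D 1%N 0| <= (2 * k / c + (k * A + A) * c) * e.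
  apply: G => [s sc|]; first by have := dom s sc; rewrite ler_norml; lra.
  have := dom 0; rewrite normr0 (ltW c0) => /(_ isT) /(le_trans (ler_norm _)).
  by rewrite E0; lra.
have -> : D 1%N 0 = (k * E 1%N 0 + D 1%N 0) - k * E 1%N 0 by ring.
apply: le_trans (ler_normB _ _) _; rewrite [leRHS]mulrDl lerD // normrM ger0_norm //.
by rewrite -mulrA ler_wpM2l.
Qed.

Lemma axis_product (x y z x1 y1 z1 e K L : R) : 0 < e -> 1 / 2 <= `|z| -> `|z1| <= K ->
  `|x * y| <= e -> `|x1 * y * z + x * y1 * z + x * y * z1| <= L * e ->
  `|x1 * y + x * y1| <= 2 * (L + K) * e.
Proof.
move=> e0 hz hz1 hxy hT.
have qE : z * (x1 * y + x * y1) =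
  x1 * y * z + x * y1 * z + x * y * z1 - x * y * z1 by ring.
have : `|z * (x1 * y + x * y1)| <= (L + K) * e.
  rewrite qE mulrDl; apply: le_trans (ler_normB _ _) _; apply: lerD => //.
  by rewrite normrM mulrC; apply: ler_pM.
move=> /(@norm_le_of_mul _ (1 / 2) _ _ ltac:(lra) hz) h; apply: le_trans h _.
by rewrite le_eqVlt; apply/orP; left; apply/eqP; field.
Qed.

(** The last hypothesis bounds the derivative of the product defining [inv6b], in
    which the factors other than [X - Y] are away from zero. *)
Lemma axis_difference (X Y Z X1 Y1 Z1 e K L : R) : 0 <= X <= 1 / 4 -> 0 <= Y <= 1 / 4 ->
  X + Y + Z = 1 -> X + Y <= 2 * e -> `|X1| <= K -> `|Y1| <= K -> `|Z1| <= K ->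
  `|3 / 2 * ((X1 - Y1) * ((Y - Z) * (X - Z)) +
     (X - Y) * ((Y1 - Z1) * (X - Z) + (Y - Z) * (X1 - Z1)))| <= L * e ->
  `|X1 - Y1| <= 16 * (L + 12 * K) * e.
Proof.
move=> hX hY n hXY hX1 hY1 hZ1.
have a1 : `|X - Z| <= 1 by rewrite ler_norml; lra.
have a2 : `|Y - Z| <= 1 by rewrite ler_norml; lra.
have P0 : 1 / 16 <= (Y - Z) * (X - Z).
  have -> : (Y - Z) * (X - Z) = (Z - Y) * (Z - X) by ring.
  have -> : 1 / 16 = 1 / 4 * (1 / 4) :> R by field.
  by apply: ler_pM; lra.
have nXY : `|X - Y| <= 2 * e by rewrite ler_norml; lra.
clear hX hY n hXY.
have w (a b d : R) : `|a| <= K -> `|b| <= K -> `|d| <= 1 -> `|(a - b) * d| <= 2 * K.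
  move=> ha hb hd; rewrite normrM -[2 * K]mulr1; apply: ler_pM => //.
  by apply: le_trans (ler_normB _ _) _; lra.
have nP1 : `|(Y1 - Z1) * (X - Z) + (Y - Z) * (X1 - Z1)| <= 4 * K.
  have -> : 4 * K = 2 * K + 2 * K by ring.
  apply: le_trans (ler_normD _ _) _; apply: lerD; first exact: w.
  by rewrite mulrC; exact: w.
move: P0 nP1; set P := (Y - Z) * (X - Z); set P1 := _ * _ + _ => P0 nP1.
set f := X1 - Y1 => hB.
clear a1 a2 w hX1 hY1 hZ1.
have fP : `|P * f| <= (L + 12 * K) * e.
  have -> : P * f = 2 / 3 * (3 / 2 * (f * P + (X - Y) * P1)) - (X - Y) * P1 by field.
  apply: le_trans (ler_normB _ _) _; rewrite [leRHS]mulrDl; apply: lerD.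
    rewrite normrM ger0_norm; last lra.
    by apply: le_trans hB; rewrite ler_piMl //; lra.
  have h := ler_pM (normr_ge0 _) (normr_ge0 _) nXY nP1.
  have K0 : 0 <= 4 * K by apply: le_trans nP1.
  have e0 : 0 <= 2 * e by apply: le_trans nXY.
  rewrite normrM; apply: le_trans h _.
  have : 0 <= e * K by apply: mulr_ge0; lra.
  lra.
have PP : 1 / 16 <= `|P| by rewrite ger0_norm; lra.
have h := norm_le_of_mul (ltac:(lra) : 0 < 1 / 16) PP fP.
by apply: le_trans h _; rewrite le_eqVlt; apply/orP; left; apply/eqP; field.
Qed.

(** The two combinations are the components of [(x + i y) (x1 + i y1)]. *)
Lemma axis_norm (x y x1 y1 e k1 k2 : R) : 0 < e -> e ^+ 2 <= 4 * (x ^+ 2 + y ^+ 2) ->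
  `|2 * x * x1 - 2 * y * y1| <= k1 * e -> `|x1 * y + x * y1| <= k2 * e ->
  x1 ^+ 2 + y1 ^+ 2 <= k1 ^+ 2 + 4 * k2 ^+ 2.
Proof.
move=> e0 he h1 h2.
have sq (u k : R) : `|u| <= k * e -> u ^+ 2 <= k ^+ 2 * e ^+ 2.
  move=> h; rewrite -[u ^+ 2]real_normK ?num_real // -exprMn lerXn2r ?nnegrE //.
  exact: le_trans h.
have {}h1 := sq _ _ h1; have {}h2 := sq _ _ h2.
have key : (2 * x * x1 - 2 * y * y1) ^+ 2 + 4 * (x1 * y + x * y1) ^+ 2 =
  4 * (x ^+ 2 + y ^+ 2) * (x1 ^+ 2 + y1 ^+ 2) by ring.
have p0 : 0 <= x1 ^+ 2 + y1 ^+ 2 by rewrite addr_ge0 // sqr_ge0.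
have e20 : 0 < e ^+ 2 by rewrite exprn_gt0.
rewrite -(ler_pM2l e20); apply: le_trans (ler_wpM2r p0 he) _; rewrite -key; lra.
Qed.

Lemma sqr_le_le (x k : R) : 0 <= k -> x ^+ 2 <= k -> `|x| <= k + 1.
Proof. by move=> k0 h; apply: sqr_le_norm; [lra|nra]. Qed.

(** On the axis itself [x^2 + y^2] is dominated by [inv4e], which vanishes to second
    order. *)
Lemma axis_zero (c A : R) (v : R -> R * R * R) v1 (De : nat -> R -> R) : 0 < c -> 0 <= A ->
  is_derive (0 : R) 1 v v1 -> De 0%N = (fun s => inv4e (v s)) -> bdd_tower 2 c A De ->
  (v 0).1.1 = 0 -> (v 0).1.2 = 0 -> 1 / 2 <= (v 0).2 ^+ 2 ->
  `|v1.1.1| <= 4 * A + 1 /\ `|v1.1.2| <= 4 * A + 1.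
Proof.
move=> c0 A0 dv ee be X00 Y00 Z2; have [dx dy dz] := der_coord dv.
have E_ge0 s : `|s| <= c -> 0 <= De 0%N s by rewrite ee => _; exact: inv4e_ge0.
have E00 : De 0%N 0 = 0 by rewrite ee /inv4e X00 Y00; ring.
have Ez := glaeser_zero c0 be E_ge0 E00.
have cz : {for 0, continuous (fun s => (v s).2 ^+ 2 - 1 / 4)}.
  exact: is_derive_continuous (derB (derX dz 2) (der_cst (1 / 4) 0)).
have /near_ballP[r r0 Hr] : \forall s \near (0 : R), 0 < (v s).2 ^+ 2 - 1 / 4.
  by apply: cts_gt0 => //; lra.
have r'0 : 0 < Num.min (r / 2) c by rewrite lt_min c0 andbT; lra.
have small s : `|s| <= Num.min (r / 2) c -> (v s).1.1 ^+ 2 + (v s).1.2 ^+ 2 <= 4 * A * s ^+ 2.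
  rewrite le_min => /andP[sr sc]; have := Ez s sc; rewrite ee /inv4e.
  have := Hr s; rewrite subr0 => /(_ ltac:(lra)).
  have := sqr_ge0 (v s).1.1; have := sqr_ge0 (v s).1.2.
  clear; move: (_ ^+ 2) ((v s).1.2 ^+ 2) ((v s).2 ^+ 2) => x y z h1 h2 h3.
  have : 0 <= x * y by apply: mulr_ge0.
  nra.
have A4 : 0 <= 4 * A by lra.
split.
  apply: (derive_sqr_le r'0 A4 dx X00) => s /small.
  by have := sqr_ge0 (v s).1.2; lra.
apply: (derive_sqr_le r'0 A4 dy Y00) => s /small.
by have := sqr_ge0 (v s).1.1; lra.
Qed.

Lemma inv2_near (c A : R) v v1 D2 D3 D4 De Da Db s : 0 <= A ->
  tame c A v v1 D2 D3 D4 De Da Db -> `|s| <= c -> A * c <= 1 / 2 ->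
  1 / 2 <= inv2 (v s) <= 3 / 2.
Proof.
move=> A0 [_ n [e2 b2] _ _ _ _ _] sc Ac.
have h1 (x : R) : `|x - 0| <= c -> is_derive x 1 (fun s => inv2 (v s)) (D2 1%N x).
  by rewrite subr0 -e2; exact: (b2.1 0%N isT).
have h2 (x : R) : `|x - 0| <= c -> `|D2 1%N x| <= A.
  by rewrite subr0; exact: (b2.2 1%N isT).
have := mvt_dist h1 h2 (s := s); rewrite subr0 n => /(_ sc).
have : A * `|s| <= A * c by apply: ler_wpM2l.
by rewrite ler_norml; lra.
Qed.

Lemma tame_shrink c c' A v v1 D2 D3 D4 De Da Db : c' <= c ->
  tame c A v v1 D2 D3 D4 De Da Db -> tame c' A v v1 D2 D3 D4 De Da Db.
Proof.
move=> cc [dv n [e2 b2] [e3 b3] [e4 b4] [ee be] [ea ba] [eb bb]].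
have sh m D (b : bdd_tower m c A D) := bdd_towerW (leqnn m) cc b.
by split=> //; split=> //; exact: sh.
Qed.

(** Near an axis of order two the function [(x + i y)^2] is, up to well-behaved
    factors, a combination of invariants dominated by [inv4e]; Glaeser's
    inequality bounds their derivatives by the square root of [inv4e], hence
    the derivative of [x + i y]. *)
Lemma bound_one (c A : R) : 0 < c -> 0 <= A -> exists2 K : R, 0 <= K &
  forall v v1 D2 D3 D4 De Da Db, tame c A v v1 D2 D3 D4 De Da Db ->
  (v 0).1.1 ^+ 2 <= 1 / 4 -> (v 0).1.2 ^+ 2 <= 1 / 4 -> `|v1| <= K.
Proof.
move=> c0 A0; have [K K0 HK] := squares_derive_bound c0 A0.
have [c' [c'0 c'c c'A]] : exists c' : R, [/\ 0 < c', c' <= c & A * c' <= 1 / 2].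
  exists (Num.min c (1 / (2 * A + 2))); split.
  - by rewrite lt_min c0 divr_gt0 //; lra.
  - by rewrite ge_min lexx.
  - apply: (@le_trans _ _ (A * (1 / (2 * A + 2)))).
      by apply: ler_wpM2l => //; rewrite ge_min lexx orbT.
    by rewrite mulrA ler_pdivrMr; lra.
pose L1 := 1 / c' + A * c'.
pose L3 := 2 * 1 / c' + (1 * A + A) * c' + 1 * L1.
pose L6 := 2 * (9 / 4) / c' + (9 / 4 * A + A) * c' + 9 / 4 * L1.
pose Kz := (16 * (L6 + 12 * K)) ^+ 2 + 4 * (2 * (L3 + K)) ^+ 2.
have Kz0 : 0 <= Kz by apply: addr_ge0; [exact: sqr_ge0|apply: mulr_ge0 => //; exact: sqr_ge0].
exists (K + (4 * A + 1) + (Kz + 1)) => [|v v1 D2 D3 D4 De Da Db tv0 X4 Y4].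
  by clearbody Kz; lra.
have [kx ky kz] := HK _ _ _ _ _ _ _ _ tv0.
have tv := tame_shrink c'c tv0.
have dT := derive_inv3 c'0 tv.
have near2 s (sc : `|s| <= c') := inv2_near A0 tv sc c'A.
have [dv n [e2 b2] [e3 b3] _ [ee be] _ [eb bb]] := tv.
have [dx dy dz] := der_coord dv.
have c00 : `|0 : R| <= c' by rewrite normr0 ltW.
clear HK tv0 c'c c'A c0.
have nn : (v 0).1.1 ^+ 2 + (v 0).1.2 ^+ 2 + (v 0).2 ^+ 2 = 1 by exact: n.
have Z2 : 1 / 2 <= (v 0).2 ^+ 2 by clear - nn X4 Y4; lra.
have z2 : 1 / 2 <= `|(v 0).2| by apply: half_le_norm; clear - Z2; lra.
have hz : `|v1.2| <= K.
  have := @norm_le_of_mul K 1 (2 * (v 0).2) v1.2 ltr01; rewrite divr1; apply=> //.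
  by clear - z2; rewrite normrM gtr0_norm //; lra.
suff [hx hy] : `|v1.1.1| <= (4 * A + 1) + (Kz + 1) /\ `|v1.1.2| <= (4 * A + 1) + (Kz + 1).
  rewrite [v1]surjective_pairing [v1.1]surjective_pairing !norm_pair !ge_max.
  clearbody Kz; clear - hx hy hz Kz0 A0 K0.
  by apply/andP; split; [apply/andP; split|]; lra.
have E_ge0 s : `|s| <= c' -> 0 <= De 0%N s by rewrite ee => _; exact: inv4e_ge0.
have [Es Ee] : ((v 0).1.1 ^+ 2 + (v 0).1.2 ^+ 2) / 2 <= De 0%N 0 /\
    De 0%N 0 <= 2 * ((v 0).1.1 ^+ 2 + (v 0).1.2 ^+ 2).
  rewrite ee /inv4e; have := sqr_ge0 (v 0).1.1; have := sqr_ge0 (v 0).1.2.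
  move: X4 Y4 Z2 nn; clear.
  move: (_ ^+ 2) ((v 0).1.2 ^+ 2) ((v 0).2 ^+ 2) => X Y Z h1 h2 h3 h4 h5 h6.
  by have : 0 <= X * Y by [apply: mulr_ge0]; split; nra.
have [E00|En0] := eqVneq (De 0%N 0) 0.
  have := sqr_ge0 (v 0).1.1; have := sqr_ge0 (v 0).1.2 => y0 x0.
  have X00 : (v 0).1.1 = 0.
    by apply/eqP; rewrite -sqrf_eq0; apply/eqP; clear - Es E00 y0 x0; lra.
  have Y00 : (v 0).1.2 = 0.
    by apply/eqP; rewrite -sqrf_eq0; apply/eqP; clear - Es E00 y0 x0; lra.
  have [h1 h2] := axis_zero c'0 A0 dv ee be X00 Y00 Z2.
  by clearbody Kz; clear - h1 h2 Kz0; split; lra.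
have {En0} Ep : 0 < De 0%N 0 by rewrite lt_neqAle eq_sym En0 E_ge0.
pose ep := Num.sqrt (De 0%N 0).
have ep0 : 0 < ep by rewrite sqrtr_gt0.
have ep2 : De 0%N 0 = ep ^+ 2 by rewrite sqr_sqrtr // ltW.
have ep1 : ep <= 1.
  rewrite -(@ler_pXn2r _ 2) ?nnegrE ?(ltW ep0) // -ep2 expr1n ee inv4eE n.
  have := rnorm_ge0 (wa (v 0)) (wb (v 0)); rewrite -/(inv4 (v 0)); clear; lra.
have epI : 0 < ep <= 1 by rewrite ep0.
have gE : `|De 1%N 0| <= L1 * ep.
  by apply: glaeser_scale be E_ge0 _ => //; rewrite mul1r ep2.
have k0 : 0 <= 9 / 4 :> R by apply: divr_ge0.
have g3 : `|D3 1%N 0| <= L3 * ep.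
  apply: glaeser_dominated be b3 _ ep2 gE => // s sc.
  rewrite e3 ee mul1r; apply: inv3_le_inv4e; by have /andP[] := near2 s sc.
have g6 : `|Db 1%N 0| <= L6 * ep.
  apply: glaeser_dominated be (bdd_towerW _ _ bb) _ ep2 gE => // s sc.
  rewrite eb ee; apply: le_trans (inv6b_le_inv4e _) _.
  apply: ler_wpM2r; first exact: inv4e_ge0.
  by have /andP[_] := near2 s sc; clear; lra.
have epsq : ep ^+ 2 <= ep by rewrite expr2 ler_piMr // ltW.
have XYe : (v 0).1.1 ^+ 2 + (v 0).1.2 ^+ 2 <= 2 * ep.
  by clear - Es ep2 epsq; lra.
have hq : `|v1.1.1 * (v 0).1.2 + (v 0).1.1 * v1.1.2| <= 2 * (L3 + K) * ep.
  apply: axis_product ep0 z2 hz _ _; last by rewrite -dT.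
  rewrite normrM; have := sqr_ge0 (`|(v 0).1.1| - `|(v 0).1.2|).
  have e1 := real_normK (num_real (v 0).1.1); have e2' := real_normK (num_real (v 0).1.2).
  clear - XYe e1 e2'; nra.
have hf : `|2 * (v 0).1.1 * v1.1.1 - 2 * (v 0).1.2 * v1.1.2| <= 16 * (L6 + 12 * K) * ep.
  have dX := derX dx 2; have dY := derX dy 2; have dZ := derX dz 2.
  apply: axis_difference nn XYe kx ky kz _; rewrite ?X4 ?Y4 ?sqr_ge0 //.
  suff <- : Db 1%N 0 = 3 / 2 * ((2 * (v 0).1.1 * v1.1.1 - 2 * (v 0).1.2 * v1.1.2) *
      (((v 0).1.2 ^+ 2 - (v 0).2 ^+ 2) * ((v 0).1.1 ^+ 2 - (v 0).2 ^+ 2)) +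
    ((v 0).1.1 ^+ 2 - (v 0).1.2 ^+ 2) *
      ((2 * (v 0).1.2 * v1.1.2 - 2 * (v 0).2 * v1.2) * ((v 0).1.1 ^+ 2 - (v 0).2 ^+ 2) +
       ((v 0).1.2 ^+ 2 - (v 0).2 ^+ 2) * (2 * (v 0).1.1 * v1.1.1 - 2 * (v 0).2 * v1.2))).
    by [].
  apply: (is_derive_unique (bb.1 0%N isT 0 c00)).
  have -> : Db 0%N = fun s => 3 / 2 * ((v s).1.1 ^+ 2 - (v s).1.2 ^+ 2) *
      ((v s).1.2 ^+ 2 - (v s).2 ^+ 2) * ((v s).1.1 ^+ 2 - (v s).2 ^+ 2).
    by rewrite eb; apply/funext => s; rewrite inv6bE.
  apply: (is_derive_eq (derM (derM (derZ (derB dX dY) (3 / 2)) (derB dY dZ)) (derB dX dZ))).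
  by rewrite /=; ring.
have key := axis_norm ep0 _ hf hq.
have {}key : v1.1.1 ^+ 2 + v1.1.2 ^+ 2 <= Kz.
  by apply: key; clear - Ee ep2 Es; lra.
have s1 := sqr_ge0 v1.1.1; have s2 := sqr_ge0 v1.1.2.
clearbody Kz; clear - key s1 s2 Kz0 A0.
have fin (x : R) : x ^+ 2 <= Kz -> `|x| <= 4 * A + 1 + (Kz + 1).
  by move=> /(sqr_le_le Kz0); lra.
by split; apply: fin; lra.
Qed.

(** At every point either two squared coordinates are at least [1 / 4] or two
    of them are at most [1 / 4]. *)
Lemma normalised_bound (c A : R) : 0 < c -> 0 <= A -> exists2 K : R, 0 <= K &
  forall v v1 D2 D3 D4 De Da Db, tame c A v v1 D2 D3 D4 De Da Db -> `|v1| <= K.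
Proof.
move=> c0 A0; have [K1 K10 H1] := bound_one c0 A0; have [K2 K20 H2] := bound_two c0 A0.
exists (K1 + K2) => [|v v1 D2 D3 D4 De Da Db tv]; first by rewrite addr_ge0.
have cyc_norm (w : R * R * R) : `|cyc w| = `|w|.
  by case: w => [[x y] z]; rewrite /cyc !norm_pair /= maxC maxA.
have t1 := tame_cyc tv; have t2 := tame_cyc t1.
have h0 := H1 _ _ _ _ _ _ _ _ tv; have h1 := H1 _ _ _ _ _ _ _ _ t1.
have h2 := H1 _ _ _ _ _ _ _ _ t2.
have g0 := H2 _ _ _ _ _ _ _ _ tv; have g1 := H2 _ _ _ _ _ _ _ _ t1.
have g2 := H2 _ _ _ _ _ _ _ _ t2.
rewrite !cyc_norm /= in h1 h2 g1 g2.
have small : `|v1| <= K1 -> `|v1| <= K1 + K2 by move=> h; rewrite (le_trans h) ?lerDl.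
have big : `|v1| <= K2 -> `|v1| <= K1 + K2 by move=> h; rewrite (le_trans h) ?lerDr.
have [x4|/ltW x4] := leP ((v 0).1.1 ^+ 2) (1 / 4);
have [y4|/ltW y4] := leP ((v 0).1.2 ^+ 2) (1 / 4);
have [z4|/ltW z4] := leP ((v 0).2 ^+ 2) (1 / 4);
by [apply: small; (exact: h0 || exact: h1 || exact: h2)
   |apply: big; (exact: g0 || exact: g1 || exact: g2)].
Qed.

End Bound.

(** ** Rescaling *)

Section Rescale.
Variable R : realType.
Implicit Types I : set R.

Lemma interpolation_bdd (n : nat) (c B M : R) : 0 < c -> 0 <= B -> 0 <= M ->
  exists2 A : R, 0 <= A & forall D : nat -> R -> R, tower n [set s | `|s| <= c] D ->
    (forall s, `|s| <= c -> `|D 0%N s| <= B) -> (forall s, `|s| <= c -> `|D n s| <= M) ->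
    bdd_tower n c A D.
Proof.
move=> c0 B0 M0; have [C C0 HC] := interpolation R n.
pose l := 2 * c; have l0 : 0 < l by rewrite /l; lra.
have ln : 0 < l ^+ n by rewrite exprn_gt0.
pose B' := B / l ^+ n + M.
have B'1 : 0 <= B / l ^+ n by apply: divr_ge0 => //; exact: ltW.
have B'0 : 0 <= B' by apply: addr_ge0.
exists (C * B' * (1 + l) ^+ n) => [|D dD h0 hn].
  by apply: mulr_ge0; [exact: mulr_ge0|apply: exprn_ge0; lra].
split=> // k kn s sc.
have in_c r : - c <= r <= - c + l -> `|r| <= c by rewrite ler_norml /l; lra.
have := HC D (- c) l B' l0 _ _ _ k kn s _.
have h : `|D k s| <= C * B' * l ^+ (n - k).
  apply: (HC D (- c)) => //.
  - by move=> i i_n r /= /in_c; exact: dD.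
  - move=> r /in_c rc; apply: le_trans (h0 r rc) _.
    rewrite /B' mulrDl divfK ?gt_eqF // lerDl.
    by apply: mulr_ge0 => //; exact: ltW.
  - by move=> r /in_c rc; apply: le_trans (hn r rc) _; rewrite /B' lerDr.
  - by move: sc; rewrite ler_norml /l; lra.
move=> _; apply: le_trans h _; apply: ler_wpM2l; first exact: mulr_ge0.
apply: (@le_trans _ _ ((1 + l) ^+ (n - k))).
  by apply: lerXn2r; rewrite ?nnegrE; lra.
by apply: ler_weXn2l; [lra|exact: leq_subr].
Qed.

Lemma continuous_bounded I (f : R -> R) (a b : R) : a <= b ->
  (forall s, a <= s <= b -> {for s, continuous f}) ->
  exists2 M : R, 0 <= M & forall s, a <= s <= b -> `|f s| <= M.
Proof.
move=> ab cf.
have [|x _ Hx] := @EVT_max R (fun s => `|f s|) a b ab.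
  apply: continuous_in_subspaceT => s; rewrite inE /= in_itv /= => sab.
  by apply: (@continuous_comp _ _ _ f Num.norm); [exact: cf|exact: norm_continuous].
exists `|f x| => // s sab; apply: Hx; by rewrite in_itv.
Qed.

(** The derivatives of the function [D 0 (t + rho s) / rho^n] of [s]. *)
Definition rescaled (n : nat) (t rho : R) (D : nat -> R -> R) (i : nat) (s : R) : R :=
  rho ^+ i / rho ^+ n * D i (t + rho * s).

Lemma rescaled_tower (n : nat) (t rho c : R) (J : set R) D :
  (forall s, `|s| <= c -> J (t + rho * s)) -> tower n J D ->
  tower n [set s | `|s| <= c] (rescaled n t rho D).
Proof.
move=> HJ dD i i_n s /= sc; rewrite /rescaled.
have da : is_derive s 1 (fun s => t + rho * s) rho.
  apply: (is_derive_eq (derD (der_cst t s) (derZ (der_id s) rho))).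
  by rewrite add0r mulr1.
have dc := @is_derive1_comp _ (D i) (fun s => t + rho * s) s _ _ (dD i i_n _ (HJ s sc)) da.
apply: (is_derive_eq (derZ dc (rho ^+ i / rho ^+ n))).
by rewrite exprSr; ring.
Qed.

Lemma norm_sqr_le_inv2 (v : R * R * R) : `|v| ^+ 2 <= inv2 v.
Proof.
case: v => [[x y] z]; rewrite /inv2 /= !norm_pair.
have := max_norm_sqr (Num.max `|x| `|y|) z; rewrite ger0_norm ?le_max ?normr_ge0 //.
by move=> /le_trans; apply; rewrite lerD2r max_norm_sqr.
Qed.

Lemma inv2_eq0 (v : R * R * R) : inv2 v = 0 -> v = 0.
Proof.
move=> h; apply/normr0_eq0/eqP; rewrite -sqrf_eq0; apply/eqP/le_anti.
by rewrite sqr_ge0 andbT -h norm_sqr_le_inv2.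
Qed.

Lemma inv_scale (c : R) (v : R * R * R) :
  [/\ inv2 (c *: v) = c ^+ 2 * inv2 v, inv3 (c *: v) = c ^+ 3 * inv3 v,
      inv4 (c *: v) = c ^+ 4 * inv4 v, inv6a (c *: v) = c ^+ 6 * inv6a v &
      inv6b (c *: v) = c ^+ 6 * inv6b v].
Proof.
have H k := inv_homog (@tet_orbit_data R) k c v.
have := H ord0; have := H (inord 1); have := H (inord 2); have := H (inord 3).
have := H (inord 4).
by rewrite /tet_inv /tet_deg /= !inordK.
Qed.

Lemma inv4e_scale (c : R) (v : R * R * R) : inv4e (c *: v) = c ^+ 4 * inv4e v.
Proof.
have [h2 _ h4 _ _] := inv_scale c v.
by rewrite !inv4eE h2 h4; field.
Qed.

Lemma inv4e_le (v : R * R * R) : inv4e v <= inv2 v ^+ 2.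
Proof. by rewrite inv4eE; have := rnorm_ge0 (wa v) (wb v); rewrite -/(inv4 v); have := sqr_ge0 (inv2 v); lra. Qed.

Lemma inv_le (B : R) (v : R * R * R) : 1 <= B -> inv2 v <= B ->
  [/\ `|inv3 v| <= B ^+ 3, `|inv4 v| <= B ^+ 4, `|inv4e v| <= B ^+ 4,
      `|inv6a v| <= B ^+ 6 & `|inv6b v| <= B ^+ 6].
Proof.
move=> B1 h2; have h0 := inv2_ge0 v; have B0 : 0 <= B by lra.
have p n : inv2 v ^+ n <= B ^+ n by rewrite lerXn2r ?nnegrE.
have bp n : 1 <= B ^+ n by exact: exprn_ege1.
have bound (x : R) n : x ^+ 2 <= inv2 v ^+ n -> `|x| <= B ^+ n.
  move=> hx; apply: sqr_le_norm; first by have := bp n; lra.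
  apply: le_trans hx _; apply: le_trans (p n) _.
  by have := bp n; nra.
split; apply: bound.
- exact: inv3_le.
- rewrite (exprM _ 2 2) lerXn2r ?nnegrE ?exprn_even_ge0 ?inv4_le //; exact: rnorm_ge0.
- by rewrite (exprM _ 2 2) lerXn2r ?nnegrE ?exprn_even_ge0 ?inv4e_le ?inv4e_ge0.
- have := inv6_le v; have := sqr_ge0 (inv6b v); lra.
- have := inv6_le v; have := sqr_ge0 (inv6a v); have := sqr_ge0 (inv6b v); lra.
Qed.

Lemma regular_bounded n I (f : R -> R) (a b : R) : a <= b ->
  (forall s, a <= s <= b -> I s) -> regular n I f ->
  exists D, [/\ D 0%N = f, tower n [set s | a <= s <= b] D &
    exists2 M : R, 0 <= M & forall s, a <= s <= b -> `|D n s| <= M].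
Proof.
move=> ab abI [D [D0 dD cD]]; exists D; split=> //.
  by move=> i i_n s /= /abI; exact: dD.
by apply: (@continuous_bounded I) => // s /abI; exact: cD.
Qed.

(** The bound is uniform because the normalised curves obtained by rescaling at
    the scale of the distance to the origin have uniformly bounded invariants. *)
Lemma lift_derivative_bound (v : R -> R * R * R) I (t0 eta : R) : 0 < eta ->
  (forall s, t0 - 2 * eta <= s <= t0 + 2 * eta -> I s) ->
  regular 2 I (fun t => inv2 (v t)) -> regular 3 I (fun t => inv3 (v t)) ->
  regular 4 I (fun t => inv4 (v t)) -> regular 4 I (fun t => inv4e (v t)) ->
  regular 6 I (fun t => inv6a (v t)) -> regular 6 I (fun t => inv6b (v t)) ->
  exists C : R, forall t d, `|t - t0| < eta -> is_derive t 1 v d -> `|d| <= C.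
Proof.
move=> eta0 JI r2 r3 r4 r4e r6a r6b.
have ab : t0 - 2 * eta <= t0 + 2 * eta by lra.
have [P0 P00 HP] : exists2 M : R, 0 <= M &
    forall s, t0 - 2 * eta <= s <= t0 + 2 * eta -> `|inv2 (v s)| <= M.
  apply: (@continuous_bounded I) => // s /JI Is.
  by have [d] := regular_der (ltn0Sn _) r2 Is; exact: is_derive_continuous.
have [D2 [e2 d2 [M2 M20 h2]]] := regular_bounded ab JI r2.
have [D3 [e3 d3 [M3 M30 h3]]] := regular_bounded ab JI r3.
have [D4 [e4 d4 [M4 M40 h4]]] := regular_bounded ab JI r4.
have [De [ee de [Me Me0 he]]] := regular_bounded ab JI r4e.
have [Da [ea da [Ma Ma0 ha]]] := regular_bounded ab JI r6a.
have [Db [eb db [Mb Mb0 hb]]] := regular_bounded ab JI r6b.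
(* [P] bounds the distance to the origin, hence the scale, so that a rescaled
   interval of radius [c] stays in the given one. *)
pose P := P0 + 1.
pose c := eta / P.
have P1 : 1 <= P by rewrite /P; lra.
have c0 : 0 < c by rewrite divr_gt0 //; lra.
(* The bound for [inv2] on the rescaled interval given by Glaeser's inequality
   and Taylor's formula. *)
pose B := 2 + 2 * M2 * c ^+ 2.
have B1 : 1 <= B.
  have : 0 <= M2 * c ^+ 2 by apply: mulr_ge0 => //; exact: sqr_ge0.
  by rewrite /B; lra.
have Bn n : 0 <= B ^+ n by apply: exprn_ge0; lra.
have B0 : 0 <= B by lra.
have [A2 A20 H2] := interpolation_bdd 2 c0 B0 M20.
have [A3 A30 H3] := interpolation_bdd 3 c0 (Bn 3%N) M30.
have [A4 A40 H4] := interpolation_bdd 4 c0 (Bn 4%N) M40.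
have [Ae Ae0 He] := interpolation_bdd 4 c0 (Bn 4%N) Me0.
have [Aa Aa0 Ha] := interpolation_bdd 6 c0 (Bn 6%N) Ma0.
have [Ab Ab0 Hb] := interpolation_bdd 6 c0 (Bn 6%N) Mb0.
pose A := A2 + A3 + A4 + Ae + Aa + Ab.
have A0 : 0 <= A by rewrite /A !addr_ge0.
have [LA2 LA3 LA4] : [/\ A2 <= A, A3 <= A & A4 <= A].
  by rewrite /A; clear - A20 A30 A40 Ae0 Aa0 Ab0; split; lra.
have [LAe LAa LAb] : [/\ Ae <= A, Aa <= A & Ab <= A].
  by rewrite /A; clear - A20 A30 A40 Ae0 Aa0 Ab0; split; lra.
have [K K0 HK] := normalised_bound c0 A0.
exists (K + (M2 + 1)) => t d tt0 dv.
have in_J s : `|s| <= eta -> t0 - 2 * eta <= t + s <= t0 + 2 * eta.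
  by move: tt0; clear; rewrite ltr_norml ler_norml; lra.
have [Ht|Ht] := eqVneq (inv2 (v t)) 0.
  have vt := inv2_eq0 Ht.
  have inJ s : `|s - t| <= eta -> t0 - 2 * eta <= s <= t0 + 2 * eta.
    by move=> /in_J; have -> : t + (s - t) = s by ring.
  suff hd : `|d| <= M2 + 1 by apply: le_trans hd _; rewrite lerDr.
  apply: (norm_derive_le dv vt); apply/near_ballP; exists eta => // s /ltW st.
  have M21 : 0 <= M2 + 1 by rewrite addr_ge0.
  have dH s' : `|s' - t| <= eta -> is_derive s' 1 (fun s => inv2 (v s)) (D2 1%N s').
    by move=> /inJ; rewrite -e2; exact: (d2 0%N).
  have dH1 s' : `|s' - t| <= eta -> is_derive s' 1 (D2 1%N) (D2 2%N s').
    by move=> /inJ; exact: (d2 1%N).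
  have dH2 s' : `|s' - t| <= eta -> `|D2 2%N s'| <= M2 by move=> /inJ; exact: h2.
  have T := taylor2 dH dH1 dH2 st.
  have D1 : D2 1%N t = 0.
    apply/normr0_eq0/le_anti; rewrite normr_ge0 andbT.
    apply: (@le0_eps _ _ M2) => // e e0.
    pose h := Num.min e eta.
    have h0 : 0 < h by rewrite lt_min e0.
    have hh : h <= eta by rewrite ge_min lexx orbT.
    have := glaeser h0 (fun s hs => dH s (le_trans hs hh)) (fun s hs => dH1 s (le_trans hs hh))
      (fun s hs => dH2 s (le_trans hs hh)) (fun s _ => inv2_ge0 _).
    rewrite Ht mul0r add0r => /le_trans; apply; apply: ler_wpM2l => //.
    by rewrite ge_min lexx.
  rewrite -(@ler_pXn2r _ 2) ?nnegrE ?mulr_ge0 //.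
  apply: le_trans (norm_sqr_le_inv2 _) _.
  move: T; rewrite Ht D1 mulr0 !subr0 => /(le_trans (ler_norm _)) /le_trans; apply.
  rewrite exprMn real_normK ?num_real //; apply: ler_wpM2r; first exact: sqr_ge0.
  by clear - M20; nra.
have {}Ht : 0 < inv2 (v t) by rewrite lt_neqAle eq_sym Ht inv2_ge0.
pose rho := Num.sqrt (inv2 (v t)).
have rho0 : 0 < rho by rewrite sqrtr_gt0.
have rn0 : rho != 0 by rewrite gt_eqF.
have rho2 : rho ^+ 2 = inv2 (v t) by rewrite sqr_sqrtr // ltW.
have rhoP : rho <= P.
  rewrite -(@ler_pXn2r _ 2) ?nnegrE ?(ltW rho0) //; last exact: le_trans ler01 P1.
  rewrite rho2; have := HP t; rewrite ger0_norm ?inv2_ge0 // => Hp.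
  apply: (@le_trans _ _ P); last by clearbody P; clear - P1; nra.
  apply: le_trans (Hp _) _; last by rewrite /P lerDl.
  by have := in_J 0; rewrite normr0 addr0 ltW //; apply.
have cr : c * rho <= eta by rewrite /c mulrAC ler_pdivrMr; [rewrite ler_wpM2l // ltW|exact: lt_le_trans ltr01 P1].
have HJ s : `|s| <= c -> t0 - 2 * eta <= t + rho * s <= t0 + 2 * eta.
  move=> sc; apply: in_J; rewrite normrM gtr0_norm //.
  by apply: le_trans cr; rewrite mulrC; apply: ler_wpM2r => //; exact: ltW.
pose vv s := rho^-1 *: v (t + rho * s).
have dvv : is_derive (0 : R) 1 vv d.
  apply/is_derive_nearP => e e0; move/is_derive_nearP: dv => /(_ e e0) /near_ballP[r r00 Hr].
  apply/near_ballP; exists (r / rho) => [|s]; first by rewrite divr_gt0.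
  rewrite subr0 ltr_pdivlMr // => sr.
  have := Hr (t + rho * s); rewrite addrAC subrr add0r normrM gtr0_norm // mulrC => /(_ sr).
  rewrite /vv mulr0 addr0 -scalerBr.
  have -> : rho^-1 *: (v (t + rho * s) - v t) - s *: d =
     rho^-1 *: (v (t + rho * s) - v t - (rho * s) *: d).
    by rewrite [RHS]scalerBr scalerA mulKf.
  move=> h; rewrite normrZ normfV gtr0_norm // [_^-1 * _]mulrC ler_pdivrMr //.
  by rewrite -mulrA.
suff tv : tame c A vv d (rescaled 2 t rho D2) (rescaled 3 t rho D3) (rescaled 4 t rho D4)
    (rescaled 4 t rho De) (rescaled 6 t rho Da) (rescaled 6 t rho Db).
  by apply: le_trans (HK _ _ _ _ _ _ _ _ tv) _; rewrite lerDl addr_ge0.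
have top n (D : nat -> R -> R) (M : R) :
   (forall s, t0 - 2 * eta <= s <= t0 + 2 * eta -> `|D n s| <= M) ->
   forall s, `|s| <= c -> `|rescaled n t rho D n s| <= M.
  by move=> hD s /HJ Js; rewrite /rescaled divff ?expf_neq0 // mul1r hD.
have sc_inv s := inv_scale rho^-1 (v (t + rho * s)).
have E2 : rescaled 2 t rho D2 0%N = fun s => inv2 (vv s).
  apply/funext => s; rewrite /rescaled e2 /vv; have [-> _ _ _ _] := sc_inv s.
  by rewrite expr0 exprVn mul1r.
have E3 : rescaled 3 t rho D3 0%N = fun s => inv3 (vv s).
  apply/funext => s; rewrite /rescaled e3 /vv; have [_ -> _ _ _] := sc_inv s.
  by rewrite expr0 exprVn mul1r.
have E4 : rescaled 4 t rho D4 0%N = fun s => inv4 (vv s).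
  apply/funext => s; rewrite /rescaled e4 /vv; have [_ _ -> _ _] := sc_inv s.
  by rewrite expr0 exprVn mul1r.
have Ee : rescaled 4 t rho De 0%N = fun s => inv4e (vv s).
  by apply/funext => s; rewrite /rescaled ee /vv inv4e_scale expr0 exprVn mul1r.
have Ea : rescaled 6 t rho Da 0%N = fun s => inv6a (vv s).
  apply/funext => s; rewrite /rescaled ea /vv; have [_ _ _ -> _] := sc_inv s.
  by rewrite expr0 exprVn mul1r.
have Eb : rescaled 6 t rho Db 0%N = fun s => inv6b (vv s).
  apply/funext => s; rewrite /rescaled eb /vv; have [_ _ _ _ ->] := sc_inv s.
  by rewrite expr0 exprVn mul1r.
have n1 : inv2 (vv 0) = 1.
  rewrite /vv mulr0 addr0; have [-> _ _ _ _] := inv_scale rho^-1 (v t).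
  by rewrite -rho2 exprVn mulVf // expf_neq0.
have t2 := rescaled_tower HJ d2.
have Hle s : `|s| <= c -> inv2 (vv s) <= B.
  have sub (r : R) : `|r - 0| <= c -> `|r| <= c by rewrite subr0.
  have g1 := glaeser c0 (fun r h => t2 0%N isT r (sub r h)) (fun r h => t2 1%N isT r (sub r h))
    (fun r h => top 2%N D2 M2 h2 r (sub r h)).
  rewrite E2 n1 in g1; have {}g1 := g1 (fun r _ => inv2_ge0 _).
  move=> sc.
  have := taylor2 (fun r h => t2 0%N isT r (sub r h)) (fun r h => t2 1%N isT r (sub r h))
    (fun r h => top 2%N D2 M2 h2 r (sub r h)) (s := s).
  rewrite E2 n1 !subr0 => /(_ sc) /(le_trans (ler_norm _)) g2.
  have g3 : s * rescaled 2 t rho D2 1%N 0 <= c * (1 / c + M2 * c).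
    by apply: le_trans (ler_norm _) _; rewrite normrM; apply: ler_pM.
  have g4 : s ^+ 2 <= c ^+ 2.
    by rewrite -[s ^+ 2]real_normK ?num_real // lerXn2r ?nnegrE // ltW.
  have g5 := ler_wpM2l M20 g4.
  have g6 : c * (1 / c + M2 * c) = 1 + M2 * c ^+ 2 by field; rewrite gt_eqF.
  rewrite g6 in g3; rewrite /B; clear - g2 g3 g5; lra.
have le_inv s (sc : `|s| <= c) := inv_le B1 (Hle s sc).
have b2 : bdd_tower 2 c A2 (rescaled 2 t rho D2).
  apply: H2 => //; last exact: top h2.
  by move=> s sc; rewrite E2 ger0_norm ?inv2_ge0 ?Hle.
have b3 : bdd_tower 3 c A3 (rescaled 3 t rho D3).
  apply: H3 (rescaled_tower HJ d3) _ _; last exact: top h3.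
  by move=> s /le_inv[]; rewrite E3.
have b4 : bdd_tower 4 c A4 (rescaled 4 t rho D4).
  apply: H4 (rescaled_tower HJ d4) _ _; last exact: top h4.
  by move=> s /le_inv[]; rewrite E4.
have be : bdd_tower 4 c Ae (rescaled 4 t rho De).
  apply: He (rescaled_tower HJ de) _ _; last exact: top he.
  by move=> s /le_inv[]; rewrite Ee.
have ba : bdd_tower 6 c Aa (rescaled 6 t rho Da).
  apply: Ha (rescaled_tower HJ da) _ _; last exact: top ha.
  by move=> s /le_inv[]; rewrite Ea.
have bb : bdd_tower 6 c Ab (rescaled 6 t rho Db).
  apply: Hb (rescaled_tower HJ db) _ _; last exact: top hb.
  by move=> s /le_inv[]; rewrite Eb.
have up m n A' D : (m <= n)%N -> A' <= A -> bdd_tower n c A' D -> bdd_tower m c A D.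
  move=> mn AA [dD bD]; split; first exact: towerW dD.
  by move=> k km s sc; apply: le_trans AA; apply: bD => //; exact: leq_trans mn.
exact: (Tame dvv n1 (conj E2 (up 2 2 _ _ isT LA2 b2)) (conj E3 (up 2 3 _ _ isT LA3 b3))
  (conj E4 (up 2 4 _ _ isT LA4 b4)) (conj Ee (up 2 4 _ _ isT LAe be))
  (conj Ea (up 3 6 _ _ isT LAa ba)) (conj Eb (up 3 6 _ _ isT LAb bb)))%N.
Qed.

End Rescale.

(** * The rotations of a regular tetrahedron *)

Section InnerProduct.
Variables (R : realType) (n : nat).
Implicit Types u v : 'cV[R]_n.

Definition ip u v : R := (u^T *m v) 0 0.

Lemma ipE u v : ip u v = \sum_i u i 0 * v i 0.
Proof. by rewrite /ip mxE; apply: eq_bigr => i _; rewrite mxE. Qed.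

Lemma ipC u v : ip u v = ip v u.
Proof. by rewrite !ipE; apply: eq_bigr => i _; rewrite mulrC. Qed.

Lemma ipDr u v w : ip u (v + w) = ip u v + ip u w.
Proof. by rewrite /ip mulmxDr mxE. Qed.

Lemma ipDl u v w : ip (u + v) w = ip u w + ip v w.
Proof. by rewrite ipC ipDr !(ipC w). Qed.

Lemma ipZr u v a : ip u (a *: v) = a * ip u v.
Proof. by rewrite /ip -scalemxAr mxE. Qed.

Lemma ipZl u v a : ip (a *: u) v = a * ip u v.
Proof. by rewrite ipC ipZr ipC. Qed.

Lemma ipBr u v w : ip u (v - w) = ip u v - ip u w.
Proof. by rewrite -scaleN1r ipDr ipZr mulN1r. Qed.

Lemma ipBl u v w : ip (u - v) w = ip u w - ip v w.
Proof. by rewrite ipC ipBr !(ipC w). Qed.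

Lemma ip_sumr u (I : finType) (F : I -> 'cV[R]_n) : ip u (\sum_i F i) = \sum_i ip u (F i).
Proof. by rewrite /ip mulmx_sumr summxE. Qed.

Lemma ip_suml u (I : finType) (F : I -> 'cV[R]_n) : ip (\sum_i F i) u = \sum_i ip (F i) u.
Proof. by rewrite ipC ip_sumr; apply: eq_bigr => i _; rewrite ipC. Qed.

Lemma ip0r u : ip u 0 = 0.
Proof. by rewrite /ip mulmx0 mxE. Qed.

Lemma enorm_sqr u : enorm u ^+ 2 = ip u u.
Proof.
rewrite sqr_sqrtr ?ipE; first by apply: eq_bigr => i _; rewrite expr2.
by apply: sumr_ge0 => i _; rewrite sqr_ge0.
Qed.

Lemma ip_mul (A : 'M[R]_n) u v : A^T *m A = 1%:M -> ip (A *m u) (A *m v) = ip u v.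
Proof. by move=> AA; rewrite /ip trmx_mul mulmxA -(mulmxA u^T) AA mulmx1. Qed.

Lemma ip_mul_inv (A : 'M[R]_n) : (forall u v, ip (A *m u) (A *m v) = ip u v) ->
  A^T *m A = 1%:M.
Proof.
move=> H; apply/matrixP => i j.
transitivity (ip (A *m delta_mx i 0) (A *m delta_mx j 0)).
  by rewrite -!colE ipE mxE; apply: eq_bigr => k _; rewrite !mxE.
by rewrite H /ip trmx_delta mul_delta_mx_cond mulmxnE !mxE !eqxx.
Qed.

End InnerProduct.

Section Tetrahedron.
Variables (R : realType) (w : 'I_4 -> 'cV[R]_3).
Hypothesis hw : regular_tetrahedron w.

Lemma gram : exists2 r : R, 0 < r &
  forall i j, ip (w i) (w j) = if i == j then r else - r / 3.
Proof.
case: hw => -[l l0 hl] sw; exists (3 * l ^+ 2 / 8).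
  by rewrite divr_gt0 // mulr_gt0 // exprn_gt0.
pose g i j := ip (w i) (w j).
have gE i j : g i j = (g i i + g j j - l ^+ 2) / 2 + (i == j)%:R * (l ^+ 2 / 2).
  have [<-|ij] := eqVneq i j; first by rewrite mul1r; field.
  have : ip (w i - w j) (w i - w j) = l ^+ 2 by rewrite -enorm_sqr hl.
  by rewrite ipBl !ipBr (ipC (w j) (w i)) -!/(g _ _) => <-; rewrite mul0r; field.
have gsum i : \sum_j g i j = 0 by rewrite -ip_sumr sw ip0r.
pose S := \sum_j g j j.
have gii i : 4 * g i i + S = 3 * l ^+ 2.
  have := gsum i.
  under eq_bigr do rewrite gE.
  rewrite big_split /= -mulr_suml big_split /= big_split /= !sumr_const card_ord -/S.
  rewrite -[X in _ + X]mulr_suml (bigD1 i) //= eqxx big1 => [|j ji]; last first.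
    by rewrite eq_sym (negbTE ji).
  rewrite addr0 mul1r -[g i i *+ 4]mulr_natl -[(- l ^+ 2) *+ 4]mulr_natl; lra.
have S3 : S = 3 * l ^+ 2 / 2.
  have : \sum_(i < 4) (4 * g i i + S) = \sum_(i < 4) (3 * l ^+ 2) by apply: eq_bigr.
  rewrite big_split /= -mulr_sumr -/S !sumr_const card_ord -[S *+ 4]mulr_natl.
  by rewrite -[_ *+ 4]mulr_natl; lra.
have gr i : g i i = 3 * l ^+ 2 / 8 by have := gii i; rewrite S3; lra.
move=> i j; by rewrite -/(g i j) gE !gr; case: eqP => _ /=; field.
Qed.

Definition o0 : 'I_4 := @Ordinal 4 0 isT.
Definition o1 : 'I_4 := @Ordinal 4 1 isT.
Definition o2 : 'I_4 := @Ordinal 4 2 isT.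
Definition o3 : 'I_4 := @Ordinal 4 3 isT.

Lemma sum4 (V : nmodType) (F : 'I_4 -> V) : \sum_i F i = F o0 + (F o1 + (F o2 + F o3)).
Proof.
rewrite !big_ord_recl big_ord0 addr0.
by congr (F _ + (F _ + (F _ + F _))); apply: val_inj.
Qed.

Lemma sum_delta (i : 'I_4) (F : 'I_4 -> R) : \sum_j (i == j)%:R * F j = F i.
Proof.
rewrite (bigD1 i) //= eqxx mul1r big1 ?addr0 // => j ji.
by rewrite eq_sym (negbTE ji) mul0r.
Qed.

Lemma forall4 (P : 'I_4 -> Prop) : P o0 -> P o1 -> P o2 -> P o3 -> forall i, P i.
Proof.
move=> p0 p1 p2 p3 [[|[|[|[|//]]]] i4].
- by have -> : Ordinal i4 = o0 by exact: val_inj.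
- by have -> : Ordinal i4 = o1 by exact: val_inj.
- by have -> : Ordinal i4 = o2 by exact: val_inj.
- by have -> : Ordinal i4 = o3 by exact: val_inj.
Qed.

(** Orthonormal coordinates along the axes through the midpoints of opposite
    edges. *)
Definition radius2 : R := ip (w o0) (w o0).
Definition edge : R := Num.sqrt (4 * radius2 / 3).

Definition axis (i : 'I_4) : 'cV[R]_3 := edge^-1 *: (w o0 + w i).

Definition coords (v : 'cV[R]_3) : R * R * R :=
  (ip (axis o1) v, ip (axis o2) v, ip (axis o3) v).

Definition point (x : R * R * R) : 'cV[R]_3 :=
  x.1.1 *: axis o1 + x.1.2 *: axis o2 + x.2 *: axis o3.

Lemma gramE i j : ip (w i) (w j) = if i == j then radius2 else - radius2 / 3.
Proof. by have [r r0 H] := gram; rewrite /radius2 !H eqxx. Qed.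

Lemma radius2_gt0 : 0 < radius2.
Proof. by have [r r0 H] := gram; rewrite /radius2 H eqxx. Qed.

Lemma edge_gt0 : 0 < edge.
Proof. by rewrite sqrtr_gt0 divr_gt0 // mulr_gt0 // radius2_gt0. Qed.

Lemma edge2 : edge ^+ 2 = 4 * radius2 / 3.
Proof. by rewrite sqr_sqrtr // divr_ge0 // mulr_ge0 // ltW // radius2_gt0. Qed.

Lemma axis_ip i j : i != o0 -> j != o0 -> ip (axis i) (axis j) = (i == j)%:R.
Proof.
move=> i0 j0; have k0 := gt_eqF edge_gt0.
rewrite /axis ipZl ipZr !ipDl !ipDr !gramE eqxx (negbTE i0) eq_sym (negbTE j0).
rewrite mulrA -expr2 exprVn edge2; have r0 := gt_eqF radius2_gt0.
by case: eqP => _ /=; field; rewrite r0.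
Qed.

Lemma axis_vertex i j : ip (axis i) (w j) =
  edge^-1 * ((if o0 == j then radius2 else - radius2 / 3) +
             (if i == j then radius2 else - radius2 / 3)).
Proof. by rewrite /axis ipZl ipDl !gramE. Qed.

Lemma pointK x : coords (point x) = x.
Proof.
have e i : i != o0 -> ip (axis i) (point x) =
    x.1.1 * (i == o1)%:R + x.1.2 * (i == o2)%:R + x.2 * (i == o3)%:R.
  move=> i0; rewrite /point !ipDr (ipZr _ _ x.1.1) (ipZr _ _ x.1.2) (ipZr _ _ x.2).
  by rewrite !axis_ip.
case: x e => [[x y] z] e; rewrite /coords !e //=.
by congr (_, _, _); ring.
Qed.

Lemma coordsK v : point (coords v) = v.
Proof.
pose Q : 'M[R]_3 := \matrix_(i, k) axis (lift ord0 k) i 0.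
have QQ : Q^T *m Q = 1%:M.
  apply/matrixP => i j; rewrite !mxE.
  have <- : (lift ord0 i == lift ord0 j :> 'I_4) = (i == j) by exact: (inj_eq lift_inj).
  rewrite -axis_ip //.
  by rewrite ipE; apply: eq_bigr => k _; rewrite !mxE.
have {}QQ := mulmx1C QQ.
rewrite -[RHS]mul1mx -QQ -mulmxA; apply/matrixP => i j.
rewrite (ord1 j) [RHS]mxE !big_ord_recl big_ord0 addr0 addrA.
have e (k : 'I_3) : (Q^T *m v) k 0 = ip (axis (lift ord0 k)) v.
  by rewrite ipE mxE; apply: eq_bigr => m _; rewrite !mxE.
rewrite !e !mxE /=.
have -> : lift ord0 (ord0 : 'I_3) = o1 by exact: val_inj.
have -> : lift ord0 (lift ord0 (ord0 : 'I_2)) = o2 by exact: val_inj.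
have -> : lift ord0 (lift ord0 (lift ord0 (ord0 : 'I_1))) = o3 by exact: val_inj.
by congr (_ + _ + _); rewrite mulrC.
Qed.

Definition dot (x y : R * R * R) : R := x.1.1 * y.1.1 + x.1.2 * y.1.2 + x.2 * y.2.

Lemma ip_coords u v : ip u v = dot (coords u) (coords v).
Proof. rewrite -{1}(coordsK u) /point !ipDl.
by rewrite (ipZl _ _ (coords u).1.1) (ipZl _ _ (coords u).1.2) (ipZl _ _ (coords u).2). Qed.

Lemma coords_vertex : [/\ coords (w o0) = (edge / 2, edge / 2, edge / 2),
  coords (w o1) = (edge / 2, - edge / 2, - edge / 2),
  coords (w o2) = (- edge / 2, edge / 2, - edge / 2) &
  coords (w o3) = (- edge / 2, - edge / 2, edge / 2)].
Proof.
have k0 := gt_eqF edge_gt0.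
have h1 : edge^-1 * (radius2 + - radius2 / 3) = edge / 2.
  have -> : radius2 = 3 / 4 * edge ^+ 2 by rewrite edge2; field.
  by field; rewrite k0.
have h2 : edge^-1 * (- radius2 / 3 + radius2) = edge / 2 by rewrite addrC h1.
have h3 : edge^-1 * (- radius2 / 3 + - radius2 / 3) = - edge / 2.
  have -> : radius2 = 3 / 4 * edge ^+ 2 by rewrite edge2; field.
  by field; rewrite k0.
by rewrite /coords !axis_vertex /= h1 h2 h3.
Qed.

Lemma w_inj : injective w.
Proof.
move=> i j ij; apply/eqP; apply: contraT => neq.
have := gramE i j; rewrite (negbTE neq) ij gramE eqxx.
by have := radius2_gt0; lra.
Qed.

(** ** Matrices of orthogonal maps in these coordinates *)

Record isometry (g : R * R * R -> R * R * R) : Prop := Isometry {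
  iso_linear : forall c u v, g (c *: u + v) = c *: g u + g v;
  iso_dot : forall u v, dot (g u) (g v) = dot u v
}.

Definition mat (g : R * R * R -> R * R * R) : 'M[R]_3 :=
  point (g (1, 0, 0)) *m (axis o1)^T + point (g (0, 1, 0)) *m (axis o2)^T +
  point (g (0, 0, 1)) *m (axis o3)^T.

Lemma point_linear c x y : point (c *: x + y) = c *: point x + point y.
Proof.
have e (a b d : R) (u : 'cV[R]_3) : (a * b + d) *: u = a *: (b *: u) + d *: u.
  by rewrite scalerDl scalerA.
rewrite /point (e c x.1.1) (e c x.1.2) (e c x.2).
by rewrite [X in X + _ = _]addrACA [LHS]addrACA -!scalerDr.
Qed.

Lemma matE g v : isometry g -> mat g *m v = point (g (coords v)).
Proof.
move=> ig; rewrite /mat 2!mulmxDl -!mulmxA.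
have e (u : 'cV[R]_3) (a : 'cV[R]_3) : u *m (a^T *m v) = ip a v *: u.
  by rewrite [a^T *m v]mx11_scalar mul_mx_scalar.
rewrite !e.
have -> : coords v = ip (axis o1) v *: (1, 0, 0) + (ip (axis o2) v *: (0, 1, 0) +
    (ip (axis o3) v *: (0, 0, 1) + 0)).
  by rewrite /coords; congr (_, _, _); rewrite /= /GRing.scale /=; ring.
have g0 : g 0 = 0.
  have := iso_linear ig (-1) 0 0; rewrite scaler0 addr0 => h.
  by rewrite h scaleN1r addNr.
have p0 : point 0 = 0 by rewrite /point !scale0r !addr0.
by rewrite !(iso_linear ig) g0 !point_linear p0 addr0 [RHS]addrA.
Qed.

Lemma mat_orth g : isometry g -> (mat g)^T *m mat g = 1%:M.
Proof.
move=> ig; apply: ip_mul_inv => u v.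
by rewrite !matE // ip_coords !pointK (iso_dot ig) -ip_coords.
Qed.

Lemma det_orth (A : 'M[R]_3) : A^T *m A = 1%:M -> \det A ^+ 2 = 1.
Proof. by move/(congr1 determinant); rewrite det_mulmx det_tr det1 expr2. Qed.

Lemma mx_ext (A B : 'M[R]_3) : (forall v : 'cV_3, A *m v = B *m v) -> A = B.
Proof.
move=> H; apply/matrixP => i j; have := H (delta_mx j 0); rewrite -!colE.
by move=> /matrixP/(_ i 0); rewrite !mxE.
Qed.

(** ** The rotation group *)

Lemma hull_perm (A : 'M[R]_3) (s : {perm 'I_4}) : (forall i, A *m w i = w (s i)) ->
  (fun x => A *m x) @` tetrahedron w = tetrahedron w.
Proof.
move=> As; apply/seteqP; split=> [_ [x [a [a0 a1 ->]] <-]|x [a [a0 a1 ->]]].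
  exists (fun i => a (s^-1%g i)); split=> //.
    by rewrite (reindex_inj (@perm_inj _ s)) -[RHS]a1; apply: eq_bigr => i _; rewrite permK.
  rewrite mulmx_sumr (reindex_inj (@perm_inj _ s^-1)); apply: eq_bigr => i _.
  by rewrite -scalemxAr As permKV.
exists (\sum_i a (s i) *: w i).
  exists (fun i => a (s i)); split=> //.
  by rewrite -[RHS]a1 [RHS](reindex_inj (@perm_inj _ s)).
rewrite mulmx_sumr [RHS](reindex_inj (@perm_inj _ s)); apply: eq_bigr => i _.
by rewrite -scalemxAr As.
Qed.

Lemma vertex_perm (A : 'M[R]_3) : A^T *m A = 1%:M -> (forall i, exists j, A *m w i = w j) ->
  exists s : {perm 'I_4}, forall i, A *m w i = w (s i).
Proof.
move=> AA /choice[f Hf].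
have f_inj : injective f.
  move=> i j fij; apply: w_inj; rewrite -[w i]mul1mx -[w j]mul1mx -AA -!mulmxA !Hf.
  by rewrite fij.
by exists (perm f_inj) => i; rewrite permE.
Qed.

(** The vertices are the points of the tetrahedron of maximal norm. *)
Lemma tetrahedron_max (x : 'cV[R]_3) : tetrahedron w x -> ip x x = radius2 ->
  exists j, x = w j.
Proof.
move=> [a [a0 a1 ->]] hx.
have r0 := radius2_gt0.
have sq : \sum_i a i ^+ 2 = 1.
  have E : ip (\sum_i a i *: w i) (\sum_i a i *: w i) =
      4 / 3 * radius2 * (\sum_i a i ^+ 2) - radius2 / 3 * (\sum_i a i) ^+ 2.
    rewrite expr2 mulrA [in RHS]mulr_sumr [in X in _ - X]mulr_sumr -sumrB ip_suml.
    apply: eq_bigr => i _; rewrite ipZl ip_sumr.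
    rewrite (eq_bigr (fun j => (i == j)%:R * (4 / 3 * radius2 * a j) - radius2 / 3 * a j)).
      by rewrite sumrB sum_delta -mulr_sumr; ring.
    by move=> j _; rewrite ipZr gramE; case: eqP => _; rewrite ?mul1r ?mul0r; field.
  move: hx; rewrite E a1 expr1n => hx.
  have : 4 / 3 * radius2 * (\sum_i a i ^+ 2 - 1) = 0 by lra.
  by move/eqP; rewrite mulf_eq0 gt_eqF ?mulr_gt0 //= subr_eq0 => /eqP.
have a_le1 i : a i <= 1 by rewrite -a1 (bigD1 i) //= lerDl sumr_ge0.
have a01 i : a i = 0 \/ a i = 1.
  have : \sum_i (a i - a i ^+ 2) = 0 by rewrite sumrB a1 sq subrr.
  move/psumr_eq0P => /(_ _ i isT) h; have : a i * (1 - a i) = 0.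
    rewrite -[RHS]h; first by ring.
    by move=> j _; have := a0 j; have := a_le1 j; nra.
  by move/eqP; rewrite mulf_eq0 subr_eq0 => /orP[]/eqP; [left|right].
have [j aj] : exists j, a j = 1.
  apply: contrapT => no; move: a1; rewrite big1; first by move/eqP; rewrite eq_sym oner_eq0.
  by move=> i _; case: (a01 i) => // ai; case: no; exists i.
exists j; rewrite (bigD1 j) //= aj scale1r big1 ?addr0 // => i ij.
have [-> |ai] := a01 i; first by rewrite scale0r.
exfalso; move: a1; rewrite (bigD1 j) //= aj (bigD1 i) //= ai.
have : 0 <= \sum_(k < 4 | (k != j) && (k != i)) a k by apply: sumr_ge0.
by move: (\sum_(_ | _) _) => y; lra.
Qed.

Lemma rotation_perm (A : 'M[R]_3) : rotation_group (tetrahedron w) A ->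
  A^T *m A = 1%:M /\ exists s : {perm 'I_4}, forall i, A *m w i = w (s i).
Proof.
move=> [AA dA hA]; have {}AA := mulmx1C AA; split=> //.
apply: vertex_perm => // i; apply: tetrahedron_max.
  rewrite -hA; exists (w i) => //; exists (fun j => (i == j)%:R); split=> //.
  - by rewrite (bigD1 i) //= eqxx big1 ?addr0 // => j ji; rewrite eq_sym (negbTE ji).
  - rewrite (bigD1 i) //= eqxx scale1r big1 ?addr0 // => j ji.
    by rewrite eq_sym (negbTE ji) scale0r.
by rewrite ip_mul // gramE eqxx.
Qed.

(** Adding a row of equal entries to the matrix of the vertices gives an
    invertible matrix of order four on which [A] acts by a permutation of the
    columns; comparing determinants gives the sign of the permutation. *)
Lemma perm_sign (A : 'M[R]_3) (s : {perm 'I_4}) : (forall i, A *m w i = w (s i)) ->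
  \det A = (-1) ^+ s.
Proof.
move=> As; pose W : 'M[R]_(3, 4) := \matrix_(i, j) w j i 0.
pose t := edge / 2.
pose M : 'M[R]_(3 + 1) := col_mx W (const_mx t : 'rV_4).
have t2 : t ^+ 2 = radius2 / 3 by rewrite /t expr_div_n edge2; field.
have MM : M^T *m M = (4 * radius2 / 3)%:M.
  apply/matrixP => i j; rewrite /M tr_col_mx mul_row_col !mxE big_ord1 !mxE -expr2 t2.
  have -> : \sum_k W^T i k * W k j = ip (w i) (w j).
    by rewrite ipE; apply: eq_bigr => k _; rewrite !mxE.
  by rewrite gramE; case: eqP => _; rewrite ?mulr1n ?mulr0n; field.
have M0 : \det M != 0.
  have := congr1 determinant MM; rewrite det_mulmx det_tr det_scalar => dM.
  apply/eqP => M0; move: dM; rewrite M0 mul0r => /esym/eqP.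
  by rewrite expf_eq0 /= gt_eqF // divr_gt0 // mulr_gt0 // radius2_gt0.
have AM : block_mx A 0 0 (1%:M : 'M[R]_1) *m M = col_perm s M.
  apply/matrixP => i j; rewrite mul_block_col !mul0mx addr0 add0r mul1mx.
  rewrite [RHS]mxE; case: (split_ordP i) => k ->{i}.
    rewrite !col_mxEu !mxE -[RHS]/((w (s j)) k 0) -As mxE.
    by apply: eq_bigr => m _; rewrite !mxE.
  by rewrite !col_mxEd !mxE.
have := congr1 determinant AM; rewrite det_mulmx det_ublock det1 mulr1.
rewrite col_permE det_mulmx det_perm odd_permV mulrC => /(mulfI M0) //.
Qed.

Lemma mat_rotation g : isometry g -> \det (mat g) = 1 ->
  (forall i, exists j, g (coords (w i)) = coords (w j)) ->
  rotation_group (tetrahedron w) (mat g).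
Proof.
move=> ig dg Hg; have AA := mat_orth ig.
have [i|s Hs] := vertex_perm AA.
  by have [j Hj] := Hg i; exists j; rewrite matE // Hj coordsK.
by split=> //; [exact: mulmx1C|exact: hull_perm Hs].
Qed.

(** The determinant of an orthogonal map is [1] or [-1], so that of its square is [1]. *)
Lemma det_square g h : isometry g -> isometry h -> (forall v, g v = h (h v)) ->
  \det (mat g) = 1.
Proof.
move=> ig ih gh; have -> : mat g = mat h *m mat h.
  by apply: mx_ext => v; rewrite -mulmxA !matE // pointK gh.
by rewrite det_mulmx -expr2 det_orth // mat_orth.
Qed.

Lemma cyc_isometry : isometry (@cyc R).
Proof. by split=> // u v; rewrite /dot /cyc /=; ring. Qed.

Lemma flip_isometry s : isometry (@flip R s).
Proof.
split=> [c u v|u v].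
  by rewrite /flip /=; congr (_, _, _); rewrite /= /GRing.scale /=; ring.
by case: s => -[] []; rewrite /dot /flip /= ?expr0 ?expr1; ring.
Qed.

Lemma rotation_cyc : rotation_group (tetrahedron w) (mat (@cyc R)).
Proof.
have ic := cyc_isometry; have [c0 c1 c2 c3] := coords_vertex.
apply: mat_rotation => //.
  have c3E : mat (@cyc R) *m (mat (@cyc R) *m mat (@cyc R)) = 1%:M.
    apply: mx_ext => v; rewrite -!mulmxA !matE // !pointK mul1mx -[RHS]coordsK.
    by case: (coords v) => -[].
  have := congr1 determinant c3E; rewrite !det_mulmx det1 -expr2 det_orth ?mulr1 //.
  exact: mat_orth.
by apply: forall4; [exists o0|exists o3|exists o1|exists o2]; rewrite ?c0 ?c1 ?c2 ?c3.
Qed.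

(** Sign changes are squares of quarter turns. *)
Lemma rotation_flip s : rotation_group (tetrahedron w) (mat (@flip R s)).
Proof.
have ig := flip_isometry s; have [c0 c1 c2 c3] := coords_vertex.
apply: mat_rotation => //.
  pose q1 (v : R * R * R) := (v.1.1, - v.2, v.1.2).
  pose q2 (v : R * R * R) := (v.2, v.1.2, - v.1.1).
  pose q3 (v : R * R * R) := (- v.1.2, v.1.1, v.2).
  have i1 : isometry q1.
    split=> [c u v|u v]; last by rewrite /dot /q1 /=; ring.
    by rewrite /q1 /=; congr (_, _, _); rewrite /= /GRing.scale /=; ring.
  have i2 : isometry q2.
    split=> [c u v|u v]; last by rewrite /dot /q2 /=; ring.
    by rewrite /q2 /=; congr (_, _, _); rewrite /= /GRing.scale /=; ring.
  have i3 : isometry q3.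
    split=> [c u v|u v]; last by rewrite /dot /q3 /=; ring.
    by rewrite /q3 /=; congr (_, _, _); rewrite /= /GRing.scale /=; ring.
  have i4 : isometry (fun v => v) by [].
  case: s ig => -[] [] ig.
  - apply: (det_square ig i3) => -[[x y] z].
    by rewrite /flip /q3 /= expr0 expr1; congr (_, _, _); ring.
  - apply: (det_square ig i2) => -[[x y] z].
    by rewrite /flip /q2 /= expr0 expr1; congr (_, _, _); ring.
  - apply: (det_square ig i1) => -[[x y] z].
    by rewrite /flip /q1 /= expr0 expr1; congr (_, _, _); ring.
  - apply: (det_square ig i4) => -[[x y] z].
    by rewrite /flip /= expr0; congr (_, _, _); ring.
have h (a b : bool) : exists j, coords (w j) =
    ((-1) ^+ a * (edge / 2), (-1) ^+ b * (edge / 2), (-1) ^+ (a (+) b) * (edge / 2)).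
  by case: a; case: b; [exists o3|exists o2|exists o1|exists o0];
    rewrite ?c0 ?c1 ?c2 ?c3 /= ?expr0 ?expr1; congr (_, _, _); ring.
case: s {ig} => a b.
have sg (u v : bool) (x : R) : (-1) ^+ u * ((-1) ^+ v * x) = (-1) ^+ (u (+) v) * x.
  by rewrite mulrA signr_addb.
have vert i : exists c d : bool, coords (w i) =
    ((-1) ^+ c * (edge / 2), (-1) ^+ d * (edge / 2), (-1) ^+ (c (+) d) * (edge / 2)).
  move: i; apply: forall4; [exists false, false|exists false, true|exists true, false
    |exists true, true]; rewrite ?c0 ?c1 ?c2 ?c3 /= ?expr0 ?expr1; congr (_, _, _); ring.
move=> i; have [c [d ->]] := vert i; rewrite /flip /= !sg addbACA.
by have [j <-] := h (a (+) c) (b (+) d); exists j.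
Qed.

(** The invariants in these coordinates are invariant under all rotations: they
    are symmetric functions of the inner products with the vertices, or their
    Vandermonde determinant. *)
Lemma rotation_inv A : rotation_group (tetrahedron w) A ->
  forall v k, tet_inv k (coords (A *m v)) = tet_inv k (coords v).
Proof.
move=> GA v; have [AA [s As]] := rotation_perm GA.
have [_ dA _] := GA.
have m_s i : ip (w (s i)) (A *m v) = ip (w i) v by rewrite -As ip_mul.
have even : (-1) ^+ s = 1 :> R by rewrite -(perm_sign As).
have pow n : \sum_i ip (w i) (A *m v) ^+ n = \sum_i ip (w i) v ^+ n.
  by rewrite (reindex_inj (@perm_inj _ s)); apply: eq_bigr => i _; rewrite m_s.
have vdm : \det (Vandermonde 4 (\row_i ip (w i) (A *m v))) =
           \det (Vandermonde 4 (\row_i ip (w i) v)).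
  have -> : Vandermonde 4 (\row_i ip (w i) v) =
      col_perm s (Vandermonde 4 (\row_i ip (w i) (A *m v))).
    by apply/matrixP => i j; rewrite !mxE m_s.
  by rewrite col_permE det_mulmx det_perm odd_permV even mulr1.
have [c0 c1 c2 c3] := coords_vertex.
have form0 u : ip (w o0) u = edge / 2 * ((coords u).1.1 + (coords u).1.2 + (coords u).2).
  by rewrite ip_coords c0 /dot /=; ring.
have form1 u : ip (w o1) u = edge / 2 * ((coords u).1.1 - (coords u).1.2 - (coords u).2).
  by rewrite ip_coords c1 /dot /=; ring.
have form2 u : ip (w o2) u = edge / 2 * (- (coords u).1.1 + (coords u).1.2 - (coords u).2).
  by rewrite ip_coords c2 /dot /=; ring.
have form3 u : ip (w o3) u = edge / 2 * (- (coords u).1.1 - (coords u).1.2 + (coords u).2).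
  by rewrite ip_coords c3 /dot /=; ring.
have e0 : edge != 0 by rewrite gt_eqF // edge_gt0.
have powE u n : \sum_i ip (w i) u ^+ n = (edge / 2) ^+ n *
    (((coords u).1.1 + (coords u).1.2 + (coords u).2) ^+ n +
     (((coords u).1.1 - (coords u).1.2 - (coords u).2) ^+ n +
      ((- (coords u).1.1 + (coords u).1.2 - (coords u).2) ^+ n +
       (- (coords u).1.1 - (coords u).1.2 + (coords u).2) ^+ n))).
  by rewrite sum4 form0 form1 form2 form3 !exprMn -!mulrDr.
have e2 n : (edge / 2) ^+ n != 0 by rewrite expf_neq0 // mulf_neq0 // invr_eq0 pnatr_eq0.
have pow' n : _ := mulfI (e2 n) (etrans (esym (powE (A *m v) n)) (etrans (pow n) (powE v n))).
have vdmE u : \det (Vandermonde 4 (\row_i ip (w i) u)) = edge ^+ 6 * (2 / 3) * inv6b (coords u).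
  have prod4 (F : 'I_4 -> R) : \prod_i F i = F o0 * (F o1 * (F o2 * F o3)).
    rewrite !big_ord_recl big_ord0 mulr1.
    by congr (F _ * (F _ * (F _ * F _))); apply: val_inj.
  rewrite det_Vandermonde; under eq_bigr do rewrite big_mkcond.
  rewrite !prod4 !mxE /= form0 form1 form2 form3 inv6bE.
  by move: (edge) (coords u) => e [[x y] z] /=; field.
have h6b : inv6b (coords (A *m v)) = inv6b (coords v).
  have := vdm; rewrite !vdmE; apply: mulfI.
  by rewrite mulf_neq0 ?expf_neq0 // mulf_neq0 // invr_eq0 pnatr_eq0.
have H2 x : inv2 x = ((x.1.1 + x.1.2 + x.2) ^+ 2 + ((x.1.1 - x.1.2 - x.2) ^+ 2 +
    ((- x.1.1 + x.1.2 - x.2) ^+ 2 + (- x.1.1 - x.1.2 + x.2) ^+ 2))) / 4 :> R.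
  by rewrite /inv2; field.
have H3 x : inv3 x = ((x.1.1 + x.1.2 + x.2) ^+ 3 + ((x.1.1 - x.1.2 - x.2) ^+ 3 +
    ((- x.1.1 + x.1.2 - x.2) ^+ 3 + (- x.1.1 - x.1.2 + x.2) ^+ 3))) / 24 :> R.
  by rewrite /inv3; field.
have H4 x : inv4e x = ((x.1.1 + x.1.2 + x.2) ^+ 4 + ((x.1.1 - x.1.2 - x.2) ^+ 4 +
    ((- x.1.1 + x.1.2 - x.2) ^+ 4 + (- x.1.1 - x.1.2 + x.2) ^+ 4))) / 16
     - inv2 x ^+ 2 / 4 :> R.
  by rewrite /inv4e /inv2; field.
have H4' x : inv4 x = inv2 x ^+ 2 - 3 * inv4e x :> R by rewrite inv4eE; field.
have H6 x : inv6a x = inv2 x ^+ 3 - 9 / 2 * inv2 x * inv4e x + 27 / 2 * inv3 x ^+ 2 :> R.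
  by rewrite /inv6a /rcube1 /wa /wb /inv2 /inv4e /inv3; field.
have h2 : inv2 (coords (A *m v)) = inv2 (coords v) by rewrite H2 pow' -H2.
have h3 : inv3 (coords (A *m v)) = inv3 (coords v) by rewrite H3 pow' -H3.
have h4 : inv4e (coords (A *m v)) = inv4e (coords v) by rewrite H4 pow' h2 -H4.
apply/tet_invP; split=> //.
- by rewrite !H4' h2 h4.
- by rewrite !H6 h2 h3 h4.
Qed.

End Tetrahedron.

(** * Curves in the orbit space *)

Section Polynomial.
Variables (R : realType) (n : nat).
Implicit Types f g : 'cV[R]_n -> R.

Definition polynomial_map f := exists p : mpoly n R, forall v, peval p v = f v.

Lemma polynomial_cst (c : R) : polynomial_map (fun=> c).
Proof. by exists (mpolyC n c) => v; exact: mevalC. Qed.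

Lemma polynomialD f g : polynomial_map f -> polynomial_map g ->
  polynomial_map (fun v => f v + g v).
Proof. by move=> [p Hp] [q Hq]; exists (p + q) => v; rewrite /peval mevalD -Hp -Hq. Qed.

Lemma polynomialM f g : polynomial_map f -> polynomial_map g ->
  polynomial_map (fun v => f v * g v).
Proof. by move=> [p Hp] [q Hq]; exists (p * q) => v; rewrite /peval mevalM -Hp -Hq. Qed.

Lemma polynomialB f g : polynomial_map f -> polynomial_map g ->
  polynomial_map (fun v => f v - g v).
Proof. by move=> [p Hp] [q Hq]; exists (p - q) => v; rewrite /peval mevalB -Hp -Hq. Qed.

Lemma polynomialX f k : polynomial_map f -> polynomial_map (fun v => f v ^+ k).
Proof.
move=> Hf; elim: k => [|k IH]; first exact: polynomial_cst.
by under eq_fun do rewrite exprS; exact: polynomialM.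
Qed.

Lemma polynomial_ip (a : 'cV[R]_n) : polynomial_map (ip a).
Proof.
exists (\sum_i a i 0 *: mpolyX R (mnm1 i)) => v; rewrite /peval raddf_sum ipE.
by apply: eq_bigr => i _; rewrite /= mevalZ mevalXU.
Qed.

End Polynomial.

Section OrbitCurve.
Variable R : realType.
Implicit Types I : set R.

Lemma class_C_entry (m k : nat) I (c : R -> 'cV[R]_m) (j : 'I_m) :
  class_C k I c -> regular k I (fun t => c t j 0).
Proof.
move=> [dc cc]; exists (fun i t => (c^`(i))%classic t j 0); split=> //.
  move=> i ik t It; have di := dc i ik t It.
  have /derivable_mxP/(_ j 0) dj := di; split=> //.
  by rewrite derive1nS derive1E derive_mx // mxE.
move=> t It; apply: (@cvg_comp _ _ _ _ (fun M : 'cV[R]_m => M j 0)); first exact: cc It.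
exact: coord_continuous.
Qed.

Lemma regular_meval (m k : nat) I (c : R -> 'cV[R]_m) (q : mpoly m R) :
  class_C k I c -> regular k I (fun t => meval (fun j => c t j 0) q).
Proof.
move=> Hc; under eq_fun do rewrite mevalE.
have rsum (T : Type) (r : seq T) (F : T -> R -> R) : (forall x, regular k I (F x)) ->
    regular k I (fun t => \sum_(x <- r) F x t).
  move=> HF; elim: r => [|x r IH]; first by under eq_fun do rewrite big_nil; exact: regular_cst.
  by under eq_fun do rewrite big_cons; exact: regularD.
have rprod (T : Type) (r : seq T) (F : T -> R -> R) : (forall x, regular k I (F x)) ->
    regular k I (fun t => \prod_(x <- r) F x t).
  move=> HF; elim: r => [|x r IH]; first by under eq_fun do rewrite big_nil; exact: regular_cst.
  by under eq_fun do rewrite big_cons; exact: regularM.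
apply: rsum => e; apply: regularM; first exact: regular_cst.
apply: rprod => j; elim: (e j) => [|d IH]; first exact: regular_cst.
by under eq_fun do rewrite exprS; apply: regularM => //; exact: class_C_entry.
Qed.

(** An invariant polynomial is a polynomial in the generators. *)
Lemma regular_invariant (n m k : nat) (G : set 'M[R]_n) (sigma : m.-tuple (mpoly n R)) I
    (c : R -> 'cV[R]_m) (v : R -> 'cV[R]_n) (f : 'cV[R]_n -> R) :
  homogeneous_generators G sigma -> near_open I -> class_C k I c ->
  (forall t, I t -> orbit_map sigma (v t) = c t) -> polynomial_map f ->
  (forall A, G A -> forall x, f (A *m x) = f x) -> regular k I (fun t => f (v t)).
Proof.
move=> [_ _ gen] oI Hc Hv [p Hp] Hf.
have [|q pq] := gen p; first by move=> A GA x; rewrite !Hp Hf.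
apply: (near_open_regular_ext oI _ (regular_meval q Hc)) => t It.
rewrite -Hp pq /peval comp_mpoly_meval; apply: meval_eq => j.
by rewrite -Hv // mxE.
Qed.

End OrbitCurve.

Section Main.
Variables (R : realType) (w : 'I_4 -> 'cV[R]_3).
Hypothesis hw : regular_tetrahedron w.

Local Notation G := (rotation_group (tetrahedron w)).

Lemma polynomial_inv (k : 'I_5) : polynomial_map (fun v => tet_inv k (coords w v)).
Proof.
pose P := @polynomial_map R 3.
have p1 : P (fun v => (coords w v).1.1) by exact: polynomial_ip.
have p2 : P (fun v => (coords w v).1.2) by exact: polynomial_ip.
have p3 : P (fun v => (coords w v).2) by exact: polynomial_ip.
have pa : P (fun v => wa (coords w v)).
  apply: polynomialB; first exact: polynomialX.
  by apply: polynomialM; [apply: polynomialD|exact: polynomial_cst]; exact: polynomialX.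
have pb : P (fun v => wb (coords w v)).
  by apply: polynomialM; [apply: polynomialB|exact: polynomial_cst]; exact: polynomialX.
case: k => -[|[|[|[|[|//]]]]] k5; rewrite /tet_inv /=.
- by apply: polynomialD; [apply: polynomialD|]; exact: polynomialX.
- by apply: polynomialM => //; exact: polynomialM.
- apply: polynomialD; first exact: polynomialX.
  by apply: polynomialM; [exact: polynomial_cst|exact: polynomialX].
- apply: polynomialB; first exact: polynomialX.
  apply: polynomialM; last exact: polynomialX.
  by apply: polynomialM => //; exact: polynomial_cst.
- apply: polynomialB; apply: polynomialM => //; last exact: polynomialX.
    by apply: polynomialM; [exact: polynomial_cst|exact: polynomialX].
  exact: polynomial_cst.
Qed.

(** The maps [tet_act g] are rotations, so the generators do not distinguish a vector
    from its image. *)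
Lemma orbit_map_act (m : nat) (sigma : m.-tuple (mpoly 3 R)) g (x : R * R * R) :
  homogeneous_generators G sigma ->
  orbit_map sigma (point w (tet_act g x)) = orbit_map sigma (point w x).
Proof.
move=> [inv _ _].
have step A v : G A -> orbit_map sigma (A *m v) = orbit_map sigma v.
  by move=> GA; apply/matrixP => i j; rewrite !mxE inv.
rewrite /tet_act.
have -> : point w (flip g.2 (iter g.1 (@cyc R) x)) = mat w (flip g.2) *m point w (iter g.1 (@cyc R) x).
  by rewrite matE ?(pointK hw) //; exact: flip_isometry.
rewrite step; last exact: rotation_flip.
elim: (nat_of_ord g.1) => //= d IH.
have -> : point w (cyc (iter d (@cyc R) x)) = mat w (@cyc R) *m point w (iter d (@cyc R) x).
  by rewrite matE ?(pointK hw) //; exact: cyc_isometry.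
by rewrite step //; exact: rotation_cyc.
Qed.

Lemma enorm_point (x : R * R * R) : enorm (point w x) ^+ 2 = inv2 x.
Proof. by rewrite enorm_sqr (ip_coords hw) (pointK hw) /dot /inv2 !expr2. Qed.

Lemma der_point (u : R -> R * R * R) (t : R) d : is_derive t 1 u d ->
  is_derive t 1 (fun s => point w (u s)) (point w d).
Proof.
move=> du; have d12 := der_fst du; have d3 := der_snd du.
have d1 := der_fst d12; have d2 := der_snd d12.
have de i j : is_derive t 1 (fun s => point w (u s) i j) (point w d i j).
  have D := derD (derD (derZ d1 (axis w o1 i j)) (derZ d2 (axis w o2 i j)))
    (derZ d3 (axis w o3 i j)).
  apply: is_derive_ext D; last by rewrite !mxE; ring.
  by apply: (@filterE _ (nbhs t)) => s; rewrite !mxE; ring.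
have dp : derivable (fun s => point w (u s)) t 1.
  by apply/derivable_mxP => i j; case: (de i j).
split=> //; rewrite derive_mx //; apply/matrixP => i j; rewrite mxE.
by case: (de i j).
Qed.

End Main.

Theorem mainTheorem11 (R : realType) (w : 'I_4 -> 'cV[R]_3)
    (hw : regular_tetrahedron w) :
  property_B (rotation_group (tetrahedron w)) 6.
Proof.
(* Every curve lifts, so the whole orbit space serves as neighbourhood. *)
move=> m sigma gens; exists (orbit_space sigma); split=> //; first exact: withinT.
move=> I c oI _ Hc HU t0 It0.
have nI : near_open I by move=> t It; exact: open_nbhs_nbhs.
have /choice[v0 Hv0] : forall t, exists x, I t -> orbit_map sigma x = c t.
  move=> t; have [It|nIt] := pselect (I t); last by exists 0.
  by have [x _ xc] := HU t It; exists x.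
pose v t := coords w (v0 t).
have rv k : regular 6 I (fun t => tet_inv k (v t)).
  apply: (regular_invariant gens nI Hc Hv0 (polynomial_inv w k)) => A GA x.
  exact: rotation_inv.
have r2 : regular 6 I (fun t => inv2 (v t)) := rv (@Ordinal 5 0 isT).
have r3 : regular 6 I (fun t => inv3 (v t)) := rv (@Ordinal 5 1 isT).
have r4 : regular 6 I (fun t => inv4 (v t)) := rv (@Ordinal 5 2 isT).
have r6a : regular 6 I (fun t => inv6a (v t)) := rv (@Ordinal 5 3 isT).
have r6b : regular 6 I (fun t => inv6b (v t)) := rv (@Ordinal 5 4 isT).
have [u Hu] := tet_lift nI (regularW (isT : 2 <= 6)%N r2) (regularW (isT : 3 <= 6)%N r3)
  (regularW (isT : 4 <= 6)%N r4) r6a r6b.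
have uv t : I t -> [/\ inv2 (u t) = inv2 (v t), inv3 (u t) = inv3 (v t),
    inv4 (u t) = inv4 (v t), inv6a (u t) = inv6a (v t) & inv6b (u t) = inv6b (v t)].
  by move=> /Hu[h _]; apply/tet_invP => k; rewrite -h.
have ext k (f : R * R * R -> R) : (forall t, I t -> f (u t) = f (v t)) ->
    (k <= 6)%N -> regular 6 I (fun t => f (v t)) -> regular k I (fun t => f (u t)).
  move=> fE k6 /(regularW k6); apply: near_open_regular_ext => // t It.
  by rewrite fE.
have r4e : regular 6 I (fun t => inv4e (v t)).
  under eq_fun do rewrite inv4eE.
  exact: (regularM (regularB (regularM r2 r2) r4) (regular_cst 6 I 3^-1)).
have /near_ballP[r r0 Hr] := nI t0 It0.
(* The bound needs the invariants on twice the interval, whence the third of [r]. *)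
have [||||||||C HC] := @lift_derivative_bound R u I t0 (r / 3).
- by rewrite divr_gt0.
- by move=> s /andP[a b]; apply: Hr; rewrite ltr_norml; lra.
- by apply: (ext 2%N) => // t /uv[].
- by apply: (ext 3%N) => // t /uv[].
- by apply: (ext 4%N) => // t /uv[].
- by apply: (ext 4%N) => // t /uv[e2 _ e4 _ _]; rewrite !inv4eE e2 e4.
- by apply: (ext 6%N) => // t /uv[].
- by apply: (ext 6%N) => // t /uv[].
pose J := [set t : R | `|t - t0| < r / 3].
have JI t : J t -> I t by rewrite /J /= => h; apply: Hr; lra.
have du t : J t -> exists2 d, is_derive t 1 u d & `|d| <= C.
  by move=> Jt; have [_ [d dd]] := Hu t (JI t Jt); exists d => //; exact: HC dd.
exists J, (fun t => point w (u t)); split=> //.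
- have -> : J = ball t0 (r / 3); last exact: ball_open.
  by apply/seteqP; split=> t; rewrite /J /ball /= distrC.
- by rewrite /J /= subrr normr0 divr_gt0.
- move=> t Jt; have [s _] := Hu t (JI t Jt).
  have [g ->] := tet_separates s.
  by rewrite (orbit_map_act hw g _ gens) (coordsK hw) Hv0 //; exact: JI.
split=> [t /du[d dd _]|K _ KJ].
  by case: (der_point w dd).
exists (Num.sqrt (3 * C ^+ 2)) => t /KJ /du[d dd dC].
have [_ dE] := der_point w dd.
rewrite derive1E dE -[enorm _]ger0_norm ?sqrtr_ge0 // -sqrtr_sqr.
rewrite (enorm_point hw) ler_wsqrtr //.
have C0 : 0 <= C by apply: le_trans dC.
case: d dd dE dC => [[x y] z] dd _; rewrite /inv2 /= !norm_pair !ge_max.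
move=> /andP[/andP[xC yC] zC].
have sqC (a : R) : `|a| <= C -> a ^+ 2 <= C ^+ 2.
  by move=> aC; rewrite -(real_normK (num_real a)) lerXn2r ?nnegrE.
by have := sqC x xC; have := sqC y yC; have := sqC z zC; lra.
Qed.
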